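(* Let $L$ be a triangulation of the $2$-simplex ($\dim L=2$) such that the only vertices of $L$ on the boundary of the simplex are the original vertices of the simplex, and let $d\ge 1$. Then $\diamondsuit(d,L)\in\mathcal{HS}(2,d)$ and it satisfies $g^{(2)}(\diamondsuit(d,L))\geq 0$ (component-wise).
   Context: Simplicial complexes are finite and abstract, and contain the empty face. $f_i(K)$ is the number of $i$-dimensional faces of $K$; the link of $\sigma\in K$ is $\mathrm{link}_K(\sigma)=\{\tau\in K:\sigma\cap\tau=\emptyset,\ \sigma\cup\tau\in K\}$. For a complex of dimension $d-1$, the $h$-polynomial is $h(K,t)=\sum_{i=0}^{d}h_i t^i$ with $h_i=\sum_{l=0}^{i}(-1)^{i-l}\binom{d-l}{i-l}f_{l-1}(K)$. A missing face of $K$ is a set $F\notin K$ all of whose proper subsets belong to $K$; its dimension is $|F|-1$. $\mathcal{HS}(i,d)$ is the family of $(d-1)$-dimensional homology spheres without missing faces of dimension $>i$. For $d\geq 0$ and a $(d-1)$-dimensional homology sphere $\Delta$ (so $h_l=h_{d-l}$), the vector $g^{(2)}(\Delta)$ is the vector of coefficients when $h(\Delta,t)$ is expressed in the basis $\left(P_{d,2}(t),\,tP_{d-2,2}(t),\ldots,t^{\lfloor d/2\rfloor}P_{d-2\lfloor d/2\rfloor,2}(t)\right)$, where $P_{d,2}(t)=(1+t+t^2)^{d/2}$ for even $d$ and $P_{d,2}(t)=(1+t+t^2)^{(d-1)/2}(1+t)$ for odd $d$. Generalized Tchebyshev triangulation: write $\partial(L)$ for the boundary complex of $L$ (that of the original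 $2$-simplex). A complex $K'$ is a generalized Tchebyshev triangulation of $K$ induced by $L$ if there is an ordered list $\sigma_1,\ldots,\sigma_m$ of all the $2$-dimensional faces of $K$, bijections $\phi_{\sigma_l}$ from the vertices of $\partial(L)$ to $\sigma_l$, and complexes $K_0=K,\ldots,K_m=K'$ such that $K_l$ is obtained from $K_{l-1}$ by replacing the faces $\{\sigma_l\cup\tau:\tau\in\mathrm{link}_{K_{l-1}}(\sigma_l)\}$ by $\{\sigma'\cup\tau:\sigma'\in L_l,\ \tau\in\mathrm{link}_{K_{l-1}}(\sigma_l)\}$, where $L_l$ is a copy of $L$ whose boundary vertices are identified with $\sigma_l$ via $\phi_{\sigma_l}$ and whose interior vertices are new. $\diamondsuit(d)$ is the boundary complex of the $d$-dimensional cross-polytope, and $\diamondsuit(d,L)$ denotes any generalized Tchebyshev triangulation of $\diamondsuit(d)$ induced by $L$. *)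

(* Defs.v *)
From HB Require Import structures.
From mathcomp Require Import all_boot all_order all_algebra.
From mathcomp Require Import reals.

Set Implicit Arguments.
Unset Strict Implicit.
Unset Printing Implicit Defensive.

Import Order.TTheory GRing.Theory Num.Theory.
Local Open Scope ring_scope.

(* A complex is a family of subsets of an ambient finite type V; elements of V
   need not be vertices.  Faces are measured by cardinality (dimension + 1). *)
Section Complexes.
Variable V : finType.
Implicit Types (K : {set {set V}}) (s t F : {set V}).

Definition is_complex K : Prop :=
  set0 \in K /\ forall s t, s \in K -> t \subset s -> t \in K.

Definition vertices K : {set V} := [set v | [set v] \in K].

(* dim K = rk K - 1 *)
Definition rk K : nat := \max_(s in K) #|s|.

Definition link K s : {set {set V}} :=
  [set t in K | (s :&: t == set0) && (s :|: t \in K)].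

(* fcard K l is f_{l-1}(K) *)
Definition fcard K (l : nat) : nat := #|[set s in K | #|s| == l]|.

Definition hcoef K (i : nat) : int :=
  \sum_(l < i.+1) (-1) ^+ (i - l) * 'C(rk K - l, i - l)%:Z * (fcard K l)%:Z.

Definition hpoly K : {poly int} := \poly_(i < (rk K).+1) hcoef K i.

Definition missing_face K F : Prop :=
  F \notin K /\ forall s, s \proper F -> s \in K.

End Complexes.

Section Homology.
Variables (A : comNzRingType) (V : finType).
Implicit Types (K : {set {set V}}) (c b z : {ffun {set V} -> A^o}).

(* Reduced simplicial chains with coefficients in A, faces being oriented by
   the enumeration order of V.  Degrees are shifted by one: degree k stands for
   the faces of cardinality k, so that degree 0 is the empty face. *)
Definition chain K (k : nat) c : Prop :=
  forall s, c s != 0 -> s \in K /\ #|s| = k.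

Definition bdry c : {ffun {set V} -> A^o} :=
  [ffun t : {set V} => \sum_(v : V | v \notin t)
     (-1) ^+ #|[set u in t | (enum_rank u < enum_rank v)%N]| * c (v |: t)].

Definition cycle K (k : nat) c : Prop := chain K k c /\ bdry c = 0.

Definition boundary K (k : nat) b : Prop :=
  exists2 c, chain K k.+1 c & bdry c = b.

(* Reduced homology of the (n-1)-sphere: it vanishes outside (shifted) degree n,
   where it is free of rank one on the class of z. *)
Definition sphere_homology K (n : nat) : Prop :=
  (forall k c, k <> n -> cycle K k c -> boundary K k c) /\
  exists z, [/\ cycle K n z,
    forall c, cycle K n c -> exists a : A, boundary K n (c - a *: z) &
    forall a : A, boundary K n (a *: z) -> a = 0].

(* (d-1)-dimensional homology sphere over A *)
Definition homology_sphere (d : nat) K : Prop :=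
  [/\ is_complex K, rk K = d &
      forall s, s \in K -> sphere_homology (link K s) (d - #|s|)].

Definition HS (i d : nat) K : Prop :=
  homology_sphere d K /\ forall F, missing_face K F -> (#|F| <= i.+1)%N.

End Homology.

Definition P2 (d : nat) : {poly int} :=
  (1 + 'X + 'X^2) ^+ d./2 * (1 + 'X) ^+ odd d.

Definition is_g2 (V : finType) (d : nat) (K : {set {set V}})
    (g : 'I_(d./2).+1 -> int) : Prop :=
  hpoly K = \sum_(k < (d./2).+1) g k *: ('X^k * P2 (d - k.*2)).

Arguments is_g2 {V} d K g.

Lemma coef0_P2 d : (P2 d)`_0 = 1.
Proof. by rewrite -horner_coef0 /P2 !hornerE /= !expr1n mulr1. Qed.

Lemma is_g2_inj (V : finType) (d : nat) (K : {set {set V}})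
    (g g' : 'I_(d./2).+1 -> int) : is_g2 d K g -> is_g2 d K g' -> g =1 g'.
Proof.
rewrite /is_g2 => -> /esym E k; move: {2}(k : nat).+1 (ltnSn k) => n.
elim: n k => // n IH k; rewrite ltnS => kn.
have /(congr1 (fun p : {poly int} => p`_k)) := E.
rewrite !coef_sum (bigD1 k) //= [in RHS](bigD1 k) //=.
rewrite !coefZ coefXnM ltnn subnn coef0_P2 !mulr1.
rewrite (eq_bigr (fun i : 'I__ => (g i *: ('X^i * P2 (d - i.*2)))`_k)); last first.
  move=> i ik; rewrite !coefZ coefXnM; case: ltnP => ki; first by rewrite !mulr0.
  rewrite IH // (leq_trans _ kn) // ltn_neqAle ki andbT.
  by apply: contra ik => /eqP /val_inj ->.
by move/addIr.
Qed.

Section Geometry.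
Variables (R : realType) (W : finType) (n : nat).
Implicit Types (L : {set {set W}}) (s : {set W}) (pos : W -> 'rV[R]_n.+1).

(* The n-simplex is the standard one, with vertices the unit vectors of
   R^(n+1), so that the coordinates of a point are barycentric. *)
Definition in_simplex (x : 'rV[R]_n.+1) : Prop :=
  (forall i, 0 <= x 0 i) /\ \sum_i x 0 i = 1.

(* x lies in the convex hull of the points pos v, v \in s *)
Definition in_hull pos s (x : 'rV[R]_n.+1) : Prop :=
  exists a : W -> R, [/\ forall v, 0 <= a v, \sum_(v in s) a v = 1 &
    x = \sum_(v in s) a v *: pos v].

Definition affinely_independent pos s : Prop :=
  forall a : W -> R, \sum_(v in s) a v = 0 ->
    \sum_(v in s) a v *: pos v = 0 -> forall v, v \in s -> a v = 0.

(* L, with vertex v placed at pos v, is a (geometric) simplicial complex whose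
   underlying space is the n-simplex. *)
Definition triangulates_simplex L pos : Prop :=
  [/\ is_complex L,
      forall s, s \in L -> affinely_independent pos s,
      forall s t x, s \in L -> t \in L ->
        in_hull pos s x -> in_hull pos t x -> in_hull pos (s :&: t) x &
      forall x, in_simplex x <-> exists2 s, s \in L & in_hull pos s x].

(* the faces of L contained in a facet x_i = 0 of the n-simplex *)
Definition boundary_complex L pos : {set {set W}} :=
  [set s in L | [exists i, [forall v in s, pos v 0 i == 0]]].

Definition only_original_boundary_vertices L pos : Prop :=
  forall v, v \in vertices (boundary_complex L pos) ->
    exists i, pos v = delta_mx 0 i.

End Geometry.

Section Tchebyshev.
Variables (W V : finType).

(* K2 is obtained from K1 by replacing the face s by a copy of L, whose boundary
   complex is B.  The map psi labels the copy: its restriction to the vertices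
   of B is the bijection phi_s, and interior vertices of L get new labels. *)
Definition tcheb_step (L B : {set {set W}}) (s : {set V})
    (K1 K2 : {set {set V}}) : Prop :=
  exists psi : W -> V,
  [/\ {in vertices L &, injective psi},
      psi @: vertices B = s,
      forall v, v \in vertices L -> v \notin vertices B ->
        psi v \notin vertices K1 &
      K2 = (K1 :\: [set s :|: t | t in link K1 s])
           :|: [set (psi @: (r : {set W})) :|: t | r in L, t in link K1 s]].

Definition gen_tchebyshev (L B : {set {set W}}) (K K' : {set {set V}}) : Prop :=
  exists (sigma : seq {set V}) (Ks : nat -> {set {set V}}),
  [/\ uniq sigma,
      forall s, (s \in sigma) = (s \in K) && (#|s| == 3),
      Ks 0%N = K, Ks (size sigma) = K' &
      forall l, (l < size sigma)%N ->
        tcheb_step L B (nth set0 sigma l) (Ks l) (Ks l.+1)].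

End Tchebyshev.

(* The vertex (i, b) is the unit vector e_i or its opposite, according to b. *)
Definition cross_polytope (d : nat) : {set {set 'I_d * bool}} :=
  [set s : {set 'I_d * bool} | [forall i, ~~ (((i, true) \in s) && ((i, false) \in s))]].

Definition is_cross_polytope (V : finType) (d : nat) (K : {set {set V}}) : Prop :=
  exists2 iota : 'I_d * bool -> V,
    injective iota & K = [set iota @: s | s : {set 'I_d * bool} in cross_polytope d].

(* Main.v *)
(* One step K1 -> K2 replaces sigma * Lam, where Lam is the link of sigma, by
   L * Lam.  Both joins are acyclic and have the same complement, so that the
   links of old faces keep their homology, and h(link s) increases by a product
   (h(link_L r) - 1) h(link_K1 (sigma :|: u)); the link of a new face is the join
   of a small sphere of L with a link of K1.  By induction on the steps, all links
   remain homology spheres with nonnegative g^(2): the polynomials with this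
   property are closed under products, and the factors coming from L are
   n t(1+t), n t and 0 for boundary faces (n >= 0), and 1, 1+t and
   (1+t+t^2) + n t for interior ones.

   That L is a disc whose links are paths and cycles is obtained from the fans
   around its vertices: walking from triangle to triangle shows that links (and
   their halves cut out by a line) are connected, and each neighbour has at most
   one successor in the positive direction, which counts the edges.  Sweeping
   the triangle by a generic linear form then reduces L to nothing. *)
From HB Require Import structures.
Require Import Defs.
From mathcomp Require Import all_boot all_order all_algebra.
From mathcomp Require Import boolp reals.
From mathcomp Require Import ring lra zify.

Set Implicit Arguments.
Unset Strict Implicit.
Unset Printing Implicit Defensive.

Import Order.TTheory GRing.Theory Num.Theory.
Local Open Scope ring_scope.

(** * Relative homology of families of sets *)

(** Homology is defined for families of sets that need not be complexes (they stand for quotients of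
    complexes), so that an acyclic piece can be discarded and the remainder treated again. Such
    removals are purely combinatorial: one reduction serves every coefficient ring, and it also
    preserves the Euler characteristic, from which the face numbers of [L] and of its links follow.

    The induction has to carry the claim for all links at once, because the increment of the
    h-polynomial at a face [s] has the h-polynomial of another link, that of [sigma :|: u], as a
    factor.

    On the geometric side, barycentric coordinates are read as homogeneous ones. A face then spans a
    cone in the nonnegative octant of R^3, points need no normalisation, and the sign of a 3 by 3
    determinant tells the side of a line on which a point lies. Angles and the topology of the plane
    never appear: only the finitely many triangles around a vertex are walked through. *)

Section RelativeHomology.
Variables (A : comNzRingType) (V : finType).
Implicit Types (F G : {set {set V}}) (s t : {set V}) (v w : V).
Implicit Types (b c : {ffun {set V} -> A^o}).

Definition incid t v : A :=
  (-1) ^+ #|[set u in t | (enum_rank u < enum_rank v)%N]|.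

Lemma bdryE c t : bdry c t = \sum_(v | v \notin t) incid t v * c (v |: t).
Proof. by rewrite ffunE. Qed.

Lemma chainB_at b c t : (b - c) t = b t - c t.
Proof. by rewrite !ffunE. Qed.

Lemma chainD_at b c t : (b + c) t = b t + c t.
Proof. by rewrite !ffunE. Qed.

Lemma chainZ_at (a : A) c t : (a *: c) t = a * c t.
Proof. by rewrite !ffunE. Qed.

Lemma chainN_at c t : (- c) t = - c t.
Proof. by rewrite ffunE. Qed.

Lemma incidK t v : incid t v * incid t v = 1.
Proof. by rewrite /incid -exprMn mulrNN mulr1 expr1n. Qed.

Lemma incidU t v w : v \notin t ->
  incid (v |: t) w = (-1) ^+ (enum_rank v < enum_rank w)%N * incid t w.
Proof.
move=> vt; rewrite /incid -exprD; congr (_ ^+ _).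
have [vw|vw] := boolP (enum_rank v < enum_rank w)%N.
  rewrite (_ : [set u in _ | _] = v |: [set u in t | (enum_rank u < enum_rank w)%N]).
    by rewrite cardsU1 !inE (negbTE vt).
  by apply/setP => u; rewrite !inE; case: eqP => // ->.
apply: eq_card => u; rewrite !inE; case: eqP => // ->.
by rewrite (negbTE vw) !andbF.
Qed.

Lemma sign_rankC v w : v != w ->
  (-1) ^+ (enum_rank v < enum_rank w)%N =
  - (-1) ^+ (enum_rank w < enum_rank v)%N :> A.
Proof.
move=> vw; case: (ltngtP (enum_rank v) (enum_rank w)) => //=.
all: rewrite ?expr0 ?expr1 ?opprK //.
by move=> /val_inj /enum_rank_inj E; rewrite E eqxx in vw.
Qed.

Lemma bdryB b c : bdry (b - c) = bdry b - bdry c.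
Proof.
apply/ffunP => t; rewrite !ffunE -sumrB; apply: eq_bigr => v _.
by rewrite !ffunE mulrBr.
Qed.

Lemma bdryZ (a : A) c : bdry (a *: c) = a *: bdry c.
Proof.
apply/ffunP => t; rewrite !ffunE scaler_sumr; apply: eq_bigr => v _.
by rewrite !ffunE /GRing.scale /= mulrCA.
Qed.

Lemma bdry0 : bdry 0 = 0 :> {ffun {set V} -> A^o}.
Proof. by have := bdryB 0 0; rewrite !subrr. Qed.

Lemma bdryN c : bdry (- c) = - bdry c.
Proof. by rewrite -[- c]sub0r bdryB bdry0 sub0r. Qed.

Lemma bdryD b c : bdry (b + c) = bdry b + bdry c.
Proof. by rewrite -[c in LHS]opprK bdryB bdryN opprK. Qed.

Lemma bdry_bdry c : bdry (bdry c) = 0.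
Proof.
apply/ffunP => t; rewrite [RHS]ffunE bdryE.
pose T v w : A := (-1) ^+ (enum_rank v < enum_rank w)%N *
  (incid t v * incid t w * c (w |: (v |: t))).
pose P (p : V * V) := [&& p.1 \notin t, p.2 \notin t & p.1 != p.2].
transitivity (\sum_(p | P p) T p.1 p.2).
  under eq_bigr => v vt do rewrite bdryE mulr_sumr.
  rewrite pair_big_dep /=; apply: eq_big => [[v w]|[v w]] /=; rewrite /P /=.
    rewrite !inE negb_or; case: (v \in t) => //=; rewrite andbC.
    by rewrite [w == v]eq_sym.
  by move=> /andP [vt _]; rewrite (incidU _ vt) /T; ring.
(* Pairs with [v] before [w] are matched with the swapped pairs, whose terms have the opposite
   sign. *)
rewrite (bigID (fun p : V * V => (enum_rank p.1 < enum_rank p.2)%N)) /=.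
rewrite [X in _ + X](reindex_inj (h := fun p => (p.2, p.1))) /=; last first.
  by move=> [v w] [v' w'] /= [-> ->].
rewrite [X in _ + X](_ : _ =
  \sum_(p | P p && (enum_rank p.1 < enum_rank p.2)%N) (- T p.1 p.2)).
  by rewrite sumrN subrr.
apply: eq_big => [[v w]|[v w]] /=; rewrite /P /=.
  rewrite andbCA [w == v]eq_sym -!andbA; congr [&& _, _ & _].
  case: eqVneq => //= vw; case: ltngtP => // /val_inj /enum_rank_inj E.
  by rewrite E eqxx in vw.
move=> /andP[/and3P[_ _ wv] _]; rewrite /T (sign_rankC wv) setUCA.
by ring.
Qed.

Definition cone v c : {ffun {set V} -> A^o} :=
  [ffun s : {set V} => if v \in s then incid (s :\ v) v * c (s :\ v) else 0].

Lemma coneE v c t : v \notin t -> cone v c (v |: t) = incid t v * c t.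
Proof. by move=> vt; rewrite ffunE setU11 setU1K. Qed.

(** Coning with apex [v] is a contracting homotopy on all chains. It discards the part of [c] on
    sets that contain [v]; that part comes back through [bdry c] evaluated at the sets without
    [v]. *)
Lemma bdry_cone v c : bdry (cone v c) = c - cone v (bdry c).
Proof.
apply/ffunP => t; rewrite bdryE chainB_at.
have [vt|vt] := boolP (v \in t); last first.
  rewrite (bigD1 v) //= big1 ?addr0 => [|w /andP[wt wv]].
    by rewrite coneE // [cone _ _ t]ffunE (negbTE vt) subr0 mulrA incidK mul1r.
  by rewrite ffunE !inE (negbTE vt) eq_sym (negbTE wv) mulr0.
have [s vs ->] : exists2 s : {set V}, v \notin s & t = v |: s.
  by exists (t :\ v); rewrite ?setD11 ?setD1K.
rewrite coneE // bdryE [in RHS](bigD1 v) //= mulrDr mulrA incidK mul1r.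
rewrite opprD addrA subrr add0r mulr_sumr -sumrN.
apply: eq_big => [w|w]; rewrite !inE negb_or andbC //.
move=> /andP[ws wv]; rewrite setUCA coneE ?inE ?negb_or ?vs ?andbT 1?eq_sym //.
rewrite (incidU _ vs) (incidU _ ws) (sign_rankC wv).
set e := _ ^+ nat_of_bool _; have e2 : e * e = 1.
  by rewrite /e -exprMn mulrNN mulr1 expr1n.
by rewrite -[RHS]mulr1 -e2; ring.
Qed.

Lemma chain_out F k c t : chain F k c -> t \notin F -> c t = 0.
Proof. by move=> Fc tF; apply/eqP; apply: contraNT tF => /Fc[]. Qed.

Lemma chain_card F k c t : chain F k c -> #|t| != k -> c t = 0.
Proof. by move=> Fc tF; apply/eqP; apply: contraNT tF => /Fc[_ ->]. Qed.

Lemma chainB F k b c : chain F k b -> chain F k c -> chain F k (b - c).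
Proof.
move=> Fb Fc t; rewrite chainB_at; have [bt|/Fb//] := eqVneq (b t) 0.
by rewrite bt sub0r oppr_eq0 => /Fc.
Qed.

Lemma chainD F k b c : chain F k b -> chain F k c -> chain F k (b + c).
Proof.
move=> Fb Fc t; rewrite chainD_at; have [bt|/Fb//] := eqVneq (b t) 0.
by rewrite bt add0r => /Fc.
Qed.

Lemma chainZ F k (a : A) c : chain F k c -> chain F k (a *: c).
Proof.
move=> Fc t; rewrite chainZ_at; have [ct|/Fc//] := eqVneq (c t) 0.
by rewrite ct mulr0 eqxx.
Qed.

Lemma chain_sub F G k c : G \subset F -> chain G k c -> chain F k c.
Proof. by move=> /subsetP GF Gc t /Gc[/GF]. Qed.

Definition restrict F c : {ffun {set V} -> A^o} :=
  [ffun s => if s \in F then c s else 0].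

Lemma restrictE F c t : restrict F c t = if t \in F then c t else 0.
Proof. by rewrite ffunE. Qed.

Lemma chain_restrict F G k c : chain F k c -> chain (F :&: G) k (restrict G c).
Proof.
move=> Fc t; rewrite restrictE; case: ifP => [tG /Fc[tF ->]|]; last by rewrite eqxx.
by rewrite inE tF.
Qed.

Lemma bdry_at_eq b c t : (forall v, v \notin t -> b (v |: t) = c (v |: t)) ->
  bdry b t = bdry c t.
Proof. by move=> bc; rewrite !bdryE; apply: eq_bigr => v /bc ->. Qed.

Lemma bdry_at0 b t : (forall v, v \notin t -> b (v |: t) = 0) -> bdry b t = 0.
Proof. by move=> b0; rewrite bdryE big1 // => v /b0 ->; rewrite mulr0. Qed.

Lemma chain_bdry_card F k c t : chain F k.+1 c -> #|t| != k -> bdry c t = 0.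
Proof.
move=> Fc tk; apply: bdry_at0 => v vt; apply: (chain_card Fc).
by rewrite cardsU1 vt add1n eqSS.
Qed.

(* Homology of a family F of sets seen as the quotient of a complex by a
   subcomplex: the boundary is read off on F only. *)
Definition rcycle F (k : nat) c : Prop :=
  chain F k c /\ forall t, t \in F -> bdry c t = 0.

Definition rbound F (k : nat) b : Prop :=
  exists2 c, chain F k.+1 c & forall t, t \in F -> bdry c t = b t.

Definition rsphere F (n : nat) : Prop :=
  (forall k c, k <> n -> rcycle F k c -> rbound F k c) /\
  exists z, [/\ rcycle F n z,
    forall c, rcycle F n c -> exists a : A, rbound F n (c - a *: z) &
    forall a : A, rbound F n (a *: z) -> a = 0].

Definition racyclic F : Prop := forall k c, rcycle F k c -> rbound F k c.

Lemma rboundD F k b c : rbound F k b -> rbound F k c -> rbound F k (b + c).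
Proof.
move=> [x Fx xb] [y Fy yc]; exists (x + y); first exact: chainD.
by move=> t tF; rewrite bdryD !chainD_at xb ?yc.
Qed.

Lemma rboundZ F k (a : A) c : rbound F k c -> rbound F k (a *: c).
Proof.
move=> [x Fx xb]; exists (a *: x); first exact: chainZ.
by move=> t tF; rewrite bdryZ !chainZ_at xb.
Qed.

Lemma rcycleB F k b c : rcycle F k b -> rcycle F k c -> rcycle F k (b - c).
Proof.
move=> [Fb b0] [Fc c0]; split; first exact: chainB.
by move=> t tF; rewrite bdryB chainB_at b0 ?c0 ?subrr.
Qed.

Lemma rcycleZ F k (a : A) c : rcycle F k c -> rcycle F k (a *: c).
Proof.
move=> [Fc c0]; split; first exact: chainZ.
by move=> t tF; rewrite bdryZ chainZ_at c0 ?mulr0.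
Qed.

Section Transfer.
Variables (F F' : {set {set V}}) (j : nat).
Variable phi : {ffun {set V} -> A^o} -> {ffun {set V} -> A^o}.
Hypothesis phiB : forall b c, phi (b - c) = phi b - phi c.
Hypothesis phiZ : forall (a : A) c, phi (a *: c) = a *: phi c.
Hypothesis phi_cycle : forall k c, rcycle F k c -> rcycle F' (k + j) (phi c).
Hypothesis phi_bound : forall k c, rbound F k c -> rbound F' (k + j) (phi c).
Hypothesis phi_inj :
  forall k c, rcycle F k c -> rbound F' (k + j) (phi c) -> rbound F k c.
Hypothesis phi_low : forall k u, (k < j)%N -> rcycle F' k u -> rbound F' k u.
Hypothesis phi_surj : forall k u, rcycle F' (k + j) u ->
  exists2 c, rcycle F k c & rbound F' (k + j) (u - phi c).

(** [phi] induces isomorphisms of homology that raise the degree by [j], and [F'] has no homology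
    below [j]. A generator on the side of [F'] need not be an image; a cycle whose image is
    homologous to it is used instead. *)
Lemma transfer_sphere n : rsphere F n <-> rsphere F' (n + j).
Proof.
split=> [[ex [z [zc zg z1]]]|[ex [z' [zc' zg z1]]]].
  split=> [k u kn uc|].
    have [kj|jk] := ltnP k j; first exact: phi_low.
    rewrite -(subnK jk) in kn uc *.
    have [c cc uB] := phi_surj uc; rewrite -[u](subrK (phi c)).
    by apply: rboundD uB _; apply/phi_bound/ex => // kE; rewrite kE in kn.
  exists (phi z); split=> [|u uc|a aB]; first exact: phi_cycle.
    have [c cc uB] := phi_surj uc; have [a aB] := zg _ cc.
    exists a; rewrite -[u](subrK (phi c)) -addrA -phiZ -phiB.
    by apply: rboundD uB (phi_bound aB).
  by apply: z1; apply: phi_inj; [apply: rcycleZ|rewrite phiZ].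
have [z cz zB] := phi_surj zc'.
split=> [k c kn cc|].
  by apply: (phi_inj cc); apply: ex (phi_cycle cc) => /addIn.
exists z; split=> // [c cc|a aB].
  have [a aB] := zg _ (phi_cycle cc); exists a.
  apply: phi_inj; first by apply: rcycleB => //; apply: rcycleZ.
  rewrite phiB phiZ (_ : _ - _ = phi c - a *: z' + a *: (z' - phi z)).
    by apply/rboundD/rboundZ.
  by rewrite scalerBr addrA subrK.
apply: z1; rewrite -[z'](subrK (phi z)) scalerDr.
by apply: rboundD; [exact: rboundZ|rewrite -phiZ; exact: phi_bound].
Qed.

End Transfer.

Definition convex F :=
  forall s t u, s \in F -> u \in F -> s \subset t -> t \subset u -> t \in F.

(** Seen in the quotient complex [F], such a [G] is a subcomplex and [F :\: G] the quotient by
    it. *)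
Definition lower F G := forall s t, s \in F -> t \in G -> s \subset t -> s \in G.

Definition toggled v G :=
  forall s, s \in G -> v |: s \in G /\ s :\ v \in G.

(** The cone with apex [v] stays inside [G], so it contracts every relative cycle. *)
Lemma toggled_racyclic v G : toggled v G -> racyclic G.
Proof.
move=> tG k c [Gc c0]; exists (cone v c) => [s|t Gt].
  rewrite ffunE; case: ifP => [vs|_]; last by rewrite eqxx.
  have [cs|cs _] := eqVneq (c (s :\ v)) 0; first by rewrite cs mulr0 eqxx.
  have [/tG[]] := Gc _ cs; rewrite setD1K // => sG _ <-.
  by rewrite (cardsD1 v s) vs.
rewrite bdry_cone chainB_at ffunE; case: ifP => [vt|_]; last by rewrite subr0.
by rewrite c0 ?mulr0 ?subr0 //; apply: (tG _ Gt).2.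
Qed.

(** This is the long exact sequence of the pair for an acyclic subcomplex [G], written out on
    chains; the isomorphism is the projection onto the quotient, that is, [restrict U]. *)
Lemma rsphere_setD F G n : convex F -> G \subset F -> lower F G -> racyclic G ->
  rsphere F n <-> rsphere (F :\: G) n.
Proof.
move=> cF GF lG aG; rewrite -[X in _ <-> rsphere _ X]addn0.
set U := F :\: G; have UF : U \subset F by apply: subsetDl.
have Uup t v c k : chain F k c -> t \in U -> restrict U c (v |: t) = c (v |: t).
  move=> Fc; rewrite restrictE inE => /andP[tG tF].
  have [//|] := boolP (v |: t \in U).
  rewrite inE negb_and negbK => /orP[vG|/(chain_out Fc) -> //].
  by rewrite (lG t _ tF vG (subsetUr _ _)) in tG.
have bU t c k : chain F k c -> t \in U -> bdry (restrict U c) t = bdry c t.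
  by move=> Fc tU; apply: bdry_at_eq => v _; apply: Uup Fc tU.
have rU c k : chain F k c -> chain U k (restrict U c).
  by move=> /(@chain_restrict _ U); rewrite setIC (setIidPl UF).
have bGU t (e : {ffun {set V} -> A^o}) k : chain G k e -> t \in U -> bdry e t = 0.
  move=> Ge; rewrite inE => /andP[tG tF]; apply: bdry_at0 => v _.
  by apply: (chain_out Ge); apply: contra tG => /(lG t) -> //; apply: subsetUr.
have bout t c k : chain F k c -> t \notin F ->
    (exists2 s, s \in F & s \subset t) -> bdry c t = 0.
  move=> Fc tF [s sF st]; apply: bdry_at0 => v _; apply: (chain_out Fc).
  by apply: contra tF => vF; apply: (cF s t (v |: t)) => //; apply: subsetUr.
apply: (@transfer_sphere F U 0 (restrict U)) => //= [b c|a c|k c|k c|k c|k u].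
- by apply/ffunP => t; rewrite !(ffunE, chainB_at); case: ifP; rewrite ?subrr ?subr0.
- by apply/ffunP => t; rewrite !(ffunE, chainZ_at); case: ifP; rewrite ?mulr0 ?scaler0.
- move=> [Fc c0]; rewrite addn0; split=> [|t tU]; first exact: rU.
  by rewrite (bU _ _ _ Fc) // c0 // (subsetP UF).
- move=> [x Fx xc]; rewrite addn0; exists (restrict U x) => [|t tU]; first exact: rU.
  by rewrite (bU _ _ _ Fx) // xc ?(subsetP UF) // restrictE tU.
- move=> [Fc c0]; rewrite addn0 => -[u Uu ub].
  have Fu := chain_sub UF Uu.
  (* [u] bounds [c] outside [G], so the defect [w] is a cycle of [G]; a chain [e] of [G] that bounds
     it corrects [u]. *)
  pose w := c - restrict F (bdry u).
  have Gw : chain G k w.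
    have Fw : chain F k w.
      apply: chainB => // s; rewrite restrictE; case: ifP => [sF bs|]; last by rewrite eqxx.
      split=> //; apply/eqP; apply: contraNT bs => sk.
      by rewrite (chain_bdry_card Uu) // eqxx.
    move=> s ws; have [sF sk] := Fw _ ws; split=> //.
    apply: contraNT ws => sG; have sU : s \in U by rewrite inE sG.
    by rewrite /w chainB_at restrictE sF ub // restrictE sU subrr.
  have [|e Ge eb] := aG k w.
    split=> // t tG; have tF := subsetP GF _ tG.
    rewrite /w bdryB chainB_at c0 // sub0r.
    rewrite (@bdry_at_eq _ (bdry u)) ?bdry_bdry ?ffunE ?oppr0 // => v _.
    rewrite restrictE; case: ifPn => // vF; rewrite (bout _ _ _ Fu) //.
    by exists t => //; apply: subsetUr.
  exists (u + e) => [|t tF]; first by apply: chainD => //; apply: (chain_sub GF).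
  rewrite bdryD chainD_at; have [tG|tG] := boolP (t \in G).
    by rewrite eb // /w chainB_at restrictE tF addrCA subrr addr0.
  have tU : t \in U by rewrite inE tG.
  by rewrite ub // restrictE tU (bGU _ _ _ Ge) // addr0.
rewrite addn0 => -[Uu u0]; have Fu := chain_sub UF Uu.
(* In degree 0 there is no boundary to correct, and [u] is already a cycle of [F]. *)
case: k Uu Fu => [|k] Uu Fu.
  exists u; last first.
    exists 0 => [t|t tU]; first by rewrite ffunE eqxx.
    by rewrite bdry0 !ffunE tU subrr.
  split=> // t tF; apply: bdry_at0 => v vt; apply: (chain_card Fu).
  by rewrite cardsU1 vt.
(* [w] represents the connecting map at [u]. It bounds some [e] in [G], and [u - e] is a cycle of
   [F] that lifts [u]. *)
pose w := restrict G (bdry u).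
have [|e Ge eb] := aG k w.
  split=> [s|t tG].
    rewrite restrictE; case: ifP => [sG bs|]; last by rewrite eqxx.
    split=> //; apply/eqP; apply: contraNT bs => sk.
    by rewrite (chain_bdry_card Uu) // eqxx.
  have tF := subsetP GF _ tG.
  rewrite /w (@bdry_at_eq _ (bdry u)) ?bdry_bdry ?ffunE // => v _.
  rewrite restrictE; case: ifPn => // vG.
  have [vF|vF] := boolP (v |: t \in F); first by rewrite u0 // inE vG.
  by rewrite (bout _ _ _ Fu) //; exists t => //; apply: subsetUr.
have Fe := chain_sub GF Ge.
exists (u - e).
  split=> [|t tF]; first exact: chainB.
  rewrite bdryB chainB_at; have [tG|tG] := boolP (t \in G).
    by rewrite eb // restrictE tG subrr.
  have tU : t \in U by rewrite inE tG.
  by rewrite (bGU _ _ _ Ge) // u0 // subrr.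
exists 0 => [t|t tU]; first by rewrite ffunE eqxx.
rewrite bdry0 !(chainB_at, restrictE) tU ffunE (chain_out Ge) ?subr0 ?subrr //.
by move: tU; rewrite inE => /andP[].
Qed.

(** In a complex the boundary of a chain has no coefficient outside the complex, so reading it on
    [F] only loses nothing. *)
Lemma rsphereP F n : is_complex F -> rsphere F n <-> sphere_homology A F n.
Proof.
move=> [F0 Fsub].
have out c k t : chain F k c -> t \notin F -> bdry c t = 0.
  move=> Fc tF; apply: bdry_at0 => v _; apply: (chain_out Fc).
  by apply: contra tF => /Fsub; apply; apply: subsetUr.
have cycE k c : Defs.cycle F k c <-> rcycle F k c.
  split=> -[Fc c0]; split=> //; first by move=> t _; rewrite c0 ffunE.
  apply/ffunP => t; rewrite [RHS]ffunE.
  by have [/c0//|/(out _ _ _ Fc)] := boolP (t \in F).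
have bndE k c : chain F k c -> boundary F k c <-> rbound F k c.
  move=> Fc; split=> -[x Fx xc]; exists x => //; first by move=> t _; rewrite xc.
  apply/ffunP => t; have [/xc//|tF] := boolP (t \in F).
  by rewrite (out _ _ _ Fx) // (chain_out Fc).
split=> -[ex [z [zc zg z1]]]; split.
- move=> k c kn /cycE cc; apply/(bndE _ _ cc.1); exact: ex.
- exists z; split=> [|c /cycE cc|a].
  + exact/cycE.
  + by have [a aB] := zg _ cc; exists a; apply/bndE => //; apply: chainB cc.1 _; apply/chainZ/zc.1.
  + by move=> aB; apply: z1; apply/bndE => //; apply: chainZ zc.1.
- move=> k c kn cc; apply/(bndE _ _ cc.1); apply: ex => //; exact/cycE.
exists z; split=> [|c /cycE cc|a].
+ exact/cycE.
+ by have [a aB] := zg _ cc; exists a; apply/bndE => //; apply: chainB cc.1 _; apply/chainZ/zc.1.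
+ by move=> aB; apply: z1; apply/bndE => //; apply: chainZ zc.1.
Qed.

(** On sets of the form [v |: t], coning commutes with the boundary up to sign and is a bijection of
    chains that raises the degree by one. *)
Lemma rsphere_shift F v n : (forall s, s \in F -> v \notin s) ->
  rsphere F n <-> rsphere [set v |: s | s in F] n.+1.
Proof.
move=> vF; set F' := imset _ _; rewrite -[X in rsphere F' X]addn1.
have F'P s : s \in F' -> exists2 t, t \in F & s = v |: t.
  by move=> /imsetP[t tF ->]; exists t.
have memF' t : t \in F -> v |: t \in F' by apply: imset_f.
have ch k c : chain F k c -> chain F' k.+1 (cone v c).
  move=> Fc s; rewrite ffunE; case: ifP => [vs|_]; last by rewrite eqxx.
  have [cs|cs _] := eqVneq (c (s :\ v)) 0; first by rewrite cs mulr0 eqxx.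
  have [sF <-] := Fc _ cs; rewrite [in #|s|](cardsD1 v s) vs; split=> //.
  by rewrite -(setD1K vs); apply: memF'.
have at_F' k c t : chain F k c -> t \in F ->
    bdry (cone v c) (v |: t) = - (incid t v * bdry c t).
  move=> Fc tF; rewrite bdry_cone chainB_at coneE ?vF // (chain_out Fc) ?sub0r //.
  by apply/negP => /vF; rewrite setU11.
(* The inverse of coning; it carries the same sign because [incid t v] squares to 1. *)
pose unc c : {ffun {set V} -> A^o} :=
  [ffun t : {set V} => if v \in t then 0 else incid t v * c (v |: t)].
have uch k c : chain F' k.+1 c -> chain F k (unc c).
  move=> Fc s; rewrite ffunE; case: ifPn => [vs|vs]; first by rewrite eqxx.
  have [cs|cs _] := eqVneq (c (v |: s)) 0; first by rewrite cs mulr0 eqxx.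
  have [/F'P[t tF st]] := Fc _ cs; rewrite cardsU1 vs => -[<-]; split=> //.
  by rewrite -(setU1K vs) st setU1K // vF.
have uncK k c : chain F' k c -> cone v (unc c) = c.
  move=> Fc; apply/ffunP => s; rewrite ffunE; case: ifPn => vs.
    by rewrite ffunE setD11 setD1K // mulrA incidK mul1r.
  by rewrite (chain_out Fc) //; apply/negP => /F'P[t _ E]; rewrite E setU11 in vs.
have coneB b c : cone v (b - c) = cone v b - cone v c.
  apply/ffunP => s; rewrite !(ffunE, chainB_at).
  by case: ifP; rewrite ?subrr ?mulrBr.
have coneZ (a : A) c : cone v (a *: c) = a *: cone v c.
  apply/ffunP => s; rewrite !(ffunE, chainZ_at) /GRing.scale /=.
  by case: ifP; rewrite ?mulr0 // mulrCA.
have bnd k c : chain F k c -> rbound F' k.+1 (cone v c) <-> rbound F k c.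
  move=> Fc; split=> [[x Fx xc]|[x Fx xc]].
    exists (- unc x) => [|t tF].
      by rewrite -scaleN1r; apply/chainZ/uch.
    have := xc _ (memF' _ tF); rewrite -{1}(uncK _ _ Fx) (at_F' _ _ _ (uch _ _ Fx)) //.
    rewrite coneE ?vF // bdryN chainN_at => /(congr1 ( *%R (incid t v))).
    by rewrite -mulrN !mulrA !incidK !mul1r.
  exists (- cone v x) => [|_ /F'P[t tF ->]].
    by rewrite -scaleN1r; apply/chainZ/ch.
  by rewrite bdryN chainN_at (at_F' _ _ _ Fx) // opprK xc // coneE ?vF.
have cyc k c : chain F k c -> rcycle F' k.+1 (cone v c) <-> rcycle F k c.
  move=> Fc; split=> -[_ c0]; split=> //; last 2 first.
  - exact: ch.
  - by move=> _ /F'P[t tF ->]; rewrite (at_F' _ _ _ Fc) // c0 // mulr0 oppr0.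
  move=> t tF; have /eqP := c0 _ (memF' _ tF); rewrite (at_F' _ _ _ Fc) // oppr_eq0.
  by move=> /eqP /(congr1 ( *%R (incid t v))); rewrite mulrA incidK mul1r mulr0.
apply: (@transfer_sphere F F' 1 (cone v)) => // [k c cc|k c|k c cc|k u|k u uc].
- by rewrite addn1; apply/cyc => //; apply: cc.1.
- rewrite addn1 => -[x Fx xc]; exists (- cone v x) => [|_ /F'P[t tF ->]].
    by rewrite -scaleN1r; apply/chainZ/ch.
  by rewrite bdryN chainN_at (at_F' _ _ _ Fx) // opprK xc // coneE ?vF.
- by rewrite addn1 => /(bnd _ _ cc.1).
- rewrite ltnS leqn0 => /eqP -> [Fu _]; exists 0 => [t|t tF]; first by rewrite ffunE eqxx.
  rewrite bdry0 ffunE (chain_card Fu) //.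
  by have [s _ ->] := F'P _ tF; rewrite -lt0n (cardsD1 v) setU11.
rewrite addn1 in uc *; exists (unc u).
  by apply/cyc; [apply: uch uc.1|rewrite (uncK _ _ uc.1)].
rewrite (uncK _ _ uc.1) subrr; exists 0 => [t|t _]; first by rewrite ffunE eqxx.
by rewrite bdry0.
Qed.

End RelativeHomology.

(** * Reductions and joins *)

Section Reduction.
Variable V : finType.
Implicit Types (F G : {set {set V}}) (r s t : {set V}) (v w : V).

(* A discrete Morse reduction: the toggled lower families that are removed one
   after the other carry no homology, so that F and F' have the same. *)
Inductive red : {set {set V}} -> {set {set V}} -> Prop :=
| red_refl F : red F F
| red_step v F G F' : G \subset F -> lower F G -> toggled v G ->
    red (F :\: G) F' -> red F F'.

Lemma red_trans F1 F2 F3 : red F1 F2 -> red F2 F3 -> red F1 F3.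
Proof.
elim=> // v F G F' GF lG tG _ IH /IH; exact: (red_step GF lG tG).
Qed.

Lemma red1 v F G : G \subset F -> lower F G -> toggled v G -> red F (F :\: G).
Proof. by move=> GF lG tG; apply: (red_step GF lG tG); apply: red_refl. Qed.

Lemma red_toggled v F : toggled v F -> red F set0.
Proof. by move=> tF; rewrite -(setDv F); apply: (red1 (v := v)). Qed.

(** A family that is lower in [G] is lower in [F] too, so each stage of the reduction of [G] can be
    carried out inside [F]. *)
Lemma red_lower0 F G : G \subset F -> lower F G -> red G set0 -> red F (F :\: G).
Proof.
move=> GF lG rG; move E: set0 rG => Z rG.
elim: rG F GF lG E => {G Z} [G F _ _ <-|v G H Z HG lH tH _ IH F GF lG E].
  by rewrite setD0; apply: red_refl.
have lH' : lower F H.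
  by move=> s t sF tH' st; apply: (lH s t) => //; apply: (lG s t) => //; apply: (subsetP HG).
apply: (red_step (subset_trans HG GF) lH' tH).
have -> : F :\: G = (F :\: H) :\: (G :\: H).
  apply/setP => s; rewrite !inE negb_and negbK.
  by have := subsetP HG s; case: (s \in H) => [/(_ isT) ->|_]; rewrite ?orbT.
apply: IH => //; first exact: setSD.
move=> s t; rewrite !inE => /andP[-> sF] /andP[tH' tG] st.
exact: lG sF tG st.
Qed.

Lemma convex_setD F G : convex F -> lower F G -> convex (F :\: G).
Proof.
move=> cF lG s t u; rewrite !inE => /andP[sG sF] /andP[_ uF] st tu.
rewrite (cF s t u) // andbT; apply: contra sG => tG; exact: lG tG st.
Qed.

Lemma convex_complex F : is_complex F -> convex F.
Proof. by move=> [_ cF] s t u _ /cF + _ => /[apply]. Qed.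

Lemma red_sphere (A : comNzRingType) F F' n : convex F -> red F F' ->
  rsphere A F n <-> rsphere A F' n.
Proof.
move=> cF rF; elim: rF cF => {F F'} // v F G F' GF lG tG _ IH cF.
rewrite -IH; last exact: convex_setD.
by apply: rsphere_setD => //; apply: toggled_racyclic tG.
Qed.

Definition euler F : int := \sum_(s in F) (-1) ^+ #|s|.

Lemma euler_setD F G : G \subset F -> euler F = euler G + euler (F :\: G).
Proof. by move=> GF; rewrite /euler (big_setID G) /= (setIidPr GF). Qed.

Lemma euler_toggled v G : toggled v G -> euler G = 0.
Proof.
move=> tG; rewrite /euler (bigID (fun s : {set V} => v \in s)) /=.
rewrite (reindex_onto (fun s => v |: s) (fun s => s :\ v)) /=; last first.
  by move=> s /andP[_ vs]; rewrite setD1K.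
rewrite (eq_big (fun s => (s \in G) && (v \notin s)) (fun s => - (-1) ^+ #|s|)).
- by rewrite sumrN addNr.
- move=> s; rewrite setU11 andbT; apply/andP/andP => [[sG /eqP E]|[sG vs]].
    have vs : v \notin s by rewrite -E setD11.
    by split=> //; rewrite -(setU1K vs); apply: (tG _ sG).2.
  by rewrite (tG _ sG).1 setU1K.
move=> s /andP[_ /eqP E]; have vs : v \notin s by rewrite -E setD11.
by rewrite cardsU1 vs exprS mulN1r.
Qed.

Lemma euler_red F F' : red F F' -> euler F = euler F'.
Proof.
elim=> // v F1 G F2 GF lG tG _ <-.
by rewrite (euler_setD GF) (euler_toggled tG) add0r.
Qed.

Definition jn F G : {set {set V}} := [set r :|: t | r in F, t in G].

Lemma jnP F G s :
  reflect (exists r t, [/\ r \in F, t \in G & s = r :|: t]) (s \in jn F G).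
Proof.
apply: (iffP imset2P) => [[r t rF tG ->]|[r [t [rF tG ->]]]]; first by exists r, t.
by exists r t.
Qed.

Lemma mem_jn F G r t : r \in F -> t \in G -> r :|: t \in jn F G.
Proof. by move=> rF tG; apply/jnP; exists r, t. Qed.

(** The ground sets of the two factors are kept apart by [D], so a member of the join is split
    uniquely by intersecting with [D] and removing [D]. *)
Definition separates (D : {set V}) F G :=
  (forall r, r \in F -> r \subset D) /\ (forall t, t \in G -> [disjoint t & D]).

Lemma separates_split D F G r t : separates D F G -> r \in F -> t \in G ->
  ((r :|: t) :&: D = r) * ((r :|: t) :\: D = t).
Proof.
move=> [FD GD] /FD rD /GD tD; split.
  by rewrite setIUl (setIidPl rD); move: tD; rewrite -setI_eq0 => /eqP ->; rewrite setU0.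
rewrite setDUl; move: rD; rewrite -setD_eq0 => /eqP ->; rewrite set0U.
by apply/setDidPl.
Qed.

Lemma mem_jnE D F G r t : separates D F G -> r \subset D -> [disjoint t & D] ->
  (r :|: t \in jn F G) = (r \in F) && (t \in G).
Proof.
move=> sD rD tD; apply/idP/andP => [/jnP[r' [t' [rF tG E]]]|[]]; last exact: mem_jn.
have s1 : separates D [set r] [set t] by split=> x; rewrite inE => /eqP ->.
have [E1 E2] := separates_split s1 (set11 r) (set11 t).
have [E3 E4] := separates_split sD rF tG.
have -> : r = r' by rewrite -[LHS]E1 E E3.
by have -> : t = t' by rewrite -[LHS]E2 E E4.
Qed.

Lemma separates_sub D F F' G : F' \subset F -> separates D F G -> separates D F' G.
Proof. by move=> /subsetP FF [FD GD]; split=> // r /FF /FD. Qed.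

(** Toggling a vertex of the first factor does not touch the second one, so every removed piece [H]
    becomes the removed piece [jn H G]. *)
Lemma red_jn D F F' G : separates D F G -> red F F' -> red (jn F G) (jn F' G).
Proof.
move=> + rF; elim: rF => {F F'} [F|v F H F' HF lH tH _ IH] sD; first exact: red_refl.
have sH := separates_sub HF sD.
have E : jn F G :\: jn H G = jn (F :\: H) G.
  apply/setP => s; rewrite inE; apply/andP/jnP => [[sH' /jnP[r [t [rF tG sE]]]]|].
    exists r, t; split=> //; rewrite inE rF andbT.
    by apply: contra sH' => rH; rewrite sE mem_jn.
  move=> [r [t [/setDP[rF rH] tG ->]]]; split; last exact: mem_jn.
  by rewrite (mem_jnE sH) ?(sD.1 _ rF) ?(sD.2 _ tG) // negb_and rH.
(* An empty [H] says nothing about [v]; otherwise [v |: h] is in [H], which places [v] in [D]. *)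
have [H0|[h hH]] := set_0Vmem H.
  by rewrite H0 setD0 in IH; apply: IH.
have vD : v \in D.
  by have /sH.1 /subsetP := (tH _ hH).1; apply; rewrite setU11.
apply: (@red_step v _ (jn H G)) => [|s t|s|].
- apply/subsetP => s /jnP[r [t [rH tG ->]]]; apply: mem_jn => //; exact: (subsetP HF).
- move=> /jnP[r1 [t1 [r1F t1G ->]]] /jnP[r [t' [rH t'G ->]]] sub.
  apply: mem_jn => //; apply: (lH r1 r) => //.
  rewrite -(separates_split sD r1F t1G).1 -(separates_split sH rH t'G).1.
  exact: setSI.
- move=> /jnP[r [t [rH tG ->]]]; rewrite setUA setDUl.
  have vt : v \notin t.
    apply/negP => vt; have := sD.2 _ tG.
    by rewrite disjoint_subset => /subsetP/(_ _ vt); rewrite inE vD.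
  have /setDidPl -> : [disjoint t & [set v]] by rewrite disjoint_sym disjoints1.
  by split; apply: mem_jn => //; [exact: (tH _ rH).1|exact: (tH _ rH).2].
rewrite E; apply: IH; apply: separates_sub sD; exact: subsetDl.
Qed.

Lemma jn0 G : jn set0 G = set0.
Proof. by apply/setP => s; rewrite in_set0; apply/negP => /jnP[r [t []]]; rewrite inE. Qed.

Lemma jn1_sphere (A : comNzRingType) (tau : {set V}) G n : (forall t, t \in G -> [disjoint tau & t]) ->
  rsphere A G n -> rsphere A (jn [set tau] G) (n + #|tau|).
Proof.
move E: #|tau| => k; elim: k tau E G n => [|k IH] tau E G n tG sG.
  rewrite addn0 (_ : jn _ _ = G) //.
  rewrite (cards0_eq E); apply/setP => s; apply/jnP/idP => [[r [t [/set1P-> tG' ->]]]|sG'].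
    by rewrite set0U.
  by exists set0, s; rewrite inE set0U.
have [v vt] : exists v, v \in tau by apply/set0Pn; rewrite -card_gt0 E.
have dv t : t \in G -> v \notin t.
  by move=> /tG; rewrite disjoint_subset => /subsetP/(_ _ vt).
rewrite addnS -addSn.
(* One vertex of [tau] is handed over to the other factor, where it shifts the degree by one. *)
have -> : jn [set tau] G = jn [set tau :\ v] [set v |: s | s in G].
  apply/setP => s; apply/jnP/jnP => [[r [t [/set1P-> tG' ->]]]|[r [_ [/set1P-> /imsetP[t tG' ->] ->]]]].
    exists (tau :\ v), (v |: t); rewrite inE eqxx imset_f //; split=> //.
    by rewrite setUCA setUA setD1K.
  by exists tau, t; rewrite inE eqxx; split=> //; rewrite setUCA setUA setD1K.
apply: IH; first by move: E; rewrite (cardsD1 v) vt => -[].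
  move=> _ /imsetP[t /tG + ->]; rewrite !disjoint_subset => /subsetP tt.
  apply/subsetP => x; rewrite !inE negb_or => /andP[-> /tt]; exact.
by rewrite -rsphere_shift.
Qed.

End Reduction.

(** * h-polynomials *)

(* gpos d p: in degree d, the vector g^(2) of p is nonnegative. *)
Inductive gpos : nat -> {poly int} -> Prop :=
| gpos0 d : gpos d 0
| gposS d k p : (k.*2 <= d)%N -> gpos d p -> gpos d ('X^k * P2 (d - k.*2) + p).

Lemma gposD d p q : gpos d p -> gpos d q -> gpos d (p + q).
Proof.
elim=> {d p} [d|d k p kd _ IH] dq; first by rewrite add0r.
by rewrite -addrA; apply/gposS/IH.
Qed.

Lemma gpos_basis d k : (k.*2 <= d)%N -> gpos d ('X^k * P2 (d - k.*2)).
Proof. by move=> kd; rewrite -[_ * _]addr0; apply: gposS => //; apply: gpos0. Qed.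

Lemma gposMn d p n : gpos d p -> gpos d (p *+ n).
Proof.
by move=> dp; elim: n => [|n IH]; rewrite ?mulr0n ?mulrS; [apply: gpos0|apply: gposD].
Qed.

(** With Q = 1 + X + X^2, two odd degrees produce the factor (1 + X)^2 = Q + X; this is where the
    second term comes from. *)
Lemma P2M a b : P2 a * P2 b =
  if odd a && odd b then P2 (a + b) + 'X * P2 (a + b - 2) else P2 (a + b).
Proof.
rewrite /P2; set Q := 1 + 'X + 'X^2; rewrite !halfD !oddD; case: ifPn => [/andP[oa ob]|].
  rewrite oa ob /= !expr0 !expr1 !mulr1.
  have -> : (odd (a + b - 2) = false) by lia.
  have -> : ((a + b - 2)./2 = a./2 + b./2)%N by lia.
  by rewrite add1n expr0 exprS exprD; rewrite /Q; ring.
rewrite negb_and => nab; have -> : odd a && odd b = false by lia.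
by rewrite add0n exprD; case: (odd a) nab; case: (odd b) => //= _; rewrite ?expr0 ?expr1; ring.
Qed.

Lemma gpos_basisM d e k j : (k.*2 <= d)%N -> (j.*2 <= e)%N ->
  gpos (d + e) ('X^k * P2 (d - k.*2) * ('X^j * P2 (e - j.*2))).
Proof.
move=> kd je; rewrite mulrACA -exprD P2M.
have E : (d - k.*2 + (e - j.*2) = d + e - (k + j).*2)%N by lia.
rewrite E; case: ifP => [|_]; last by apply: gpos_basis; lia.
move=> odds; rewrite mulrDr; apply: gposD; first by apply: gpos_basis; lia.
rewrite mulrA -exprSr.
have -> : (d + e - (k + j).*2 - 2 = d + e - (k + j).+1.*2)%N by lia.
apply: gpos_basis; lia.
Qed.

Lemma gposM d e p q : gpos d p -> gpos e q -> gpos (d + e) (p * q).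
Proof.
elim=> {d p} [d|d k p kd _ IH] eq; first by rewrite mul0r; apply: gpos0.
rewrite mulrDl; apply: gposD; last exact: IH.
elim: eq {IH} => {e q} [e|e j q je _ IH]; first by rewrite mulr0; apply: gpos0.
by rewrite mulrDr; apply: gposD => //; apply: gpos_basisM.
Qed.

Lemma gpos1 : gpos 0 1.
Proof. by have := @gpos_basis 0 0 isT; rewrite /P2 !expr0 !mulr1. Qed.

Lemma gpos_X1 : gpos 1 (1 + 'X).
Proof. by have := @gpos_basis 1 0 isT; rewrite /P2 /= !expr0 expr1 !mul1r. Qed.

Lemma gpos_X : gpos 2 'X.
Proof. by have := @gpos_basis 2 1 isT; rewrite /P2 /= !expr0 expr1 !mulr1. Qed.

Lemma gpos_Q : gpos 2 (1 + 'X + 'X^2).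
Proof. by have := @gpos_basis 2 0 isT; rewrite /P2 /= !expr0 expr1 mul1r mulr1. Qed.

Lemma gpos_coef d p : gpos d p -> exists g : 'I_(d./2).+1 -> int,
  p = \sum_(k < (d./2).+1) g k *: ('X^k * P2 (d - k.*2)) /\ (forall k, 0 <= g k).
Proof.
elim=> {d p} [d|d k p kd _ [g [-> g0]]].
  by exists (fun=> 0); split=> //; rewrite big1 // => i _; rewrite scale0r.
have kd2 : (k < (d./2).+1)%N by lia.
exists (fun i => (i == Ordinal kd2)%:R + g i); split.
  under [RHS]eq_bigr => i _ do rewrite scalerDl.
  rewrite big_split /=; congr (_ + _).
  rewrite (bigD1 (Ordinal kd2)) //= eqxx scale1r big1 ?addr0 // => i /negbTE ->.
  by rewrite scale0r.
by move=> i; apply: addr_ge0.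
Qed.

Section HPol.
Variable V : finType.
Implicit Types (F G K : {set {set V}}).

(* h(F,t) of an (n-1)-dimensional complex F, written as the sum of f_(l-1) t^l (1-t)^(n-l);
   additive in F and multiplicative under joins. *)
Definition hpol (n : nat) F : {poly int} :=
  \sum_(s in F) 'X^#|s| * (1 - 'X) ^+ (n - #|s|).

Lemma coef_1subX n j : ((1 - 'X : {poly int}) ^+ n)`_j = (-1) ^+ j * 'C(n, j)%:Z.
Proof.
rewrite exprBn coef_sum.
under eq_bigr => i _ do rewrite expr1n mulr1 -polyC1 -polyCN -polyC_exp -mulrnAl.
under eq_bigr => i _ do rewrite -polyCMn coefCM coefXn.
have [jn|nj] := leqP j n; last first.
  rewrite bin_small // mulr0 big1 // => i _.
  by rewrite gtn_eqF ?mulr0 // (leq_trans (ltn_ord i)).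
rewrite (bigD1 (inord j)) //= inordK ?ltnS // eqxx mulr1 big1 ?addr0.
  by rewrite -mulr_natr natz.
move=> i ij; case: eqP => [E|]; rewrite ?mulr0 //.
by case/eqP: ij; apply/val_inj; rewrite /= inordK // ltnS.
Qed.

Lemma hpolyE d K : rk K = d -> hpoly K = hpol d K.
Proof.
move=> rkd; apply/polyP => i; rewrite coef_poly rkd coef_sum.
have le_d s : s \in K -> (#|s| <= d)%N.
  by move=> sK; rewrite -rkd /rk (bigD1 s) //= leq_maxl.
under [RHS]eq_bigr => s _ do rewrite coefXnM coef_1subX.
case: ltnP => [led|di]; last first.
  rewrite big1 // => s /le_d sd; case: ltnP => // _.
  by rewrite bin_small ?mulr0 //; lia.
rewrite /hcoef rkd.
have -> : \sum_(l < i.+1) (-1) ^+ (i - l) * 'C(d - l, i - l)%:Z * (Defs.fcard K l)%:Z =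
  \sum_(l < i.+1) \sum_(s in K | #|s| == l) (-1) ^+ (i - #|s|) * 'C(d - #|s|, i - #|s|)%:Z.
  apply: eq_bigr => l _.
  rewrite (eq_bigr (fun=> (-1) ^+ (i - l) * 'C(d - l, i - l)%:Z)); last first.
    by move=> s /andP[_ /eqP ->].
  rewrite sumr_const /Defs.fcard -[_ *+ _]mulr_natr natz; congr (_ * Posz _).
  by apply: eq_card => s; rewrite !inE.
rewrite (exchange_big_dep (mem K)) //=; last by move=> l s _ /andP[].
apply: eq_bigr => s sK; rewrite sK /=; case: ltnP => [is_|si].
  by rewrite big1 // => l /eqP E; move: (ltn_ord l); rewrite -E ltnS leqNgt is_.
by rewrite (big_pred1 (Ordinal (si : (#|s| < i.+1)%N))) // => l; rewrite eq_sym.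
Qed.

Lemma hpol_setD n F G : G \subset F -> hpol n F = hpol n G + hpol n (F :\: G).
Proof. by move=> GF; rewrite /hpol (big_setID G) /= (setIidPr GF). Qed.

Lemma hpol_jn D m n F G : separates D F G ->
  (forall r, r \in F -> (#|r| <= m)%N) -> (forall t, t \in G -> (#|t| <= n)%N) ->
  hpol (m + n) (jn F G) = hpol m F * hpol n G.
Proof.
move=> sD Fm Gn; rewrite /hpol /jn.
rewrite curry_imset2X big_imset /=; last first.
  move=> [r t] [r' t'] /setXP[rF tG] /setXP[rF' tG'] /= E.
  have [E1 E2] := separates_split sD rF tG.
  have [E3 E4] := separates_split sD rF' tG'.
  have -> : r = r' by rewrite -[LHS]E1 E E3.
  by have -> : t = t' by rewrite -[LHS]E2 E E4.
rewrite big_distrlr /= (pair_big_dep (mem F) (fun _ => mem G)) /=.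
apply: eq_big => [[r t]|[r t] /setXP[/= rF tG]]; first by rewrite inE.
have -> : #|r :|: t| = (#|r| + #|t|)%N.
  have [E _] := separates_split sD rF tG.
  rewrite cardsU (_ : r :&: t = set0) ?cards0 ?subn0 //.
  apply/eqP; rewrite setI_eq0; apply: disjointWl (sD.1 _ rF) _.
  by rewrite disjoint_sym; apply: sD.2.
have rm := Fm _ rF; have tn := Gn _ tG.
have -> : (m + n - (#|r| + #|t|) = (m - #|r|) + (n - #|t|))%N by lia.
by rewrite !exprD mulrACA.
Qed.



Lemma sum_by_card (R : nmodType) n F (f : nat -> R) : (forall s, s \in F -> (#|s| <= n)%N) ->
  \sum_(s in F) f #|s| = \sum_(l < n.+1) f l *+ Defs.fcard F l.
Proof.
move=> Fn; rewrite (partition_big (fun s : {set V} => inord #|s| : 'I_n.+1) predT) //=.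
apply: eq_bigr => l _; rewrite -sumr_const; apply: eq_big => [s|s].
  rewrite inE; case sF: (s \in F) => //=.
  by rewrite -val_eqE /= inordK // ltnS Fn.
by case/andP => sF /eqP <-; rewrite inordK // ltnS Fn.
Qed.

Lemma hpol_fcard n F : (forall s, s \in F -> (#|s| <= n)%N) ->
  hpol n F = \sum_(l < n.+1) ('X^l * (1 - 'X) ^+ (n - l)) *+ Defs.fcard F l.
Proof. by move=> Fn; rewrite /hpol (sum_by_card (fun l => 'X^l * (1 - 'X) ^+ (n - l)) Fn). Qed.

Lemma euler_fcard n F : (forall s, s \in F -> (#|s| <= n)%N) ->
  euler F = \sum_(l < n.+1) (-1) ^+ l *+ Defs.fcard F l.
Proof. by move=> Fn; rewrite /euler (sum_by_card (fun l => (-1) ^+ l) Fn). Qed.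

Lemma fcard_powerset (s : {set V}) k : Defs.fcard (powerset s) k = 'C(#|s|, k).
Proof. by rewrite -cards_draws; apply: eq_card => t; rewrite !inE. Qed.

(** This is the binomial expansion of (X + (1 - X))^n. *)
Lemma hpol_powerset (s : {set V}) : hpol #|s| (powerset s) = 1.
Proof.
rewrite (@hpol_fcard #|s|) => [|t]; last by rewrite inE => /subset_leq_card.
under eq_bigr => l _ do rewrite fcard_powerset mulrC.
by rewrite -exprDn subrK expr1n.
Qed.

Lemma red_sub F F' : red F F' -> F' \subset F.
Proof. by elim=> // v F1 G F2 _ _ _ _ /subset_trans; apply; apply: subsetDl. Qed.

Lemma fcard0 F : is_complex F -> Defs.fcard F 0 = 1%N.
Proof.
move=> [F0 _]; rewrite /Defs.fcard (_ : [set s in F | _] = [set set0]) ?cards1 //.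
apply/setP => s; rewrite !inE cards_eq0; case: eqP => [->|]; rewrite ?andbF //.
by rewrite F0.
Qed.

Lemma fcard1 F : Defs.fcard F 1 = #|vertices F|.
Proof.
rewrite /Defs.fcard -(card_imset (mem (vertices F)) set1_inj); apply: eq_card => s.
rewrite !inE; apply/andP/imsetP => [[sF /cards1P[x E]]|[x]].
  by exists x; rewrite // inE -E.
by rewrite inE => xF ->; rewrite cards1.
Qed.

Lemma link_complex K s : is_complex K -> s \in K -> is_complex (link K s).
Proof.
move=> [K0 Ksub] sK; split=> [|t u]; first by rewrite !inE setI0 setU0 eqxx K0 sK.
rewrite !inE => /and3P[tK /eqP st stK] ut; apply/and3P; split.
- exact: Ksub tK ut.
- by rewrite -subset0 -st setIS.
- by apply: Ksub stK _; apply: setUS.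
Qed.

Lemma mem_link K s t : is_complex K -> (t \in link K s) = [disjoint s & t] && (s :|: t \in K).
Proof.
move=> [_ Ksub]; rewrite !inE setI_eq0; apply/andP/andP => -[]; last first.
  by move=> st stK; rewrite st stK (Ksub _ _ stK) // subsetUr.
by move=> _ /andP.
Qed.

End HPol.

(** * Discs *)

Section Discs.
Variable V : finType.
Implicit Types (F G K : {set {set V}}) (r s t u : {set V}).

(* What is used of a triangulated triangle L with corners sigma: it is a disc,
   all the links of which are reduced to a point (boundary faces) or to a
   sphere (interior faces). *)
Record disc (L : {set {set V}}) (sigma : {set V}) : Prop := Disc {
  disc_complex : is_complex L;
  disc_card : #|sigma| = 3%N;
  disc_le3 : forall r, r \in L -> (#|r| <= 3)%N;
  disc_bdry : forall r : {set V}, r \proper sigma -> r \in L /\ red (link L r) set0;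
  disc_int : forall r, r \in L -> ~~ (r \proper sigma) ->
    exists2 tau : {set V}, #|tau| = (3 - #|r|)%N & red (link L r) [set tau];
  disc_full : sigma \in L -> forall r, r \in L -> r \subset sigma
}.

Section DiscCounts.
Variables (L : {set {set V}}) (sigma : {set V}).
Hypothesis dL : disc L sigma.

Lemma disc_link_card r t : t \in link L r -> (#|t| <= 3 - #|r|)%N.
Proof.
rewrite (mem_link _ _ (disc_complex dL)) => /andP[rt /(disc_le3 dL)].
by rewrite cardsU disjoint_setI0 // cards0; lia.
Qed.

(** The link of an edge has only the empty set and points, so its Euler characteristic, 0 here and
    -1 for an interior edge, counts the triangles on the edge. *)
Lemma disc_bdry_edge r : r \proper sigma -> #|r| = 2%N -> Defs.fcard (link L r) 1 = 1%N.
Proof.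
move=> rs r2; have [rL /euler_red] := disc_bdry dL rs.
have le t : t \in link L r -> (#|t| <= 1)%N by move/disc_link_card; rewrite r2.
rewrite (euler_fcard le) !big_ord_recr /= big_ord0 (fcard0 (link_complex (disc_complex dL) rL)).
by rewrite /euler big_set0 expr0 expr1; lia.
Qed.

Lemma disc_int_edge r : r \in L -> ~~ (r \proper sigma) -> #|r| = 2%N ->
  Defs.fcard (link L r) 1 = 2%N.
Proof.
move=> rL rs r2; have [tau tau1 /euler_red] := disc_int dL rL rs.
have le t : t \in link L r -> (#|t| <= 1)%N by move/disc_link_card; rewrite r2.
rewrite (euler_fcard le) !big_ord_recr /= big_ord0 (fcard0 (link_complex (disc_complex dL) rL)).
by rewrite /euler big_set1 tau1 r2 expr0 !expr1; lia.
Qed.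

(** Incidences of edges and triangles are counted twice: a triangle has three edges, the three
    boundary edges lie in one triangle and all other edges in two. *)
Lemma disc_triangles : (3 * Defs.fcard L 3 + 3 = 2 * Defs.fcard L 2)%N.
Proof.
pose E : {set {set V}} := [set e in L | #|e| == 2].
pose T : {set {set V}} := [set t in L | #|t| == 3].
have deg e : e \in E -> Defs.fcard (link L e) 1 = \sum_(t in T | e \subset t) 1.
  rewrite inE => /andP[eL /eqP e2]; rewrite sum1_card.
  rewrite /Defs.fcard -(card_in_imset (f := fun t => e :|: t)); last first.
    move=> t t'; rewrite !inE => /andP[/and3P[_ /eqP te _] _] /andP[/and3P[_ /eqP te' _] _] E'.
    have dd u : e :&: u = set0 -> u = (e :|: u) :\: e.
      by move=> eu; rewrite setDUl setDv set0U; apply/esym/setDidPl; rewrite disjoint_sym -setI_eq0 eu.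
    by rewrite (dd _ te) (dd _ te') E'.
  apply: eq_card => t; rewrite [in RHS]unfold_in /= inE; apply/imsetP/idP.
    move=> [u]; rewrite !inE => /andP[/and3P[_ /eqP eu euL] /eqP u1] ->.
    by rewrite euL cardsU eu cards0 e2 u1 subsetUl.
  move=> /andP[/andP[tL /eqP t3] et].
  have E' : e :|: t :\: e = t by rewrite setDE setUIr setUCr setIT; apply/setUidPr.
  exists (t :\: e) => //.
  rewrite inE (mem_link _ _ (disc_complex dL)) cardsD (setIidPr et) t3 e2 andbT E' tL andbT.
  by rewrite disjoint_sym -setI_eq0 setIC setIDA setDIl setDv set0I.
have dd : (\sum_(e in E) Defs.fcard (link L e) 1 = 3 * Defs.fcard L 3)%N.
  under eq_bigr => e /deg -> do [].
  rewrite (exchange_big_dep (mem T)) /=; last by move=> e t _ /andP[].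
  rewrite (eq_bigr (fun=> 3%N)) => [|t tT]; first by rewrite sum_nat_const mulnC.
  rewrite sum1_card; move: (tT); rewrite inE => /andP[tL /eqP t3].
  transitivity 'C(#|t|, 2); last by rewrite t3.
  rewrite -cards_draws; apply: eq_card => e.
  rewrite unfold_in /= !inE tL t3 eqxx /=; case et: (e \subset t); rewrite ?andbF ?andbT //=. 
  by have [_ /(_ _ _ tL et) ->] := disc_complex dL.
rewrite -dd (bigID (fun e : {set V} => e \proper sigma)) /=.
rewrite (eq_bigr (fun=> 1%N)); last first.
  by move=> e /andP[]; rewrite inE => /andP[_ /eqP e2] es; apply: disc_bdry_edge.
rewrite [X in (_ + X + _)%N](eq_bigr (fun=> 2%N)); last first.
  by move=> e /andP[]; rewrite inE => /andP[eL /eqP e2] es; apply: disc_int_edge.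
rewrite !sum_nat_const.
have E1 : #|[pred e in E | e \proper sigma]| = 3%N.
  transitivity 'C(#|sigma|, 2); last by rewrite (disc_card dL).
  rewrite -cards_draws; apply: eq_card => e.
  rewrite unfold_in /= !inE; case: (#|e| =P 2) => e2; rewrite ?andbF //= !andbT.
  case es: (e \subset sigma); last by rewrite properE es andbF.
  have ps : e \proper sigma by rewrite properEcard es e2 (disc_card dL).
  by rewrite ps (disc_bdry dL ps).1.
have := cardID (fun e : {set V} => e \proper sigma) E.
move: E1; rewrite /Defs.fcard -/E.
have -> : #|[predI E & fun e : {set V} => e \proper sigma]| = #|[pred e in E | e \proper sigma]|.
  by apply: eq_card => e; rewrite !inE.
have -> : #|[predD E & fun e : {set V} => e \proper sigma]| = #|[pred e in E | ~~ (e \proper sigma)]|.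
  by apply: eq_card => e; rewrite !inE andbC.
move=> -> <-; set m := #|[pred e in E | _]|; set m' := (X in (_ + X * _ + _)%N).
have -> : m' = m by apply: eq_card.
by lia.
Qed.

Lemma h_graphE (R : comNzRingType) (x : R) (p e n : nat) : (e + 1 = p + n)%N ->
  (1 - x) ^+ 2 + x * (1 - x) *+ p + x ^+ 2 *+ e = 1 + x *+ p - x *+ 2 + x ^+ 2 *+ n.
Proof.
move=> E; apply: (addrI (x ^+ 2)).
have -> : x ^+ 2 + ((1 - x) ^+ 2 + x * (1 - x) *+ p + x ^+ 2 *+ e) = (1 - x) ^+ 2 + x * (1 - x) *+ p + x ^+ 2 *+ (e + 1) by ring.
rewrite E; ring.
Qed.
(** A disc with three boundary vertices and [n] interior ones has n + 3 vertices, 3n + 3 edges and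
    2n + 1 triangles. *)
Lemma h_discE (R : comNzRingType) (x : R) (n : nat) :
  (1 - x) ^+ 3 + x * (1 - x) ^+ 2 *+ (n + 3) + x ^+ 2 * (1 - x) *+ (3 * n + 3)
     + x ^+ 3 *+ (2 * n + 1) - 1 = x * (1 + x) *+ n.
Proof. ring. Qed.

(** For the link of a vertex, [n] is 0 when it is a path and 1 when it is a cycle. *)
Lemma disc_vertex_euler r (n : nat) : r \in L -> #|r| = 1%N -> euler (link L r) = n ->
  (Defs.fcard (link L r) 2 + 1 = Defs.fcard (link L r) 1 + n)%N.
Proof.
move=> rL r1.
have le t : t \in link L r -> (#|t| <= 2)%N by move/disc_link_card; rewrite r1.
rewrite (euler_fcard le) !big_ord_recr /= !big_ord0.
rewrite (fcard0 (link_complex (disc_complex dL) rL)).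
by rewrite expr0 expr1 -[(-1) ^+ 2]/((-1) * (-1)); lia.
Qed.

Lemma disc_vertex_hpol r (n : nat) : r \in L -> #|r| = 1%N -> euler (link L r) = n ->
  hpol 2 (link L r) = 1 + 'X *+ Defs.fcard (link L r) 1 - 'X *+ 2 + 'X^2 *+ n.
Proof.
move=> rL r1 eu; rewrite -(h_graphE _ (disc_vertex_euler rL r1 eu)).
have le t : t \in link L r -> (#|t| <= 2)%N by move/disc_link_card; rewrite r1.
rewrite (hpol_fcard le) !big_ord_recr /= !big_ord0.
rewrite (fcard0 (link_complex (disc_complex dL) rL)).
by rewrite expr0 mul1r mulr1n add0r mulr1.
Qed.

Lemma disc_hpol_int r : r \in L -> ~~ (r \proper sigma) ->
  gpos (3 - #|r|) (hpol (3 - #|r|) (link L r)).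
Proof.
move=> rL rs; have [tau tauc rtau] := disc_int dL rL rs.
have le := @disc_link_card r; have lc := link_complex (disc_complex dL) rL.
have := disc_le3 dL rL; case rE: #|r| => [|[|[|[|//]]]] _; rewrite /= ?subn1 /=.
- case/negP: rs; rewrite (cards0_eq rE) properEneq sub0set andbT.
  by rewrite eq_sym -card_gt0 (disc_card dL).
- have eu : euler (link L r) = 1.
    by rewrite (euler_red rtau) /euler big_set1 tauc rE.
  rewrite (disc_vertex_hpol rL rE eu) mulr1n.
  set p := Defs.fcard _ 1.
  (* The link has [p] vertices and [p] edges, at least one edge, and at most C(p,2) edges; this
     leaves only p at least 3. *)
  have p3 : (3 <= p)%N.
    have pe : (Defs.fcard (link L r) 2 = p)%N.
      by have := disc_vertex_euler rL rE eu; rewrite -/p; lia.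
    have e1 : (0 < Defs.fcard (link L r) 2)%N.
      apply/card_gt0P; exists tau; rewrite inE tauc rE eqxx andbT.
      by have /subsetP := red_sub rtau; apply; rewrite inE.
    have : (Defs.fcard (link L r) 2 <= 'C(p, 2))%N.
      rewrite /p fcard1 -cards_draws; apply: subset_leq_card.
      apply/subsetP => t; rewrite inE => /andP[tl t2]; rewrite inE t2 andbT.
      apply/subsetP => x xt; rewrite inE; have [_ lsub] := lc.
      by apply: (lsub t); rewrite ?sub1set.
    by rewrite pe in e1 *; rewrite bin2; nia.
  have -> : 1 + 'X *+ p - 'X *+ 2 + 'X^2 = (1 + 'X + 'X^2) + 'X *+ (p - 3) :> {poly int}.
    rewrite mulrnBr //; ring.
  by apply: gposD; [apply: gpos_Q|apply/gposMn/gpos_X].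
- rewrite rE in le; rewrite (hpol_fcard le) !big_ord_recr /= big_ord0 (fcard0 lc).
  rewrite (disc_int_edge rL rs rE) subnn !expr0 !expr1.
  rewrite add0r mul1r mulr1 mulr1n mulr2n addrA subrK.
  exact: gpos_X1.
rewrite rE in le; rewrite (hpol_fcard le) !big_ord_recr /= big_ord0 (fcard0 lc).
by rewrite !expr0 mulr1 mulr1n add0r; apply: gpos1.
Qed.

Lemma disc_hpol_bdry r : r \proper sigma ->
  gpos (3 - #|r|) (hpol (3 - #|r|) (link L r) - 1).
Proof.
move=> rs; have [rL rr] := disc_bdry dL rs.
have le := @disc_link_card r; have lc := link_complex (disc_complex dL) rL.
have eu : euler (link L r) = 0 by rewrite (euler_red rr) /euler big_set0.
have := proper_card rs; rewrite (disc_card dL); case rE: #|r| => [|[|[|//]]] _; rewrite /= ?subn1 /=.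
- have r0 := cards0_eq rE.
  have E : link L r = L.
    apply/setP => t; rewrite (mem_link _ _ (disc_complex dL)) r0 set0U -setI_eq0 set0I eqxx //.
  rewrite E in eu lc le *; rewrite subn0; rewrite rE subn0 in le.
  have f0 : (3 <= Defs.fcard L 1)%N.
    rewrite -(disc_card dL) fcard1; apply: subset_leq_card; apply/subsetP => x xs.
    rewrite inE; apply: (disc_bdry dL _).1; rewrite properEcard sub1set xs.
    by rewrite cards1 (disc_card dL).
  move: eu; rewrite (hpol_fcard le) (euler_fcard le) !big_ord_recr /= !big_ord0 (fcard0 lc).
  rewrite -[(-1) ^+ 2]/((-1) * (-1)) -[(-1) ^+ 3]/((-1) * ((-1) * (-1))) !expr0 !expr1 => eu.
  have tri := disc_triangles; rewrite -(subnK f0) in eu tri *.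
  (* [N] is the number of interior vertices. The Euler characteristic and the incidence count
     determine the other two face numbers from it. *)
  set N := (Defs.fcard L 1 - 3)%N in eu tri *.
  have -> : Defs.fcard L 3 = (2 * N + 1)%N by lia.
  have -> : Defs.fcard L 2 = (3 * N + 3)%N by lia.
  rewrite mul1r mulr1n add0r mulr1 h_discE.
  apply: gposMn; exact: gposM gpos_X gpos_X1.
- rewrite (disc_vertex_hpol rL rE eu) mulr0n addr0 addrAC [1 + _]addrC addrK.
  (* The other two corners are both joined to the corner [r]. *)
  have p2 : (2 <= Defs.fcard (link L r) 1)%N.
    have -> : 2%N = #|sigma :\: r| by rewrite cardsD (setIidPr (proper_sub rs)) rE (disc_card dL).
    rewrite fcard1; apply: subset_leq_card; apply/subsetP => x; rewrite inE => /andP[xr xs].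
    rewrite inE (mem_link _ _ (disc_complex dL)) disjoint_sym disjoints1 xr /=.
    apply: (disc_bdry dL _).1; rewrite properEcard subUset sub1set xs (proper_sub rs).
    by rewrite setUC cardsU1 xr rE (disc_card dL).
  by rewrite -mulrnBr //; apply/gposMn/gpos_X.
rewrite rE in le; rewrite (hpol_fcard le) !big_ord_recr /= big_ord0 (fcard0 lc).
rewrite (disc_bdry_edge rs rE) subnn !expr0 !expr1.
rewrite add0r mul1r mulr1 !mulr1n subrK subrr.
exact: gpos0.
Qed.

End DiscCounts.
End Discs.

(** * Replacing a face by a disc *)

Section LinksAndJoins.
Variable V : finType.
Implicit Types (F G K L : {set {set V}}) (D r s t u sigma : {set V}).

Lemma cardD1S x s : x \in s -> #|s :\ x|.+1 = #|s|.
Proof. by move=> xs; rewrite [RHS](cardsD1 x) xs. Qed.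

Lemma disjointUP s t u : [disjoint s & t :|: u] = [disjoint s & t] && [disjoint s & u].
Proof. by rewrite -!setI_eq0 setIUr setU_eq0. Qed.

Lemma disjoint_split D s t :
  [disjoint s & t] = [disjoint s :&: D & t :&: D] && [disjoint s :\: D & t :\: D].
Proof.
rewrite -!setI_eq0 -setU_eq0; congr (_ == _); apply/setP => x; rewrite !inE.
by case: (x \in s); case: (x \in t); case: (x \in D).
Qed.

Lemma mem_jn_split D F G s : separates D F G ->
  (s \in jn F G) = (s :&: D \in F) && (s :\: D \in G).
Proof.
move=> sD; rewrite -{1}(setID s D) (mem_jnE sD) ?subsetIr //.
by rewrite -setI_eq0 setIDAC -setIDA setDv setI0.
Qed.

Lemma jn_complex D F G : separates D F G -> is_complex F -> is_complex G ->
  is_complex (jn F G).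
Proof.
move=> sD [F0 Fs] [G0 Gs]; split=> [|s t].
  by rewrite (mem_jn_split _ sD) set0I set0D F0 G0.
rewrite !(mem_jn_split _ sD) => /andP[sF sG] ts.
by rewrite (Fs _ _ sF) ?setSI // (Gs _ _ sG) ?setSD.
Qed.

Lemma link_jn D F G s : separates D F G -> is_complex F -> is_complex G ->
  s \in jn F G -> link (jn F G) s = jn (link F (s :&: D)) (link G (s :\: D)).
Proof.
move=> sD cF cG sJ; have cJ := jn_complex sD cF cG.
have sD' : separates D (link F (s :&: D)) (link G (s :\: D)).
  by split=> x; rewrite inE => /andP[+ _]; [apply: sD.1|apply: sD.2].
apply/setP => t; rewrite (mem_link _ _ cJ) (mem_jn_split _ sD) (mem_jn_split _ sD').
rewrite (mem_link _ _ cF) (mem_link _ _ cG) setIUl setDUl (disjoint_split D).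
by rewrite andbACA.
Qed.

Lemma link_link K s u : is_complex K -> s \in K -> u \in link K s ->
  link (link K s) u = link K (s :|: u).
Proof.
move=> cK sK uL; have cL := link_complex cK sK.
move: uL; rewrite (mem_link _ _ cK) => /andP[su suK].
apply/setP => t; rewrite (mem_link _ _ cL) !(mem_link _ _ cK) disjointUP su /= setUA.
rewrite andbA; congr (_ && _); rewrite -!setI_eq0 setIUl setU_eq0.
by rewrite andbC.
Qed.

Lemma link_powerset s r : r \subset s -> link (powerset s) r = powerset (s :\: r).
Proof.
move=> rs; apply/setP => t; rewrite !inE subUset rs subsetD -setI_eq0 setIC.
by case: (t \subset s); rewrite //= andbC.
Qed.

Lemma powerset_complex s : is_complex (powerset s).
Proof.
by split=> [|t u]; rewrite !inE ?sub0set // => ts ut; apply: subset_trans ut ts.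
Qed.

Lemma red_powerset s : s != set0 -> red (powerset s) set0.
Proof.
case/set0Pn => x xs; apply: (@red_toggled _ x) => t; rewrite !inE => ts.
by rewrite subUset sub1set xs ts (subset_trans (subsetDl _ _) ts).
Qed.

Lemma minimal_nonface K (F : {set V}) : is_complex K -> F \notin K ->
  exists2 M, missing_face K M & M \subset F.
Proof.
move=> cK FK; have [M /minsetP[MK Mmin] MF] := @minset_exists _ (fun s => s \notin K) F FK.
exists M => //; split=> // s sM; apply: contraTT (sM) => sK.
by rewrite (Mmin s sK (proper_sub sM)) properxx.
Qed.

(** A nonempty closed set [Z] of top faces would survive every reduction. A top face in a removed
    piece contains the toggled vertex [v], so two of them with [z :\ v] in common coincide.
    Closedness is asked only at ridges still present in [F], which makes it pass to [F :\: G]. *)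
Lemma red_no_closed n F (Z : {set {set V}}) : red F set0 ->
  (forall s, s \in F -> (#|s| <= n)%N) -> Z \subset F ->
  (forall z, z \in Z -> #|z| = n) ->
  (forall z v, z \in Z -> v \in z -> z :\ v \in F ->
     exists z', [/\ z' \in Z, z' != z & z :\ v \subset z']) -> Z = set0.
Proof.
move E: {1}set0 => F' rF; move: E; elim: rF Z => {F F'} [F Z <- _|v F G F' GF lG tG _ IH Z E Fn ZF Zn Zc].
  by rewrite subset0 => /eqP.
have topG z : z \in Z -> z \in G -> v \in z.
  move=> zZ zG; apply: contraTT isT => vz; have := Fn _ (subsetP GF _ (tG _ zG).1).
  by rewrite cardsU1 vz (Zn _ zZ) ltnn.
have Z0 : Z :\: G = set0.
  apply: (IH _ E) => [s|||z w]; rewrite ?inE.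
  - by case/andP=> _ /Fn.
  - exact: setSD.
  - by move=> z; rewrite inE => /andP[_ /Zn].
  move=> /andP[zG zZ] wz /andP[zwG zwF]; have [z' [z'Z z'z sub]] := Zc _ _ zZ wz zwF.
  exists z'; split=> //; rewrite inE z'Z andbT; apply: contra zwG => z'G.
  exact: lG zwF z'G sub.
have ZG : Z \subset G by rewrite -setD_eq0 Z0.
apply/eqP/set0Pn => -[z zZ]; have zG := subsetP ZG _ zZ; have vz := topG _ zZ zG.
have [z' [z'Z /eqP z'z sub]] := Zc _ _ zZ vz (subsetP GF _ (tG _ zG).2).
have vz' := topG _ z'Z (subsetP ZG _ z'Z).
apply: z'z; apply/esym/eqP; rewrite eqEcard (Zn _ zZ) (Zn _ z'Z) leqnn andbT.
by rewrite -(setD1K vz) subUset sub1set vz' sub.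
Qed.

End LinksAndJoins.

(** * One replacement step: links, h-polynomials and missing faces *)

Section Step.
Variables (A : comNzRingType) (V : finType).
Implicit Types (F G J K L : {set {set V}}) (D r s t u sigma : {set V}).

(** The invariant of the induction. The bound on [#|s|] makes all the differences [d - #|s|]
    genuine; the empty face gives the statement about [K] itself. *)
Definition good (d : nat) K : Prop := is_complex K /\ forall s, s \in K ->
  [/\ (#|s| <= d)%N, rsphere A (link K s) (d - #|s|) &
      gpos (d - #|s|) (hpol (d - #|s|) (link K s))].

Variables (d : nat) (K1 L : {set {set V}}) (sigma : {set V}).
Hypothesis gK : good d K1.
Hypothesis sK : sigma \in K1.
Hypothesis dL : disc L sigma.
Hypothesis new : forall x, x \in vertices L -> x \notin sigma -> x \notin vertices K1.

(** [J1] is the closed star of [sigma] and [J2] the join that takes its place. *)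
Let Lam := link K1 sigma.
Let D := vertices L.
Let K2 := (K1 :\: [set sigma :|: t | t in Lam]) :|: jn L Lam.
Let J1 := jn (powerset sigma) Lam.
Let J2 := jn L Lam.
Let cK1 : is_complex K1 := gK.1.
Let cL : is_complex L := disc_complex dL.
Let cLam : is_complex Lam := link_complex cK1 sK.

Lemma sub_vertices K s : is_complex K -> s \in K -> s \subset vertices K.
Proof.
by move=> [_ Ks] sK'; apply/subsetP => x xs; rewrite inE (Ks s) // sub1set.
Qed.

Lemma sigma_D : sigma \subset D.
Proof.
apply/subsetP => x xs; rewrite inE; apply: (disc_bdry dL _).1.
by rewrite properEcard sub1set xs cards1 (disc_card dL).
Qed.

(** The vertices of [L] off [sigma] are new, so an old face sees only [sigma] of [L]. *)
Lemma D_K1 s : s \in K1 -> s :&: D = s :&: sigma.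
Proof.
move=> sK1; apply/setP => x; rewrite !inE; case xs: (x \in s) => //=.
apply/idP/idP => [xD|]; last by move/(subsetP sigma_D); rewrite inE.
apply/negPn/negP => /(new _); rewrite inE xD => /(_ isT) /negP; apply.
by apply: (subsetP (sub_vertices cK1 sK1)).
Qed.

Lemma Lam_D t : t \in Lam -> [disjoint t & D].
Proof.
rewrite (mem_link _ _ cK1) -!setI_eq0 setIC => /andP[/eqP st stK].
by rewrite D_K1 ?st //; apply: (cK1.2 _ _ stK); apply: subsetUr.
Qed.

Lemma sepL : separates D L Lam.
Proof. by split=> [r|t]; [apply: sub_vertices|apply: Lam_D]. Qed.

Lemma sepP : separates D (powerset sigma) Lam.
Proof.
by split=> [r|t]; [rewrite inE => /subset_trans; apply; apply: sigma_D|apply: Lam_D].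
Qed.

Lemma mem_J1 s : (s \in J1) = (s :&: D \subset sigma) && (s :\: D \in Lam).
Proof. by rewrite (mem_jn_split _ sepP) inE. Qed.

Lemma mem_J2 s : (s \in J2) = (s :&: D \in L) && (s :\: D \in Lam).
Proof. exact: mem_jn_split sepL. Qed.

Lemma mem_star s : (s \in [set sigma :|: t | t in Lam]) = (s \in K1) && (sigma \subset s).
Proof.
apply/imsetP/andP => [[t]|[sK1 ss]].
  by rewrite (mem_link _ _ cK1) => /andP[_ stK] ->; rewrite stK subsetUl.
have E : sigma :|: s :\: sigma = s by rewrite setDE setUIr setUCr setIT; apply/setUidPr.
exists (s :\: sigma) => //; rewrite (mem_link _ _ cK1) E sK1 andbT.
by rewrite -setI_eq0 setIDA setDIl setDv set0I.
Qed.

Lemma mem_K2 s : (s \in K2) = (s \in K1) && ~~ (sigma \subset s) || (s \in J2).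
Proof. by rewrite in_setU in_setD mem_star; case: (s \in K1); rewrite ?andbF ?andbT. Qed.

Lemma J1_K1 s : s \in J1 -> s \in K1.
Proof.
rewrite mem_J1 (mem_link _ _ cK1) => /and3P[sD _ sK1]; apply: (cK1.2 _ _ sK1).
by rewrite -{1}(setID s D) setSU.
Qed.

Lemma J2_K2 s : s \in J2 -> s \in K2.
Proof. by rewrite mem_K2 => ->; rewrite orbT. Qed.

Lemma star_J1 s : s \in K1 -> sigma \subset s -> s \in J1.
Proof.
move=> sK1 ss; rewrite mem_J1 (D_K1 sK1) subsetIr /= (mem_link _ _ cK1).
have -> : s :\: D = s :\: sigma.
  by apply/setP => x; have /setP/(_ x) := D_K1 sK1; rewrite !inE; case: (x \in s); rewrite ?andbF //= => ->.
have E : sigma :|: s :\: sigma = s by rewrite setDE setUIr setUCr setIT; apply/setUidPr.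
by rewrite E sK1 andbT -setI_eq0 setIDA setDIl setDv set0I.
Qed.

Lemma J2_J1 s : s \in K1 -> s \in J2 -> s \in J1.
Proof. by move=> sK1; rewrite mem_J1 mem_J2 (D_K1 sK1) subsetIr => /andP[]. Qed.

Lemma J1_J2 s : s \in J1 -> ~~ (sigma \subset s) -> s \in J2.
Proof.
rewrite mem_J1 mem_J2 => /andP[sD ->] ss; rewrite andbT; apply: (disc_bdry dL _).1.
rewrite properE sD; apply: contra ss => ss; apply: subset_trans ss _; apply: subsetIl.
Qed.

Lemma same_complement s : (s \in K1) && (s \notin J1) = (s \in K2) && (s \notin J2).
Proof.
rewrite mem_K2; apply/andP/andP => [[sK1 sJ1]|[]].
  split; last by apply: contra sJ1; apply: J2_J1.
  by rewrite sK1 /=; apply/orP; left; apply: contra sJ1; apply: star_J1.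
move=> /orP[/andP[sK1 ss]|->] // sJ2; split=> //.
by apply: contra sJ2 => sJ1; apply: J1_J2.
Qed.

Lemma cJ1 : is_complex J1.
Proof. exact: jn_complex sepP (powerset_complex _) cLam. Qed.

Lemma cJ2 : is_complex J2.
Proof. exact: jn_complex sepL cL cLam. Qed.

Lemma cK2 : is_complex K2.
Proof.
split=> [|s t]; first by apply: J2_K2; apply: cJ2.1.
rewrite !mem_K2 => /orP[/andP[sK1 ss]|sJ] ts.
  by rewrite (cK1.2 _ _ sK1 ts) /=; apply/orP; left; apply: contra ss => /subset_trans; apply.
by rewrite (cJ2.2 _ _ sJ ts) orbT.
Qed.

Lemma link_complement s : s \in K2 ->
  link K1 s :\: link J1 s = link K2 s :\: link J2 s.
Proof.
move=> sK2; apply/setP => t.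
have E J K : is_complex J -> is_complex K ->
    (t \in link K s :\: link J s) = [disjoint s & t] && ((s :|: t \in K) && (s :|: t \notin J)).
  move=> cJ cK; rewrite in_setD (mem_link _ _ cJ) (mem_link _ _ cK).
  by case: [disjoint s & t]; rewrite //= andbC.
by rewrite (E _ _ cJ1 cK1) (E _ _ cJ2 cK2) same_complement.
Qed.

Lemma link_sub J K s : J \subset K -> link J s \subset link K s.
Proof.
by move=> /subsetP JK; apply/subsetP => t; rewrite !inE => /and3P[/JK-> -> /JK->].
Qed.

Lemma lower_link J K s : is_complex J -> lower (link K s) (link J s).
Proof.
move=> cJ t u _; rewrite !(mem_link _ _ cJ) => /andP[su suJ] tu.
rewrite (disjointWr tu su) /=; apply: (cJ.2 _ _ suJ); exact: setUS.
Qed.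

Section Face.
Variable s : {set V}.
Hypothesis sK2 : s \in K2.
Let r := s :&: D.
Let u := s :\: D.

Lemma card_face : #|s| = (#|r| + #|u|)%N.
Proof. by rewrite cardsID. Qed.

Hypothesis uLam : u \in Lam.
Hypothesis rL : r \in L.

Lemma su_K1 : sigma :|: u \in K1.
Proof. by move: uLam; rewrite (mem_link _ _ cK1) => /andP[]. Qed.

Lemma card_su : #|sigma :|: u| = (3 + #|u|)%N.
Proof.
move: uLam; rewrite (mem_link _ _ cK1) => /andP[su _].
by rewrite cardsU disjoint_setI0 // cards0 subn0 (disc_card dL).
Qed.

Lemma le_u : (3 + #|u| <= d)%N.
Proof. by rewrite -card_su; have [] := gK.2 _ su_K1. Qed.

Lemma le_s : (#|s| <= d)%N.
Proof.
by rewrite card_face; apply: leq_trans le_u; rewrite leq_add2r (disc_le3 dL).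
Qed.

Let k := (d - (3 + #|u|))%N.
Let Lu := link K1 (sigma :|: u).

Lemma Lu_sphere : rsphere A Lu k.
Proof. by have [_ +] := gK.2 _ su_K1; rewrite card_su. Qed.

Lemma Lu_gpos : gpos k (hpol k Lu).
Proof. by have [_ _] := gK.2 _ su_K1; rewrite card_su. Qed.

Lemma Lu_card t : t \in Lu -> (#|t| <= k)%N.
Proof.
rewrite (mem_link _ _ cK1) => /andP[su' suK].
have [+ _ _] := gK.2 _ suK.
by rewrite cardsU disjoint_setI0 // cards0 subn0 card_su /k; lia.
Qed.

Lemma dim_link : (d - #|s| = (3 - #|r|) + k)%N.
Proof. by rewrite card_face /k; have := le_u; have := disc_le3 dL rL; lia. Qed.

Lemma linkJ2 : link J2 s = jn (link L r) Lu.
Proof.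
rewrite /J2 (link_jn sepL cL cLam); last by rewrite mem_J2 rL uLam.
by rewrite (link_link cK1 sK).
Qed.

Lemma sep_link : separates D (link L r) Lu.
Proof.
split=> t; first by rewrite inE => /andP[+ _]; apply: sepL.1.
rewrite /Lu -(link_link cK1 sK) // inE => /andP[+ _]; exact: Lam_D.
Qed.

Lemma good_new_face : ~~ (r \proper sigma) ->
  rsphere A (link K2 s) (d - #|s|) /\ gpos (d - #|s|) (hpol (d - #|s|) (link K2 s)).
Proof.
move=> rs; have [tau tauc rtau] := disc_int dL rL rs.
have E : link K2 s = jn (link L r) Lu.
  rewrite -linkJ2; apply/setP => t; rewrite (mem_link _ _ cK2) (mem_link _ _ cJ2).
  congr (_ && _); apply/idP/idP; last exact: J2_K2.
  (* An old face that contains [r] forces [r] into [sigma], hence [r = sigma]; but the old faces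
     containing [sigma] have been removed. *)
  rewrite mem_K2 => /orP[/andP[stK /negP[]]|//].
  have rK : r \in K1 by apply: (cK1.2 _ _ stK); apply: subset_trans (subsetIl _ _) (subsetUl _ _).
  have rs' : r \subset sigma by apply/setIidPl; rewrite -(D_K1 rK) /r -setIA setIid.
  have /eqP <- : r == sigma by rewrite eqEproper rs' rs.
  by apply: subset_trans (subsetIl _ _) (subsetUl _ _).
have ls := @disc_link_card _ _ _ dL r.
rewrite E dim_link; split; last first.
  rewrite (hpol_jn sep_link ls Lu_card).
  by apply: gposM Lu_gpos; apply: (disc_hpol_int dL).
have sJ : separates D [set tau] Lu by apply: separates_sub sep_link; apply: red_sub.
rewrite (red_sphere A _ _ (red_jn sep_link rtau)).
  rewrite -tauc addnC; apply: jn1_sphere Lu_sphere => t tLu.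
  by apply: disjointWl (sJ.1 _ (set11 _)) _; rewrite disjoint_sym; apply: sJ.2.
apply: convex_complex; apply: jn_complex sep_link _ _; apply: link_complex => //.
exact: su_K1.
Qed.

(* h(link_K2 s) = h(link_K1 s) + (h(link_L r) - 1) h(link_K1 (sigma :|: u)). *)
Lemma good_old_face : r \proper sigma -> s \in K1 ->
  rsphere A (link K2 s) (d - #|s|) /\ gpos (d - #|s|) (hpol (d - #|s|) (link K2 s)).
Proof.
move=> rs sK1; have [_ sph gp] := gK.2 _ sK1.
have sJ1 : s \in J1 by rewrite mem_J1 (proper_sub rs).
have linkJ1 : link J1 s = jn (powerset (sigma :\: r)) Lu.
  rewrite /J1 (link_jn sepP (powerset_complex _) cLam) //.
  by rewrite (link_link cK1 sK) // (link_powerset (proper_sub rs)).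
have sepP' : separates D (powerset (sigma :\: r)) Lu.
  split=> t; last exact: sep_link.2.
  rewrite inE => /subset_trans; apply; apply: subset_trans (subsetDl _ _) sigma_D.
have sr0 : sigma :\: r != set0 by rewrite setD_eq0; move: rs; rewrite properE => /andP[].
(* Both links reduce to nothing: one is a join with a nonempty full simplex, the other a join with
   the link of a boundary face of the disc. Homology is then compared on their common complement. *)
have R1 : red (link J1 s) set0 by rewrite linkJ1 -(jn0 Lu); apply/(red_jn sepP')/red_powerset.
have R2 : red (link J2 s) set0.
  by rewrite linkJ2 -(jn0 Lu); apply: (red_jn sep_link); apply: (disc_bdry dL rs).2.
have S1 : link J1 s \subset link K1 s by apply: link_sub; apply/subsetP => x; apply: J1_K1.
have S2 : link J2 s \subset link K2 s by apply: link_sub; apply/subsetP => x; apply: J2_K2.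
have cc := convex_complex (link_complex cK1 sK1); have cc2 := convex_complex (link_complex cK2 sK2).
split.
  rewrite (red_sphere A _ cc2 (red_lower0 S2 (lower_link cJ2) R2)).
  rewrite -link_complement // -(red_sphere A _ cc) //.
  exact: red_lower0 S1 (lower_link cJ1) R1.
rewrite (hpol_setD _ S2) -link_complement //.
have -> : hpol (d - #|s|) (link K1 s :\: link J1 s) =
    hpol (d - #|s|) (link K1 s) - hpol (d - #|s|) (link J1 s).
  by rewrite (hpol_setD _ S1) addrC addKr.
have ls := @disc_link_card _ _ _ dL r.
rewrite addrCA; apply: gposD => //; rewrite linkJ1 linkJ2 dim_link.
rewrite (hpol_jn sep_link ls Lu_card) (hpol_jn sepP' _ Lu_card); last first.
  by move=> t; rewrite inE => /subset_leq_card; rewrite cardsD (setIidPr (proper_sub rs)) (disc_card dL).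
have -> : hpol (3 - #|r|) (powerset (sigma :\: r)) = 1.
  have -> : (3 - #|r|)%N = #|sigma :\: r|; last exact: hpol_powerset.
  by rewrite cardsD (setIidPr (proper_sub rs)) (disc_card dL).
by rewrite -mulrBl; apply: gposM Lu_gpos; apply: (disc_hpol_bdry dL).
Qed.

End Face.

Lemma good_step : good d K2.
Proof.
split=> [|s sK2]; first exact: cK2.
have [/andP[rL uL]|] := boolP ((s :&: D \in L) && (s :\: D \in Lam)).
  have [sph gp] : rsphere A (link K2 s) (d - #|s|) /\ gpos (d - #|s|) (hpol (d - #|s|) (link K2 s)).
    have [rs|] := boolP (s :&: D \proper sigma); last exact: good_new_face.
    apply: good_old_face => //; apply: J1_K1; by rewrite mem_J1 (proper_sub rs).
  by split=> //; apply: le_s.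
rewrite -mem_J2 => sJ2.
have sK1 : s \in K1 by move: sK2; rewrite mem_K2 (negbTE sJ2) orbF => /andP[].
have sJ1 : s \notin J1.
  have := same_complement s; rewrite sK2 sJ2 sK1 /=; by case: (s \in J1).
(* A face outside both joins has an empty trace on them, so its link is the same before and after
   the step. *)
have noL J : is_complex J -> s \notin J -> link J s = set0.
  move=> cJ sJ; apply/setP => t; rewrite (mem_link _ _ cJ) in_set0; apply/negP => /andP[_ stJ].
  by case/negP: sJ; apply: (cJ.2 _ _ stJ); apply: subsetUl.
have := link_complement sK2; rewrite (noL _ cJ1) // (noL _ cJ2) // !setD0 => <-.
exact: gK.2.
Qed.

(** The four triangles of a tetrahedron form a closed surface, which a disc cannot contain by
    [red_no_closed]. *)
Lemma disc_no_K4 (F : {set V}) : #|F| = 4%N -> ~ (forall x, x \in F -> F :\ x \in L).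
Proof.
move=> F4 FL; have [F0|[x0 x0F]] := set_0Vmem F; first by rewrite F0 cards0 in F4.
have rL : red L set0.
  have p0 : set0 \proper sigma.
    by rewrite properEneq sub0set andbT eq_sym -card_gt0 (disc_card dL).
  have [_] := disc_bdry dL p0; rewrite (_ : link L set0 = L) //.
  by apply/setP => t; rewrite (mem_link _ _ cL) set0U -setI_eq0 set0I eqxx.
pose Z : {set {set V}} := [set F :\ x | x in F].
have Zc z : z \in Z -> #|z| = 3%N.
  by move=> /imsetP[x xF ->]; move: F4; rewrite (cardsD1 x) xF => -[].
have : Z = set0.
  apply: (red_no_closed rL (disc_le3 dL) _ Zc).
    by apply/subsetP => _ /imsetP[x xF ->]; apply: FL.
  move=> _ v /imsetP[x xF ->]; rewrite !inE => /andP[vx vF] _.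
  exists (F :\ v); split; first exact: imset_f.
    apply: contraNneq vx => E; have : v \notin F :\ x by rewrite -E setD11.
    by rewrite !inE vF andbT negbK.
  by rewrite setDDl setUC -setDDl; apply: subsetDl.
have x0Z : F :\ x0 \in Z by apply: imset_f.
by move=> Z0; rewrite Z0 inE in x0Z.
Qed.

(** A missing face with more than three vertices is either old, and excluded by assumption, or
    contains a vertex interior to [L]. In the second case its proper subsets through that vertex lie
    in [J2], and they show that the whole set is a face. *)
Lemma missing_step : (forall F : {set V}, missing_face K1 F -> (#|F| <= 3)%N) ->
  forall F : {set V}, missing_face K2 F -> (#|F| <= 3)%N.
Proof.
move=> mK1 F [FK2 Fp]; rewrite leqNgt; apply/negP => F4.
have D1 (x : V) : x \in F -> F :\ x \in K2 by move=> xF; apply: Fp; rewrite properD1.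
(* If [sigma] is a face of [L], then [L] is the full simplex by [disc_full] and the step changes
   nothing. *)
have [sL|sL] := boolP (sigma \in L).
  have E : K2 = K1.
    apply/setP => s; rewrite mem_K2 mem_J2.
    have EL r : (r \in L) = (r \subset sigma).
      apply/idP/idP => [|rs]; first exact: (disc_full dL).
      exact: (cL.2 _ _ sL).
    rewrite EL -mem_J1; apply/orP/idP => [[/andP[]//|/J1_K1//]|sK1].
    by have [/(star_J1 sK1)|ss] := boolP (sigma \subset s); [right|left; rewrite sK1].
  have /mK1 : missing_face K1 F by rewrite -E; split.
  by rewrite leqNgt F4.
have sK2 : sigma \notin K2.
  by rewrite mem_K2 subxx andbF mem_J2 (setIidPl sigma_D) (negbTE sL).
(* Without interior vertices of [L], [F] would already be missing in [K1]. *)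
have [Fold|] := boolP (F :&: D \subset sigma).
  have sF : ~~ (sigma \subset F).
    apply: contra sK2 => sF; apply: Fp; rewrite properEcard sF (disc_card dL).
    exact: F4.
  have /mK1 : missing_face K1 F; last by rewrite leqNgt F4.
  split=> [|P PF]; first by apply: contra FK2 => FK1; rewrite mem_K2 FK1 sF.
  have := Fp _ PF; rewrite mem_K2 => /orP[/andP[]//|]; rewrite mem_J2 => /andP[_ PL].
  apply: J1_K1; rewrite mem_J1 PL andbT; apply: subset_trans Fold.
  by rewrite setSI // proper_sub.
case/subsetPn => x; rewrite inE => /andP[xF xD] xs.
(* Every face that contains the new vertex [x] was created by the step. *)
have xJ2 (P : {set V}) : x \in P -> P \in K2 -> P \in J2.
  move=> xP; rewrite mem_K2 => /orP[/andP[PK1 _]|//].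
  by have := subsetP (sub_vertices cK1 PK1) _ xP; rewrite (negbTE (new xD xs)).
set Fd := F :&: D; set Ft := F :\: D.
have Fd1 : (Fd :&: D = Fd) * (Fd :\: D = set0).
  by rewrite /Fd -setIA setIid -setIDA setDv setI0.
have xFd : x \in Fd by rewrite inE xF.
(* If [F] lies inside [L], it has exactly four vertices and all its triangles are in [L], against
   [disc_no_K4]. *)
have [Ft0|Ft0] := eqVneq Ft set0.
  have FD : F \subset D by rewrite -setD_eq0 -/Ft Ft0.
  have xL y : y \in F -> y != x -> F :\ y \in L.
    move=> yF yx; have := xJ2 _ _ (D1 _ yF); rewrite !inE eq_sym yx xF => /(_ isT).
    by rewrite mem_J2 (setIidPl _) ?(subset_trans (subsetDl _ _) FD) // => /andP[].
  have [y yF yx] : exists2 y, y \in F & y != x.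
    have : (0 < #|F :\ x|)%N by rewrite -ltnS cardD1S //; apply: leq_trans F4.
    by case/card_gt0P => y; rewrite !inE => /andP[yx yF]; exists y.
  have F4' : #|F| = 4%N.
    by apply/eqP; rewrite eqn_leq F4 andbT -(cardD1S yF) ltnS (disc_le3 dL) // xL.
  apply: (disc_no_K4 F4') => z zF; have [->|zx] := eqVneq z x; last exact: xL.
  (* The only triangle of [F] not through [x]: if it were an old face it would be [sigma], which is
     no longer a face. *)
  have := D1 _ xF; rewrite mem_K2 => /orP[/andP[FxK ss]|]; last first.
    by rewrite mem_J2 (setIidPl _) ?(subset_trans (subsetDl _ _) FD) // => /andP[].
  case/negP: ss; have := D_K1 FxK; rewrite (setIidPl (subset_trans (subsetDl _ _) FD)).
  move/esym/setIidPl => sub; have /eqP -> // : F :\ x == sigma.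
  by rewrite eqEcard sub (disc_card dL) -ltnS cardD1S // F4'.
have [y0 y0Ft] := set0Pn _ Ft0.
have y0F : (y0 \in F) * (y0 \notin D) by move: y0Ft; rewrite inE => /andP[].
have FdL : Fd \in L.
  have FdF : Fd \proper F.
    rewrite properE subsetIl; apply/subsetPn; exists y0; first by rewrite y0F.
    by rewrite inE negb_and y0F.2 orbT.
  by have := xJ2 _ xFd (Fp _ FdF); rewrite mem_J2 Fd1 => /andP[].
suff FtL : Ft \in Lam by case/negP: FK2; apply: J2_K2; rewrite mem_J2 FdL FtL.
have QLam (Q : {set V}) : Q \subset Ft -> x |: Q \proper F -> Q \in Lam.
  move=> QFt QF; have := xJ2 _ (setU11 _ _) (Fp _ QF); rewrite mem_J2 => /andP[_].
  suff -> : (x |: Q) :\: D = Q by [].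
  rewrite setDUl (_ : [set x] :\: D = set0) ?set0U; last by apply/eqP; rewrite setD_eq0 sub1set.
  apply/setDidPl; rewrite -setI_eq0 -subset0; apply: subset_trans (setSI _ QFt) _.
  by rewrite /Ft setDE -setIA (setIC (~: D)) setICr setI0.
(* If [F] has a second vertex in [D], then [x |: Ft] is a proper subset of [F] and gives the claim
   at once. The case of [x] alone needs the bound on the missing faces of [K1]. *)
have [Fdx|Fdx] := eqVneq Fd [set x]; last first.
  apply: QLam => //; rewrite properE subUset sub1set xF subsetDl /=.
  have [y yFd yx] : exists2 y, y \in Fd & y != x.
    apply/exists_inP; apply: contraNT Fdx => /exists_inPn all; rewrite eqEsubset sub1set xFd andbT.
    by apply/subsetP => y /all /negPn; rewrite inE.
  apply/subsetPn; exists y; first by move: yFd; rewrite inE => /andP[].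
  by move: yFd; rewrite !inE (negbTE yx) => /andP[_ ->].
have FE : F = x |: Ft by rewrite -Fdx setID.
have xFt : x \notin Ft by rewrite inE xD.
have Ft3 : (3 <= #|Ft|)%N by move: F4; rewrite FE cardsU1 xFt.
have Qsub (Q : {set V}) : Q \proper Ft -> Q \in Lam.
  move=> QFt; apply: QLam (proper_sub QFt) _; rewrite FE properE (setUS _ (proper_sub QFt)) /=.
  have [_ [y yFt yQ]] := properP QFt; apply/subsetPn; exists y; first by rewrite inE yFt orbT.
  by rewrite !inE negb_or yQ andbT; apply: contraNneq xFt => <-.
have FtK1 : Ft \in K1.
  have : Ft \in K2.
    by apply: Fp; rewrite properE subsetDl; apply/subsetPn; exists x.
  rewrite mem_K2 => /orP[/andP[]//|]; rewrite mem_J2 => /andP[_].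
  rewrite setDDl setUid (mem_link _ _ cK1) => /andP[_] /cK1.2; apply; exact: subsetUr.
have sFt : [disjoint sigma & Ft].
  by rewrite disjoint_subset; apply/subsetP => y /(subsetP sigma_D) yD; rewrite inE /= /Ft in_setD yD.
rewrite (mem_link _ _ cK1) sFt; apply/negPn/negP => nK1.
(* A minimal nonface [M] of [sigma :|: Ft] must contain [Ft], since all proper subsets of [Ft] are
   in the link of [sigma]. As [M] has at most three elements and [Ft] at least three, they are
   equal, although [Ft] is a face of [K1]. *)
have [M mM MF] := minimal_nonface cK1 nK1.
have FtM : Ft \subset M.
  apply: contraT => nsub; have := mM.1.
  have pr : Ft :&: M \proper Ft by rewrite properE subsetIl subsetIidl.
  have := Qsub _ pr; rewrite (mem_link _ _ cK1) => /andP[_] sQ.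
  rewrite (cK1.2 _ _ sQ) //; apply/subsetP => y yM; have := subsetP MF _ yM.
  by rewrite !inE yM andbT; case: (y \in sigma) => //=; rewrite andbC.
have MFt : Ft = M by apply/eqP; rewrite eqEcard FtM (leq_trans (mK1 _ mM)).
by have := mM.1; rewrite -MFt FtK1.
Qed.

End Step.

(** * Determinants in dimension three *)

Section Space.
Variable R : realFieldType.
Implicit Types (x y z u v w : 'rV[R]_3).

Definition o0 : 'I_3 := @Ordinal 3 0 isT.
Definition o1 : 'I_3 := @Ordinal 3 1 isT.
Definition o2 : 'I_3 := @Ordinal 3 2 isT.

Lemma ord3P (i : 'I_3) : [\/ i = o0, i = o1 | i = o2].
Proof. by case: i => [[|[|[|//]]]] H; [apply: Or31|apply: Or32|apply: Or33]; apply/val_inj. Qed.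

Lemma row3P x y : x 0 o0 = y 0 o0 -> x 0 o1 = y 0 o1 -> x 0 o2 = y 0 o2 -> x = y.
Proof. by move=> e0 e1 e2; apply/rowP => i; case: (ord3P i) => ->. Qed.

Lemma sum3 (f : 'I_3 -> R) : \sum_i f i = f o0 + f o1 + f o2.
Proof.
by rewrite !big_ord_recr big_ord0 /= add0r; congr (f _ + f _ + f _); apply: val_inj.
Qed.

Definition det3 x y z : R :=
  x 0 o0 * (y 0 o1 * z 0 o2 - y 0 o2 * z 0 o1)
  - x 0 o1 * (y 0 o0 * z 0 o2 - y 0 o2 * z 0 o0)
  + x 0 o2 * (y 0 o0 * z 0 o1 - y 0 o1 * z 0 o0).

Lemma det3_is_linear x y : linear (det3 x y : 'rV_3 -> R^o).
Proof. by move=> a u v; rewrite /det3 !mxE /GRing.scale /=; ring. Qed.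

HB.instance Definition _ x y :=
  GRing.isLinear.Build R 'rV[R]_3 R^o _ (det3 x y) (det3_is_linear x y).

Lemma det3_anti x y z : det3 x z y = - det3 x y z.
Proof. by rewrite /det3; ring. Qed.

Lemma det3_swap x y z : det3 y x z = - det3 x y z.
Proof. by rewrite /det3; ring. Qed.

Lemma det3_alt1 x y : det3 x x y = 0.
Proof. by rewrite /det3; ring. Qed.

Lemma det3_alt2 x y : det3 x y y = 0.
Proof. by rewrite /det3; ring. Qed.

Lemma cramer x y z w :
  det3 x y z *: w = det3 w y z *: x + det3 x w z *: y + det3 x y w *: z.
Proof. by apply: row3P; rewrite !mxE /det3; ring. Qed.

(** Modulo [x] the other vectors live in a plane, and this is the three-term Pluecker relation
    there. *)
Lemma plucker x a b c d :
  det3 x a b * det3 x c d = det3 x a c * det3 x b d - det3 x a d * det3 x b c.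
Proof. by rewrite /det3; ring. Qed.

Definition axis (i : 'I_3) : 'rV[R]_3 := delta_mx 0 i.

Lemma axisE i j : axis i 0 j = (j == i)%:R.
Proof. by rewrite mxE eqxx. Qed.

(** The three determinants are, up to sign, the 2 by 2 minors of [x] and [y]. Their vanishing makes
    the two vectors proportional, and the coordinate sums fix the factor. *)
Lemma det3_axis x y : \sum_i x 0 i = 1 -> \sum_i y 0 i = 1 ->
  (forall i, det3 x y (axis i) = 0) -> x = y.
Proof.
rewrite !sum3 => x1 y1 d0.
have /eqP := d0 o0; have /eqP := d0 o1; have /eqP := d0 o2.
rewrite /det3 !axisE /= !(mulr0, mulr1, subr0, sub0r, addr0, add0r, mulrN).
move=> /eqP e2 /eqP e1 /eqP e0.
have -> : x = (y 0 o0 + y 0 o1 + y 0 o2) *: x by rewrite y1 scale1r.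
have -> : y = (x 0 o0 + x 0 o1 + x 0 o2) *: y by rewrite x1 scale1r.
apply: row3P; rewrite !mxE; nra.
Qed.

End Space.

(** * Faces of a triangulated triangle as cones *)

Section Cones.
Variables (R : realType) (W : finType) (L : {set {set W}}) (pos : W -> 'rV[R]_3).
Hypothesis tL : triangulates_simplex L pos.
Implicit Types (r s t e : {set W}) (u v w x : W) (y z : 'rV[R]_3) (a b c : W -> R).

Definition lincomb s a : 'rV[R]_3 := \sum_(v in s) a v *: pos v.

Definition nonneg y := forall i, 0 <= y 0 i.

Lemma cplxL : is_complex L. Proof. by case: tL. Qed.

Lemma face_sub s t : s \in L -> t \subset s -> t \in L.
Proof. exact: cplxL.2. Qed.

Lemma combD s a b : lincomb s (fun v => a v + b v) = lincomb s a + lincomb s b.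
Proof. by rewrite -big_split; apply: eq_bigr => v _; rewrite scalerDl. Qed.

Lemma combZ s k a : lincomb s (fun v => k * a v) = k *: lincomb s a.
Proof. by rewrite scaler_sumr; apply: eq_bigr => v _; rewrite scalerA. Qed.

Lemma combB s a b : lincomb s (fun v => a v - b v) = lincomb s a - lincomb s b.
Proof. by rewrite -sumrB; apply: eq_bigr => v _; rewrite scalerBl. Qed.

Lemma eq_comb s a b : {in s, a =1 b} -> lincomb s a = lincomb s b.
Proof. by move=> ab; apply: eq_bigr => v vs; rewrite ab. Qed.

Lemma comb_sub s t a : t \subset s -> (forall v, v \in s -> v \notin t -> a v = 0) ->
  lincomb s a = lincomb t a.
Proof.
move=> ts a0; rewrite /lincomb (big_setID t) /= (setIidPr ts) [X in _ + X]big1 ?addr0 //.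
by move=> v; rewrite inE => /andP[vt vs]; rewrite a0 ?scale0r.
Qed.

Lemma comb_restrict s t a : t \subset s -> lincomb s (fun v => if v \in t then a v else 0) = lincomb t a.
Proof.
move=> ts; rewrite (comb_sub ts) => [|v _ /negbTE -> //].
by apply: eq_comb => v ->.
Qed.

Lemma comb1 v a : lincomb [set v] a = a v *: pos v.
Proof. exact: big_set1. Qed.

Lemma combU1 v s a : v \notin s -> lincomb (v |: s) a = a v *: pos v + lincomb s a.
Proof. exact: big_setU1. Qed.

Lemma pos_simplex v : v \in vertices L -> in_simplex (pos v).
Proof.
rewrite inE => vL; case: tL => _ _ _ /(_ (pos v)) [_]; apply; exists [set v] => //.
exists (fun=> 1); split=> [w||]; rewrite ?big_set1 ?scale1r //; exact: ler01.
Qed.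

Lemma mem_vertices s v : s \in L -> v \in s -> v \in vertices L.
Proof. by move=> sL vs; rewrite inE (face_sub sL) ?sub1set. Qed.

Lemma pos_ge0 v : v \in vertices L -> nonneg (pos v).
Proof. by move=> /pos_simplex[]. Qed.

Lemma pos_sum v : v \in vertices L -> \sum_i pos v 0 i = 1.
Proof. by move=> /pos_simplex[]. Qed.

Lemma comb_sum s a : s \in L -> \sum_i lincomb s a 0 i = \sum_(v in s) a v.
Proof.
move=> sL; rewrite (eq_bigr (fun i => \sum_(v in s) a v * pos v 0 i)); last first.
  by move=> i _; rewrite summxE; apply: eq_bigr => v _; rewrite mxE.
rewrite exchange_big; apply: eq_bigr => v vs.
by rewrite -mulr_sumr pos_sum ?mulr1 //; apply: mem_vertices vs.
Qed.

Lemma comb_free s a : s \in L -> lincomb s a = 0 -> forall v, v \in s -> a v = 0.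
Proof.
move=> sL a0; case: tL => _ /(_ s sL a) + _ _; apply=> //.
by rewrite -(comb_sum a sL) a0 big1 // => i _; rewrite mxE.
Qed.

Lemma comb_inj s a b : s \in L -> lincomb s a = lincomb s b -> {in s, a =1 b}.
Proof.
move=> sL ab v vs; apply/eqP; rewrite -subr_eq0; apply/eqP.
by apply: (comb_free sL _ vs (a := fun v => a v - b v)); rewrite combB ab subrr.
Qed.

Lemma comb_ge0 s a : s \in L -> (forall v, v \in s -> 0 <= a v) -> nonneg (lincomb s a).
Proof.
move=> sL a0 i; rewrite summxE; apply: sumr_ge0 => v vs; rewrite mxE.
by rewrite mulr_ge0 ?a0 // pos_ge0 //; apply: mem_vertices vs.
Qed.

Lemma cone_inter s t a b : s \in L -> t \in L ->
  (forall v, v \in s -> 0 <= a v) -> (forall v, v \in t -> 0 <= b v) ->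
  lincomb s a = lincomb t b -> forall v, v \in s -> v \notin t -> a v = 0.
Proof.
move=> sL tL' a0 b0 ab v vs vt.
have [l0|l0] := eqVneq (\sum_(v in s) a v) 0; first exact: (psumr_eq0P a0 l0).
set l := \sum_(v in s) a v in l0.
have lb : \sum_(v in t) b v = l by rewrite -(comb_sum b tL') -ab comb_sum.
have lp : 0 < l by rewrite lt_def l0 sumr_ge0.
have hull r c : (forall v, v \in r -> 0 <= c v) -> \sum_(v in r) c v = l ->
    in_hull pos r (l^-1 *: lincomb r c).
  move=> c0 cl; exists (fun v => if v \in r then l^-1 * c v else 0); split.
  - by move=> w; case: ifP => // wr; rewrite mulr_ge0 ?c0 // invr_ge0 ltW.
  - under eq_bigr => w wr do rewrite wr.
    by rewrite -mulr_sumr cl mulVf.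
  by rewrite -combZ; apply: eq_comb => w ->.
have [c [c0 c1 cE]] : in_hull pos (s :&: t) (l^-1 *: lincomb s a).
  case: tL => _ _ /(_ s t _ sL tL' (hull _ _ a0 erefl)) + _; apply.
  by rewrite ab; apply: hull.
have := @comb_inj s (fun v => l^-1 * a v) (fun v => if v \in s :&: t then c v else 0) sL.
rewrite combZ (comb_restrict _ (subsetIl s t)) => /(_ cE v vs) /eqP.
by rewrite inE (negbTE vt) andbF mulf_eq0 invr_eq0 (negbTE l0) => /eqP.
Qed.

(* Near a relative interior point of e, the faces containing e do not overlap. *)
Lemma local_inter e s t a b : s \in L -> t \in L -> e \subset s -> e \subset t ->
  (forall v, v \in s -> v \notin e -> 0 <= a v) ->
  (forall v, v \in t -> v \notin e -> 0 <= b v) ->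
  lincomb s a = lincomb t b -> forall v, v \in s -> v \notin t -> a v = 0.
Proof.
move=> sL tL' es et a0 b0 ab v vs vt.
pose M := \sum_(v in e) (`|a v| + `|b v|).
(* Adding a large multiple of the vertices of [e] to both sides makes all coefficients nonnegative
   and leaves those outside [e] unchanged. *)
pose lift c v := c v + (if v \in e then M else 0).
have bound v' : v' \in e -> `|a v'| + `|b v'| <= M.
  move=> ve; rewrite /M (bigD1 v') //= lerDl sumr_ge0 // => w _.
  by rewrite addr_ge0.
have ve : v \notin e by apply: contra vt; apply: (subsetP et).
have : lift a v = 0.
  apply: (@cone_inter s t _ (lift b)) => // [w ws|w wt|].
  - rewrite /lift; case: ifPn => we; last by rewrite addr0 a0.
    by have := bound _ we; have := ler_norm (- a w); have := normr_ge0 (b w); rewrite normrN; lra.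
  - rewrite /lift; case: ifPn => we; last by rewrite addr0 b0.
    by have := bound _ we; have := ler_norm (- b w); have := normr_ge0 (a w); rewrite normrN; lra.
  by rewrite /lift !combD ab !(comb_restrict (fun=> M)).
by rewrite /lift (negbTE ve) addr0.
Qed.

Lemma cone_cover y : nonneg y -> exists2 s, s \in L &
  exists a, (forall v, 0 <= a v) /\ y = lincomb s a.
Proof.
move=> y0; have [l0|l0] := eqVneq (\sum_i y 0 i) 0.
  exists set0; first exact: cplxL.1.
  exists (fun=> 0); split=> //; rewrite /lincomb big_set0; apply/rowP => i.
  by rewrite mxE (psumr_eq0P (fun i _ => y0 i) l0).
set l := \sum_i y 0 i in l0.
have lp : 0 < l by rewrite lt_def l0 sumr_ge0.
have : in_simplex (l^-1 *: y).
  split=> [i|]; first by rewrite mxE mulr_ge0 // invr_ge0 ltW.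
  by under eq_bigr => i _ do rewrite mxE; rewrite -mulr_sumr mulVf.
case: tL => _ _ _ H /H[s sL [a [a0 _ ya]]]; exists s => //.
exists (fun v => l * a v); split=> [v|]; first by rewrite mulr_ge0 // ltW.
by rewrite combZ /lincomb -ya scalerA mulfV ?scale1r.
Qed.

(* Among the points y + n m, with m the sum of the vertices of e, infinitely many
   lie in the cone of one face s, which then contains m, hence e. *)
Lemma local_cover e y : e \in L -> nonneg y -> exists2 s, s \in L &
  e \subset s /\ exists a, (forall v, v \in s -> v \notin e -> 0 <= a v) /\ y = lincomb s a.
Proof.
move=> eL y0; pose m := lincomb e (fun=> 1).
have m0 : nonneg m by apply: comb_ge0 => // v _; apply: ler01.
pose inc s (n : nat) a := (forall v, 0 <= a v) /\ y + n%:R *: m = lincomb s a.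
have [s sL unb] : exists2 s, s \in L & forall n0 : nat, exists2 n : nat, (n0 <= n)%N & exists a, inc s n a.
  apply: contrapT => no.
  have /choice[f fP] : forall s, exists n0 : nat, s \in L ->
      forall n : nat, (n0 <= n)%N -> ~ exists a, inc s n a.
    move=> s; apply: contrapT => nos; apply: no.
    have sL : s \in L by apply: contrapT => sL; apply: nos; exists 0%N.
    exists s => // n0; apply: contrapT => non; apply: nos; exists n0 => _ n nn ex.
    by apply: non; exists n.
  pose n := (\max_(s in L) f s)%N.
  have [i|s sL [a aP]] := @cone_cover (y + n%:R *: m).
    by rewrite !mxE addr_ge0 // mulr_ge0.
  apply: (fP s sL n _ (ex_intro _ a aP)).
  by rewrite /n (bigD1 s) //= leq_maxl.
have [n1 _ [a1 [a10 a1E]]] := unb 0%N.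
have [n2 n12 [a2 [a20 a2E]]] := unb n1.+1.
(* Two of the points on the ray lie in the cone of [s]; their scaled difference expresses [m] by the
   vertices of [s]. *)
pose beta v := (n2%:R - n1%:R)^-1 * (a2 v - a1 v).
have n21 : n2%:R - n1%:R != 0 :> R by rewrite subr_eq0 eqr_nat; lia.
have betaE : lincomb s beta = m.
  rewrite combZ combB -a1E -a2E opprD addrACA subrr add0r -scalerBl.
  by rewrite scalerA mulVf ?scale1r.
(* A negative coefficient of the direction would make the coefficient of [v] negative far out on the
   ray, where the cone of [s] is met again. *)
have beta0 v : v \in s -> 0 <= beta v.
  move=> vs; rewrite leNgt; apply/negP => bv.
  have q0 : 0 <= a1 v / - beta v by rewrite divr_ge0 // oppr_ge0 ltW.
  have [n3 n13 [a3 [a30 a3E]]] := unb (n1 + Num.bound (a1 v / - beta v))%N.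
  have a3v : a3 v = a1 v + (n3%:R - n1%:R) * beta v.
    apply: (comb_inj sL _ vs (b := fun v => a1 v + (n3%:R - n1%:R) * beta v)).
    by rewrite combD combZ betaE -a1E -a3E -addrA -scalerDl [n1%:R + _]addrC subrK.
  have n3b : a1 v / - beta v < n3%:R - n1%:R.
    apply: lt_le_trans (archi_boundP q0) _.
    by rewrite lerBrDl -natrD ler_nat.
  rewrite ltr_pdivrMr ?oppr_gt0 // mulrN in n3b.
  by have := a30 v; rewrite a3v; lra.
have es : e \subset s.
  apply/subsetP => v ve; apply: contraT => vs.
  have : (1 : R) = 0.
    apply: (@cone_inter e s (fun=> 1) beta) ve vs => // [w _|]; exact: ler01.
  by move/eqP; rewrite oner_eq0.
exists s => //; split=> //; exists (fun v => a1 v - (if v \in e then n1%:R else 0)); split.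
  by move=> v vs /negbTE ->; rewrite subr0.
rewrite combB (comb_restrict (fun=> n1%:R) es) -a1E -[lincomb e _](_ : n1%:R *: m = _) ?addrK //.
by rewrite /m -combZ; apply: eq_comb => v _; rewrite mulr1.
Qed.

(** Up to a positive constant the oriented area of the triangle: its sign tells on which side of the
    directed line from [v] to [w] the point [u] lies. *)
Definition angle_det v w u := det3 (pos v) (pos w) (pos u).

Lemma angC v w u : angle_det v u w = - angle_det v w u. Proof. exact: det3_anti. Qed.
Lemma angS v w u : angle_det w v u = - angle_det v w u. Proof. exact: det3_swap. Qed.
Lemma ang_alt v w : angle_det v w w = 0. Proof. exact: det3_alt2. Qed.
Lemma set3C v w u : [set v; u; w] = [set v; w; u].
Proof. by rewrite -!setUA [[set u; w]]setUC. Qed.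

Lemma set3S v w u : [set w; v; u] = [set v; w; u].
Proof. by rewrite [[set w; v]]setUC. Qed.

Lemma comb2 v w a : v != w -> lincomb [set v; w] a = a v *: pos v + a w *: pos w.
Proof. by move=> vw; rewrite combU1 ?comb1 // inE. Qed.

Lemma comb3 v w u a : v != w -> v != u -> w != u ->
  lincomb [set v; w; u] a = a v *: pos v + a w *: pos w + a u *: pos u.
Proof.
by move=> vw vu wu; rewrite -setUA combU1 ?comb2 ?addrA // !inE negb_or vw.
Qed.

Definition coef3 v w (k l m : R) x := if x == v then k else if x == w then l else m.

Lemma comb_coef3 v w u k l m : v != w -> v != u -> w != u ->
  lincomb [set v; w; u] (coef3 v w k l m) = k *: pos v + l *: pos w + m *: pos u.
Proof.
move=> vw vu wu; rewrite comb3 // /coef3 !eqxx.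
by rewrite eq_sym (negbTE vw) [u == v]eq_sym (negbTE vu) [u == w]eq_sym (negbTE wu).
Qed.

Lemma axis_ge0 i : nonneg (axis R i).
Proof. by move=> j; rewrite axisE ler0n. Qed.

Lemma edge_axis v w : v != w -> [set v; w] \in L -> exists i, det3 (pos v) (pos w) (axis R i) != 0.
Proof.
move=> vw eL; apply/existsP; apply: contraT; rewrite negb_exists => /forallP d0.
have vL : v \in vertices L by apply: (mem_vertices eL); rewrite !inE eqxx.
have wL : w \in vertices L by apply: (mem_vertices eL); rewrite !inE eqxx orbT.
have E : pos v = pos w.
  by apply: det3_axis (pos_sum vL) (pos_sum wL) _ => i; apply/eqP; rewrite -[_ == _]negbK.
have := @comb_free [set v; w] (fun x => if x == v then 1 else -1) eL.
rewrite comb2 // eqxx eq_sym (negbTE vw) E scaleN1r scale1r subrr => /(_ erefl v).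
by rewrite !inE eqxx => /(_ isT) /eqP; rewrite oner_eq0.
Qed.

Lemma tri_ang v w u : v != w -> v != u -> w != u -> [set v; w; u] \in L -> angle_det v w u != 0.
Proof.
move=> vw vu wu tL'; apply/negP => /eqP d0.
have eL : [set v; w] \in L by apply: face_sub tL' _; apply: subsetUl.
have [i di] := edge_axis vw eL.
have := cramer (pos v) (pos w) (pos u) (axis R i); rewrite -/(angle_det v w u) d0 scale0r.
rewrite -(comb_coef3 _ _ _ vw vu wu) => /esym /(comb_free tL') /(_ u).
rewrite !inE eqxx orbT /coef3 [u == v]eq_sym (negbTE vu) [u == w]eq_sym (negbTE wu).
by move=> /(_ isT) /eqP; rewrite (negbTE di).
Qed.

(** This is [local_inter] at the single vertex [v], so the coefficients at [v] may have any sign: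
    only directions seen from [v] matter. *)
Lemma nbr_inter v x s a k l : s \in L -> v \in s -> x != v -> [set v; x] \in L ->
  (forall w, w \in s -> w != v -> 0 <= a w) -> 0 <= l ->
  lincomb s a = k *: pos v + l *: pos x ->
  forall w, w \in s -> w != v -> w != x -> a w = 0.
Proof.
move=> sL vs xv vxL a0 l0 E w ws wv wx.
apply: (@local_inter [set v] s [set v; x] a (fun p : W => if p == v then k else l)) => //.
- by rewrite sub1set.
- exact: subsetUl.
- by move=> y ys; rewrite inE; apply: a0.
- by move=> y _; rewrite inE => /negbTE ->.
- by rewrite comb2 ?eqxx ?(negbTE xv) // eq_sym.
by rewrite !inE negb_or wv.
Qed.

Definition neighbour v x := (x != v) && ([set v; x] \in L).

Lemma nbr_tri v w u : u != v -> [set v; w; u] \in L -> neighbour v u.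
Proof.
move=> uv tL'; rewrite /neighbour uv; apply: face_sub tL' _.
by apply/subsetP => x; rewrite !inE => /orP[|] ->; rewrite ?orbT.
Qed.

Lemma ang_neq v w u : angle_det v w u != 0 -> [/\ v != w, v != u & w != u].
Proof.
move=> a0; split; apply: contraNneq a0 => E; rewrite /angle_det E ?det3_alt1 ?det3_alt2 //.
by rewrite det3_anti det3_alt1 oppr0.
Qed.

(** By Cramer, [x] is modulo [v] a positive combination of [w] and [u], so the edge to [x] would run
    through the inside of the triangle; [nbr_inter] makes the coefficient of [w] vanish. *)
Lemma cone_empty v w u x : [set v; w; u] \in L -> neighbour v x ->
  0 < angle_det v w u -> 0 < angle_det v w x -> 0 < angle_det v x u -> False.
Proof.
move=> tL' /andP[xv vx] wu wx xu.
have [vw vu wu'] := ang_neq (lt0r_neq0 wu).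
have [_ _ wx'] := ang_neq (lt0r_neq0 wx).
pose a := coef3 v w 0 (angle_det v x u) (angle_det v w x).
have E : lincomb [set v; w; u] a = (- det3 (pos x) (pos w) (pos u)) *: pos v + angle_det v w u *: pos x.
  by rewrite comb_coef3 // /angle_det cramer scaleNr !addrA addNr add0r scale0r add0r.
have a0 (p : W) : p != v -> 0 <= a p.
  by rewrite /a /coef3 => /negbTE ->; case: eqP => _; apply: ltW.
have aw : a w = angle_det v x u by rewrite /a /coef3 eqxx eq_sym (negbTE vw).
have := xu; rewrite -aw (nbr_inter tL' _ xv vx (fun p _ => a0 p) (ltW wu) E) ?ltxx //.
- by rewrite !inE eqxx.
- by rewrite !inE eqxx orbT.
by rewrite eq_sym.
Qed.

(** Two neighbours of [v] in the same direction are equal, as edges meet only in common faces. *)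
Lemma same_ray v w x k l m : neighbour v w -> neighbour v x -> 0 < k -> 0 <= l ->
  k *: pos w = l *: pos x + m *: pos v -> w = x.
Proof.
move=> /andP[wv vw] /andP[xv vx] k0 l0 E; apply/eqP; apply: contraT => wx.
have := @nbr_inter v x [set v; w] (fun p : W => if p == v then 0 else k) m l vw.
rewrite comb2; last by rewrite eq_sym.
rewrite eqxx (negbTE wv) scale0r add0r E addrC !inE eqxx.
move=> /(_ isT xv vx _ l0 erefl w); rewrite !inE eqxx orbT (negbTE wv) => H.
have /eqP : k = 0 by apply: H => // y _ /negbTE ->; apply: ltW.
by rewrite gt_eqF.
Qed.

(** Moving slightly from the edge towards [y] one stays in the simplex, hence in a face containing
    the edge; some vertex of that face lies strictly on the side of [y]. *)
Lemma edge_cover v w y : w != v -> [set v; w] \in L -> nonneg y ->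
  0 < det3 (pos v) (pos w) y -> exists2 u, [set v; w; u] \in L & 0 < angle_det v w u.
Proof.
move=> wv eL y0; have [s sL [es [a [a0 ->]]]] := local_cover eL y0.
rewrite /lincomb raddf_sum /= => dp.
have [u us du] : exists2 u, u \in s & 0 < a u * angle_det v w u.
  apply: contrapT => no; move: dp; rewrite ltNge => /negP; apply.
  apply: sumr_le0 => u us; rewrite linearZ /= /GRing.scale /= leNgt; apply/negP => du.
  by apply: no; exists u.
have a_pos : 0 < angle_det v w u.
  have ue : u \notin [set v; w].
    apply: contraTN du; rewrite !inE => /orP[] /eqP ->; rewrite /angle_det.
      by rewrite det3_anti det3_alt1 oppr0 mulr0 ltxx.
    by rewrite det3_alt2 mulr0 ltxx.
  by have := a0 _ us ue; rewrite le_eqVlt => /orP[/eqP E|ap]; [move: du; rewrite -E mul0r ltxx|rewrite pmulr_rgt0 in du].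
exists u => //; apply: (face_sub sL); apply/subsetP => x; rewrite !inE => /orP[xe|/eqP -> //].
by apply: (subsetP es); rewrite !inE.
Qed.

(** Of two different candidates one would lie inside the triangle of the other, unless they are on
    the same ray. *)
Lemma succ_unique v w u u' : [set v; w; u] \in L -> [set v; w; u'] \in L ->
  0 < angle_det v w u -> 0 < angle_det v w u' -> u = u'.
Proof.
move=> tu tu' du du'.
have [vw vu wu] := ang_neq (lt0r_neq0 du); have [_ vu' wu'] := ang_neq (lt0r_neq0 du').
have nu : neighbour v u by apply: nbr_tri tu; rewrite eq_sym.
have nu' : neighbour v u' by apply: nbr_tri tu'; rewrite eq_sym.
case: (ltgtP (angle_det v u u') 0) => d.
- by case: (cone_empty tu nu' du du'); rewrite angC oppr_gt0.
- by case: (cone_empty tu' nu du' du d).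
apply/esym; apply: (same_ray nu' nu du (ltW du') (m := det3 (pos u') (pos w) (pos u))).
have := cramer (pos v) (pos w) (pos u) (pos u'); rewrite -/(angle_det v w u) => ->.
by rewrite [det3 (pos v) (pos u') _]det3_anti -/(angle_det v u u') d oppr0 scale0r addr0 addrC.
Qed.

(* The cut is crossed by the walk from w to w' through successive triangles at v. *)
Lemma cut_walk v (N S : pred W) w w' :
  (forall x y z : W, N x -> N y -> neighbour v z -> 0 < angle_det v x y -> 0 < angle_det v x z -> 0 < angle_det v z y -> N z) ->
  (forall x, N x -> neighbour v x) ->
  N w -> N w' -> 0 < angle_det v w w' -> S w != S w' ->
  exists x y : W, [/\ N x, N y, [set v; x; y] \in L & S x != S y].
Proof.
(* The induction is on the number of neighbours of [v] strictly between [w] and [w']. *)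
move=> Ncone Nnbr; have [n] := ubnP #|[set x | [&& neighbour v x, 0 < angle_det v w x & 0 < angle_det v x w']]|.
elim: n w => // n IH w; rewrite ltnS => le Nw Nw' ww' Sw.
have /andP[wv vwL] := Nnbr _ Nw; have /andP[w'v vw'L] := Nnbr _ Nw'.
have [|u tu du] := edge_cover wv vwL _ ww'.
  by apply: pos_ge0; apply: (mem_vertices vw'L); rewrite !inE eqxx orbT.
have [vw vu wu] := ang_neq (lt0r_neq0 du).
have nu : neighbour v u by apply: nbr_tri tu; rewrite eq_sym.
have E := cramer (pos v) (pos w) (pos w') (pos u); rewrite -/(angle_det v w w') in E.
case: (ltgtP (angle_det v u w') 0) => d.
(* The next triangle cannot reach beyond [w'], which would then be a neighbour inside it. *)
- by case: (cone_empty tu (Nnbr _ Nw') du ww'); rewrite angC oppr_gt0.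
- have Nu : N u by apply: (Ncone w w').
  have [Suw|Suw] := eqVneq (S u) (S w); last by exists w, u; rewrite eq_sym.
  apply: (IH u) => //; last by rewrite Suw.
  apply: leq_trans le; apply: proper_card; rewrite properE; apply/andP; split.
    apply/subsetP => x; rewrite !inE => /and3P[-> ux xw'] /=; rewrite xw' andbT.
    (* The relation shows that whatever lies between [u] and [w'] also lies between [w] and [w'];
       the point [u] itself drops out of the count. *)
    have := plucker (pos v) (pos u) (pos w') (pos w) (pos x).
    rewrite -/(angle_det v u w') -/(angle_det v w x) -/(angle_det v u w) -/(angle_det v w' x) -/(angle_det v u x) -/(angle_det v w' w).
    rewrite [angle_det v u w]angC [angle_det v w' x]angC [angle_det v w' w]angC => pl.
    have : 0 < angle_det v u w' * angle_det v w x.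
      by rewrite pl mulrNN mulrN opprK addr_gt0 // mulr_gt0.
    by rewrite pmulr_rgt0.
  apply/subsetPn; exists u; rewrite !inE ?nu ?du ?d //.
  by rewrite ang_alt ltxx andbF.
have uw' : u = w'.
  apply: (same_ray nu (Nnbr _ Nw') ww' (ltW du) (m := det3 (pos u) (pos w) (pos w'))).
  by rewrite E -/(angle_det v u w') d scale0r addr0 addrC.
by exists w, w'; split=> //; rewrite -uw'.
Qed.

End Cones.

(** * Connected graphs *)

Section Graphs.
Variable V : finType.
Implicit Types (C E T : {set {set V}}) (S s t : {set V}) (x y : V).

(** The vertices are matched along a spanning tree, the root with the empty set and every other
    vertex with its tree edge. The edges outside the tree remain. *)
Lemma graph_red C : is_complex C -> (forall t, t \in C -> (#|t| <= 2)%N) ->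
  vertices C != set0 ->
  (forall S x y, x \in vertices C -> y \in vertices C -> (x \in S) != (y \in S) ->
     exists x' y', [/\ x' \in vertices C, y' \in vertices C, [set x'; y'] \in C &
       (x' \in S) != (y' \in S)]) ->
  exists E, [/\ E \subset C, forall t, t \in E -> #|t| = 2%N & red C E].
Proof.
move=> [C0 Csub] C2 /set0Pn[x0 x0C] conn.
(* What is left once a tree with vertices [S] and edges [T] has been removed, together with the
   empty set. *)
pose F T S := [set t in C | (#|t| == 2%N) && (t \notin T) || (#|t| == 1%N) && ~~ (t \subset S)].
have start : red C (F set0 [set x0]).
  have x0C' : [set x0] \in C by rewrite inE in x0C.
  have -> : F set0 [set x0] = C :\: [set set0; [set x0]].
    apply/setP => t; rewrite !inE; case tC: (t \in C); rewrite ?andbF ?andbT //=.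
    rewrite negb_or -cards_eq0; have := C2 _ tC; case tc: #|t| => [|[|[|//]]] _ //=.
      move/eqP/cards1P: tc => [y ->]; rewrite sub1set inE.
      by rewrite (inj_eq set1_inj).
    by apply/esym/eqP => tx; move: tc; rewrite tx cards1.
  apply: (@red1 _ x0).
  - by apply/subsetP => t; rewrite !inE => /orP[] /eqP ->.
  - move=> s t _; rewrite !inE => /orP[] /eqP ->; first by rewrite subset0 => ->.
    by rewrite subset1 orbC.
  move=> s; rewrite !inE => /orP[] /eqP ->; first by rewrite setU0 set0D !eqxx orbT.
  by rewrite setUid setDv !eqxx orbT.
suff [T RT] : exists T, red C (F T (vertices C)).
  exists (F T (vertices C)); split=> // [|t].
    by apply/subsetP => t; rewrite inE => /andP[].
  rewrite inE => /andP[tC /orP[/andP[/eqP //]|/andP[/cards1P[y tE]]]].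
  by rewrite tE sub1set inE -tE tC.
(* The tree grows by an edge that crosses the cut [S]; its new end [b] and the edge are removed
   together by toggling the old end [a]. *)
have grow n S T : (#|vertices C :\: S| <= n)%N -> S != set0 -> S \subset vertices C ->
    (forall t, t \in T -> t \subset S) -> red C (F T S) -> exists T', red C (F T' (vertices C)).
  elim: n S T => [|n IH] S T le S0 SC TS rS.
    exists T; have -> // : vertices C = S.
    by apply/eqP; rewrite eqEsubset SC -setD_eq0 -cards_eq0 -leqn0 le.
  have [E|] := eqVneq (vertices C :\: S) set0; first by apply: (IH S T) => //; rewrite E cards0.
  case/set0Pn => y; rewrite inE => /andP[yS yC]; have [x xS] := set0Pn _ S0.
  have [|a [b [aC bC abC Sab]]] := conn S x y (subsetP SC _ xS) yC; first by rewrite xS.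
  wlog aS : a b aC bC abC Sab / a \in S.
    move=> wl; have [aS|aS] := boolP (a \in S); first exact: (wl a b).
    apply: (wl b a) => //; first by rewrite setUC.
      by rewrite eq_sym.
    by move: Sab; rewrite (negbTE aS); case: (b \in S).
  have bS : b \notin S by move: Sab; rewrite aS; case: (b \in S).
  have ab : a != b by apply: contraNneq bS => <-.
  apply: (IH (b |: S) ([set a; b] |: T)).
  - rewrite -ltnS; apply: leq_trans le; apply: proper_card; rewrite properE.
    apply/andP; split; first by apply: setDS; apply: subsetUr.
    by apply/subsetPn; exists b; rewrite !inE ?bS ?bC ?eqxx // inE in bC *.
  - by apply/set0Pn; exists b; rewrite setU11.
  - by rewrite subUset sub1set bC.
  - move=> t; rewrite !inE => /orP[/eqP ->|/TS tS]; last by apply: subset_trans tS (subsetUr _ _).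
    by rewrite subUset !sub1set !inE aS eqxx orbT.
  apply: (red_trans rS).
  have bC' : [set b] \in C by rewrite inE in bC.
  have abT : [set a; b] \notin T.
    by apply/negP => /TS; rewrite subUset !sub1set (negbTE bS) andbF.
  have GF : [set [set b]; [set a; b]] \subset F T S.
    apply/subsetP => t; rewrite !inE => /orP[] /eqP ->; rewrite ?bC' ?abC ?cards2 ?cards1 ?ab ?abT //=.
    by rewrite sub1set bS.
  have -> : F ([set a; b] |: T) (b |: S) = F T S :\: [set [set b]; [set a; b]].
    apply/setP => t; rewrite !inE; case tC: (t \in C); rewrite ?andbF ?andbT //=.
    rewrite !negb_or; have := C2 _ tC; case tc: #|t| => [|[|[|//]]] _ //=; rewrite ?andbF //=.
      move/eqP/cards1P: tc => [z ->]; rewrite !sub1set !inE negb_or (inj_eq set1_inj).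
      case: (z =P b) => //= zb; case: (z \in S); rewrite ?andbF ?andbT //=.
      by apply/esym; apply/eqP => /(congr1 (fun s : {set V} => #|s|)); rewrite cards1 cards2 ab.
    have -> : t != [set b] by apply/eqP => tx; move: tc; rewrite tx cards1.
    by rewrite !orbF.
  apply: (@red1 _ a) => // [s t|s].
    rewrite inE => /andP[sC sF]; rewrite !inE => /orP[] /eqP ->.
      rewrite subset1 => /orP[-> //|/eqP s0].
      by move: sF; rewrite s0 cards0.
    move=> sab; have := C2 _ sC; case sc: #|s| sF => [|[|[|//]]] //= sF _.
      move/eqP/cards1P: sc sab sF => [z ->]; rewrite !sub1set !inE => /orP[] /eqP ->.
        by rewrite aS.
      by rewrite eqxx.
    by rewrite [s == [set a; b]]eqEcard sab sc cards2 ab orbT.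
  rewrite !inE => /orP[] /eqP ->.
    rewrite eqxx orbT; split=> //; apply/orP; left.
    by apply/eqP/setDidPl; rewrite disjoint_sym disjoints1 inE.
  rewrite setUA setUid eqxx orbT; split=> //; apply/orP; left.
  by apply/eqP; rewrite setU1K // inE.
apply: (grow #|vertices C :\: [set x0]| [set x0] set0) => //.
- by apply/set0Pn; exists x0; rewrite inE.
- by rewrite sub1set.
by move=> t; rewrite inE.
Qed.

Lemma graph_red_card C E : is_complex C -> (forall t, t \in C -> (#|t| <= 2)%N) ->
  (forall t, t \in E -> #|t| = 2%N) -> red C E ->
  (#|E| + #|vertices C| = 1 + Defs.fcard C 2)%N.
Proof.
move=> cC C2 E2 /euler_red; rewrite (euler_fcard C2) !big_ord_recr /= big_ord0.
rewrite (fcard0 cC) fcard1 /euler (eq_bigr (fun=> 1)) => [|t /E2 ->]; last by rewrite -signr_odd.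
rewrite sumr_const !natz expr1 mulNrn natz; set m := (X in _ = Posz X) => H.
by rewrite -[#|E|]/m; lia.
Qed.

End Graphs.

(** * Links of vertices *)

Section VertexLinks.
Variables (R : realType) (W : finType) (L : {set {set W}}) (pos : W -> 'rV[R]_3).
Hypothesis tL : triangulates_simplex L pos.
Implicit Types (r s t e N S : {set W}) (u v w x : W) (y z : 'rV[R]_3) (a b c : W -> R).

Local Notation ang := (angle_det pos).
Local Notation nbr := (neighbour L).
Local Notation comb := (lincomb pos).

(** Cramer's rule is a linear relation between any four vectors of R^3, and its coefficient at the
    fourth is nonzero when the first three span a triangle. *)
Lemma face_le3 s : s \in L -> (#|s| <= 3)%N.
Proof.
move=> sL; rewrite leqNgt; apply/negP => s4.
have [u us] : exists u, u \in s by apply/set0Pn; rewrite -card_gt0; lia.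
have [v] : exists v, v \in s :\ u.
  by apply/set0Pn; rewrite -card_gt0; move: s4; rewrite (cardsD1 u s) us; lia.
rewrite !inE => /andP[vu vs].
have [w] : exists w, w \in s :\: [set u; v].
  apply/set0Pn; rewrite -card_gt0 cardsD; have := subset_leq_card (subsetIr s [set u; v]).
  by rewrite cards2; case: (u != v); lia.
rewrite !inE negb_or => /andP[/andP[wu wv] ws].
have uvw : [set u; v; w] \subset s by rewrite !subUset !sub1set us vs ws.
have [x] : exists x, x \in s :\: [set u; v; w].
  apply/set0Pn; rewrite -card_gt0 cardsD (setIidPr uvw).
  have : (#|[set u; v; w]| <= 3)%N.
    by apply: leq_trans (leq_card_setU _ _) _; rewrite cards1 cards2; case: (u != v).
  by lia.
rewrite !inE !negb_or => /andP[/andP[/andP[xu xv] xw] xs].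
have uv : u != v by rewrite eq_sym.
have uw : u != w by rewrite eq_sym.
have vw : v != w by rewrite eq_sym.
have tuvw := face_sub tL sL uvw.
have xuvw : x \notin [set u; v; w] by rewrite !inE !negb_or xu xv xw.
have xL : x |: [set u; v; w] \in L by apply: (face_sub tL sL); rewrite subUset sub1set xs.
have := cramer (pos u) (pos v) (pos w) (pos x); rewrite -/(ang u v w).
set k := det3 _ _ (pos w); set l := det3 _ _ (pos w); set m := det3 _ _ (pos x) => E.
pose a p := if p == x then - ang u v w else coef3 u v k l m p.
have a0 : comb (x |: [set u; v; w]) a = 0.
  have -> : comb (x |: [set u; v; w]) a =
      - ang u v w *: pos x + comb [set u; v; w] (coef3 u v k l m).
    rewrite combU1 // {1}/a eqxx; congr (_ + _); apply: eq_comb => p pu.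
    by rewrite /a; case: eqP => // px; rewrite -px pu in xuvw.
  by rewrite comb_coef3 // scaleNr E addNr.
have := comb_free tL xL a0 (setU11 _ _); rewrite /a eqxx => /eqP.
by rewrite oppr_eq0 (negbTE (tri_ang tL uv uw vw tuvw)).
Qed.

Section AtVertex.
Variables (v : W) (N : {set W}).
Hypothesis vL : v \in vertices L.
Hypothesis Nn : forall x, x \in N -> nbr v x.

(** Keeping only the vertices in [N] covers two cases: the full link, with [N] all neighbours, and
    the lower link of the sweep, with [N] the neighbours in an open half-plane. *)
Definition lk : {set {set W}} := [set t in link L [set v] | t \subset N].

Lemma vN : v \notin N.
Proof. by apply/negP => /Nn; rewrite /neighbour eqxx. Qed.

Lemma mem_lk t : (t \in lk) = (t \subset N) && (v |: t \in L).
Proof.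
rewrite inE (mem_link _ _ (cplxL tL)) andbC; case tN: (t \subset N) => //=.
by rewrite disjoint_sym disjoint_subset (subset_trans tN) //; apply/subsetP => x; rewrite !inE;
   apply: contraTneq => ->; exact: vN.
Qed.

Lemma lk_complex : is_complex lk.
Proof.
split=> [|s t]; rewrite !mem_lk; first by rewrite sub0set setU0; move: vL; rewrite inE.
move=> /andP[sN sL] ts; rewrite (subset_trans ts sN) (face_sub tL sL) //; exact: setUS.
Qed.

Lemma lk_le2 t : t \in lk -> (#|t| <= 2)%N.
Proof.
rewrite mem_lk => /andP[tN /face_le3]; rewrite cardsU1.
by rewrite (contra (subsetP tN v)) ?vN.
Qed.

Lemma lk_vertices : vertices lk = N.
Proof.
apply/setP => x; rewrite inE mem_lk sub1set.
by case xN: (x \in N) => //=; case/andP: (Nn xN).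
Qed.

Lemma lk_edge x x' : x \in N -> x' \in N -> ([set x; x'] \in lk) = ([set v; x; x'] \in L).
Proof. by move=> xN x'N; rewrite mem_lk subUset !sub1set xN x'N setUA. Qed.

Definition fwd w u := (u \in N) && ([set v; w; u] \in L) && (0 < ang v w u).

Definition has_fwd := [set w in N | [exists u, fwd w u]].

(** Each edge of the link is positively oriented from exactly one of its ends, and an end has at
    most one successor. *)
Lemma lk_edges : Defs.fcard lk 2 = #|has_fwd|.
Proof.
pose f w := [set w; odflt w [pick u | fwd w u]].
have fP w : w \in has_fwd -> exists2 u, fwd w u & f w = [set w; u].
  rewrite inE => /andP[_ /existsP[u0 wu0]]; rewrite /f.
  by case: pickP => [u wu|/(_ u0)]; [exists u|rewrite wu0].
rewrite -(card_in_imset (f := f)); last first.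
  move=> w w' wN wN'; have [u wu ->] := fP _ wN; have [u' wu' ->] := fP _ wN' => E.
  apply/eqP; apply: contraT => ww'.
  have : w \in [set w'; u'] by rewrite -E !inE eqxx.
  rewrite !inE (negbTE ww') /= => /eqP wu2.
  have : w' \in [set w; u] by rewrite E !inE eqxx.
  rewrite !inE eq_sym (negbTE ww') /= => /eqP wu3.
  move: wu wu'; rewrite /fwd -wu2 -wu3 => /andP[_ p1] /andP[_ ].
  by rewrite (angC _ v w w') oppr_gt0 ltNge (ltW p1).
apply: eq_card => t; rewrite inE; apply/andP/imsetP => [[tl /cards2P[w [u [wu tE]]]]|[w wf ->]]; last first.
  have [u /andP[/andP[uN wuL] wu] ->] := fP _ wf; move: wf; rewrite inE => /andP[wN _].
  have [_ _ wu'] := ang_neq (lt0r_neq0 wu).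
  by rewrite lk_edge // wuL cards2 wu'.
have /andP[tN _] : (t \subset N) && (v |: t \in L) by rewrite -mem_lk.
have wN : w \in N by apply: (subsetP tN); rewrite tE !inE eqxx.
have uN : u \in N by apply: (subsetP tN); rewrite tE !inE eqxx orbT.
have wuL : [set v; w; u] \in L by rewrite -lk_edge // -tE.
have vw : v != w by apply: contraNneq vN => ->.
have vu : v != u by apply: contraNneq vN => ->.
have sol w1 u1 : w1 \in N -> u1 \in N -> [set v; w1; u1] \in L -> 0 < ang v w1 u1 ->
    exists2 x, x \in has_fwd & [set w1; u1] = f x.
  move=> w1N u1N L1 d1; have wf : w1 \in has_fwd.
    by rewrite inE w1N; apply/existsP; exists u1; rewrite /fwd u1N L1.
  exists w1 => //; have [u2 /andP[/andP[u2N L2] d2] ->] := fP _ wf.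
  by rewrite (succ_unique tL L1 L2).
have := tri_ang tL vw vu wu wuL; rewrite neq_lt => /orP[d|d]; last first.
  by have [x xf E] := sol _ _ wN uN wuL d; exists x; rewrite ?tE.
have [||||x xf E] := sol u w => //; first by rewrite set3C.
  by rewrite angC oppr_gt0.
by exists x => //; rewrite tE setUC.
Qed.

(** Connectivity in the form of cuts, as [graph_red] consumes it: a set that separates two points of
    [N] is crossed by an edge. *)
Definition linked := forall S w w', w \in N -> w' \in N -> (w \in S) != (w' \in S) ->
  exists x x', [/\ x \in N, x' \in N, [set v; x; x'] \in L & (x \in S) != (x' \in S)].

Hypothesis N0 : N != set0.
Hypothesis Nc : linked.

Lemma lk_graph : exists E : {set {set W}}, [/\ E \subset lk, forall t, t \in E -> #|t| = 2%N, red lk E &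
  (#|E| + #|N| = 1 + #|has_fwd|)%N].
Proof.
have [||E [EC E2 rE]] := graph_red lk_complex lk_le2.
- by rewrite lk_vertices.
- move=> S x x'; rewrite lk_vertices => xN x'N Sx.
  have [x1 [x2 [x1N x2N xL S12]]] := Nc xN x'N Sx.
  by exists x1, x2; rewrite lk_edge.
exists E; split=> //; rewrite -lk_edges -{1}lk_vertices.
exact: graph_red_card lk_complex lk_le2 E2 rE.
Qed.

(** A connected graph with fewer edges than vertices is a tree, so no edge survives the
    reduction. *)
Lemma lk_red0 : has_fwd != N -> red lk set0.
Proof.
move=> hN; have [E [_ _ rE EN]] := lk_graph.
suff E0 : E = set0 by rewrite -E0.
apply: cards0_eq; have : (#|has_fwd| < #|N|)%N.
  by apply: proper_card; rewrite properEneq hN; apply/subsetP => x; rewrite inE => /andP[].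
by set m := #|E| in EN *; lia.
Qed.

(** As many edges as vertices: exactly one edge lies outside a spanning tree. *)
Lemma lk_red1 : has_fwd = N -> exists2 tau : {set W}, #|tau| = 2%N & red lk [set tau].
Proof.
move=> hN; have [E [_ E2 rE]] := lk_graph; rewrite hN addnC => EN.
have /eqP/cards1P[tau tE] : #|E| = 1%N by set m := #|E| in EN *; lia.
by exists tau; rewrite -?tE // E2 // tE inE.
Qed.

End AtVertex.

End VertexLinks.

(** * Connectivity and sweep *)

Definition lin (R : realFieldType) (c y : 'rV[R]_3) : R :=
  c 0 o0 * y 0 o0 + c 0 o1 * y 0 o1 + c 0 o2 * y 0 o2.

Lemma lin_is_linear (R : realFieldType) (c : 'rV[R]_3) : linear (lin c : 'rV_3 -> R^o).
Proof. by move=> a u v; rewrite /lin !mxE /GRing.scale /=; ring. Qed.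

HB.instance Definition _ (R : realFieldType) (c : 'rV[R]_3) :=
  GRing.isLinear.Build R 'rV[R]_3 R^o _ (lin c) (lin_is_linear c).

Section Connectivity.
Variables (R : realType) (W : finType) (L : {set {set W}}) (pos : W -> 'rV[R]_3).
Hypothesis tL : triangulates_simplex L pos.
Implicit Types (r s t e N S : {set W}) (u v w x : W) (y z : 'rV[R]_3) (a b : W -> R).

Local Notation ang := (angle_det pos).
Local Notation nbr := (neighbour L).
Local Notation comb := (lincomb pos).

Definition nbrs v := [set x | nbr v x].

Lemma nbr_vertex v w : nbr v w -> w \in vertices L.
Proof. by move=> /andP[_ vw]; apply: (mem_vertices tL vw); rewrite !inE eqxx orbT. Qed.

Lemma linked_nbrs v : linked L v (nbrs v).
Proof.
move=> S w w'; rewrite !inE => nw nw' Sw.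
have walk x x' : nbr v x -> nbr v x' -> 0 < ang v x x' -> (x \in S) != (x' \in S) ->
    exists x1 x2, [/\ x1 \in nbrs v, x2 \in nbrs v, [set v; x1; x2] \in L & (x1 \in S) != (x2 \in S)].
  move=> nx nx' xx' Sx.
  have [//|//|x1 [x2 [n1 n2 x12 S12]]] := @cut_walk _ _ _ _ tL v (nbr v) (fun p => p \in S) x x' _ _ nx nx' xx' Sx.
  by exists x1, x2; rewrite !inE.
case: (ltgtP (ang v w w') 0) => d; last 2 first.
- exact: walk d Sw.
(* Here [w] and [w'] are in opposite directions from [v], as they are distinct. A neighbour [u] off
   the line serves as a stop between them: either the cut separates [w] from [u], or it separates
   [u] from [w'] and the walk applies. *)
- have /andP[wv vw] := nw; have vw' : v != w by rewrite eq_sym.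
  have [u [uL du]] : exists u, [set v; w; u] \in L /\ ang v w u != 0.
    have [i] := edge_axis tL vw' vw; rewrite neq_lt => /orP[di|di].
      have wvL : [set w; v] \in L by rewrite setUC.
      have di' : 0 < det3 (pos w) (pos v) (axis R i) by rewrite det3_swap oppr_gt0.
      have [u uL du] := edge_cover tL vw' wvL (axis_ge0 R i) di'.
      exists u; rewrite set3S in uL; split=> //.
      by rewrite angS oppr_eq0 lt0r_neq0.
    have [u uL du] := edge_cover tL wv vw (axis_ge0 R i) di.
    by exists u; rewrite lt0r_neq0.
  have [_ vu wu] := ang_neq du.
  have nu : nbr v u by apply: (nbr_tri tL) uL; rewrite eq_sym.
  have [Suw|Suw] := eqVneq (w \in S) (u \in S); last by exists w, u; rewrite !inE.
  have E := cramer (pos v) (pos w) (pos u) (pos w').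
  rewrite -/(ang v w u) -/(ang v w' u) -/(ang v w w') d scale0r addr0 addrC in E.
  have ww' : w' <> w by move=> ww'; rewrite ww' eqxx in Sw.
  move: du; rewrite neq_lt => /orP[du|du].
    have du' : 0 < ang v w' u.
      rewrite ltNge; apply/negP => le0; apply: ww'.
      apply: (same_ray tL nw' nw (k := - ang v w u) (l := - ang v w' u) (m := - det3 (pos w') (pos w) (pos u))).
      + by rewrite oppr_gt0.
      + by rewrite oppr_ge0.
      by rewrite !scaleNr -opprD E.
    by apply: walk du' _ => //; rewrite eq_sym -Suw.
  have du' : 0 < ang v u w'.
    rewrite angC oppr_gt0 ltNge; apply/negP => le0; apply: ww'.
    exact: (same_ray tL nw' nw du le0 E).
  by apply: walk du' _ => //; rewrite -Suw.
by apply: (walk w' w) => //; rewrite ?(eq_sym (w' \in S)) // angC oppr_gt0.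
Qed.

Section HalfPlane.
Variables (v : W) (k : 'rV[R]_3).
Hypothesis k0 : lin k (pos v) = 0.

Definition half := [set w | nbr v w && (0 < lin k (pos w))].

Lemma half_nbr w : w \in half -> nbr v w.
Proof. by rewrite inE => /andP[]. Qed.

Lemma half_pos w : w \in half -> 0 < lin k (pos w).
Proof. by rewrite inE => /andP[]. Qed.

Lemma lin_cramer w u x :
  ang v w u * lin k (pos x) = ang v x u * lin k (pos w) + ang v w x * lin k (pos u).
Proof.
have := congr1 (lin k) (cramer (pos v) (pos w) (pos u) (pos x)).
by rewrite !linearD !linearZ /= k0 scaler0 add0r.
Qed.

(** Collinear neighbours are on the same ray or on opposite ones; a form vanishing at [v] and
    positive on both excludes the latter. *)
Lemma half_ang w w' : w \in half -> w' \in half -> w != w' -> ang v w w' != 0.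
Proof.
rewrite !inE => /andP[nw hw] /andP[nw' hw'] ww'; apply: contra_neq ww' => d.
have /andP[wv vw] := nw; have vw' : v != w by rewrite eq_sym.
have [i di] := edge_axis tL vw' vw.
have E := cramer (pos v) (pos w) (axis R i) (pos w').
rewrite -/(ang v w w') d scale0r addr0 addrC in E.
have := congr1 (lin k) E; rewrite !linearD !linearZ /= k0 scaler0 addr0 => E'.
apply/esym; set D := det3 _ _ _ in di E E'; set D' := det3 _ (pos w') _ in E E'.
(* The sign of [D] is unknown; multiplying the relation by [D] makes its left coefficient
   positive. *)
apply: (same_ray tL nw' nw (k := D * D) (l := D * D')
  (m := D * det3 (pos w') (pos w) (axis R i))).
- by rewrite -expr2 exprn_even_gt0.
- rewrite -(pmulr_rge0 _ hw) mulrC -mulrA -[D' * _]E' /GRing.scale /= mulrA -expr2.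
  by rewrite mulr_ge0 ?sqr_ge0 // ltW.
by rewrite -!scalerA E scalerDr.
Qed.

Lemma linked_half : linked L v half.
Proof.
move=> S w w' wN w'N Sw.
have walk x x' : x \in half -> x' \in half -> 0 < ang v x x' -> (x \in S) != (x' \in S) ->
    exists x1 x2, [/\ x1 \in half, x2 \in half, [set v; x1; x2] \in L & (x1 \in S) != (x2 \in S)].
  move=> nx nx' xx' Sx.
  apply: (@cut_walk _ _ _ _ tL v (fun p => p \in half) (fun p => p \in S) x x') => //.
    move=> p q t hp hq nt pq pt tq; rewrite inE nt /=.
    rewrite -(pmulr_rgt0 _ pq) lin_cramer.
    by move: hp hq; rewrite !inE => /andP[_ hp] /andP[_ hq]; rewrite addr_gt0 // mulr_gt0.
  exact: half_nbr.
have ww' : w != w' by apply: contraNneq Sw => ->.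
have := half_ang wN w'N ww'; rewrite neq_lt => /orP[d|d]; last exact: walk d Sw.
by apply: (walk w' w) => //; rewrite ?(eq_sym (w' \in S)) // angC oppr_gt0.
Qed.

(** Directions in an open half-plane are linearly ordered by [slope], taken relative to a fixed
    [w0]; the one of largest slope has no successor. *)
Lemma half_fwd : half != set0 -> has_fwd L pos v half != half.
Proof.
case/set0Pn => w0 w0N; pose slope w := ang v w0 w / lin k (pos w).
have [w wN wmax] := arg_maxP slope w0N.
apply/negP => /eqP E; have : w \in has_fwd L pos v half by rewrite E.
rewrite inE => /andP[_ /existsP[u /andP[/andP[uN _] wu]]].
have : slope u <= slope w := wmax u uN.
rewrite leNgt => /negP; apply; rewrite /slope.
have h0 := half_pos w0N; have hw := half_pos wN; have hu := half_pos uN.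
rewrite ltr_pdivrMr // mulrAC ltr_pdivlMr // -subr_gt0.
have := lin_cramer w u w0; rewrite [ang v w w0]angC => E0.
have : 0 < ang v w u * lin k (pos w0) by rewrite mulr_gt0.
by rewrite E0 mulNr.
Qed.

End HalfPlane.

Lemma nonroot (p : {poly R}) : p != 0 -> exists x : R, p.[x] != 0.
Proof.
move=> p0; apply: contrapT => no.
have := @max_poly_roots _ p [seq i%:R | i <- iota 0 (size p)] p0.
rewrite size_map size_iota ltnn => H; suff : false by []; apply: H => //.
  by apply/allP => x _; apply: contrapT => px; apply: no; exists x; apply/negP.
rewrite map_inj_uniq ?iota_uniq // => i j /eqP.
by rewrite eqr_nat => /eqP.
Qed.

Lemma pos_inj : {in vertices L &, injective pos}.
Proof.
move=> v w vL wL E; apply/eqP; apply: contraT => vw.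
have : (1 : R) = 0.
  apply: (@cone_inter _ _ _ _ tL [set v] [set w] (fun=> 1) (fun=> 1)) (set11 v) _.
  - by rewrite inE in vL.
  - by rewrite inE in wL.
  - by move=> *; apply: ler01.
  - by move=> *; apply: ler01.
  - by rewrite !comb1 E.
  by rewrite inE.
by move/eqP; rewrite oner_eq0.
Qed.

(** In the pencil of forms [axis R o0 + d *: axis R o1], each pair of vertices excludes only the
    roots of a nonzero polynomial in [d]. Two coordinates suffice since the coordinate sum is 1. *)
Lemma generic_lin : exists c : 'rV[R]_3, {in vertices L &, injective (fun w => lin c (pos w))}.
Proof.
pose q (p : W * W) : {poly R} :=
  (pos p.1 0 o0 - pos p.2 0 o0)%:P + (pos p.1 0 o1 - pos p.2 0 o1)%:P * 'X.
pose P (p : W * W) := [&& p.1 \in vertices L, p.2 \in vertices L & p.1 != p.2].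
have q0 p : P p -> q p != 0.
  move=> /and3P[p1 p2 p12]; apply: contra_neq p12 => q0; apply: pos_inj => //.
  have e0 : pos p.1 0 o0 = pos p.2 0 o0.
    have := congr1 (fun f : {poly R} => f`_0) q0.
    by rewrite coefD coefC coefMX coef0 addr0 => /eqP; rewrite subr_eq0 => /eqP.
  have e1 : pos p.1 0 o1 = pos p.2 0 o1.
    have := congr1 (fun f : {poly R} => f`_1) q0.
    by rewrite coefD coefC coefMX coefC coef0 add0r => /eqP; rewrite subr_eq0 => /eqP.
  have := pos_sum tL p1; rewrite -(pos_sum tL p2) !sum3 e0 e1 => /addrI.
  exact: row3P.
have [|d d0] := @nonroot (\prod_(p | P p) q p); first by apply/prodf_neq0.
exists (axis R o0 + d *: axis R o1) => v w vL wL E; apply/eqP; apply: contraT => vw.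
move: d0; rewrite horner_prod (bigD1 (v, w)) /= ?mulf_eq0 ?negb_or; last by rewrite /P vL wL.
move=> /andP[qd _]; case/negP: qd; rewrite /q !hornerE /=.
by move: E; rewrite /lin !mxE /= => E; apply/eqP; lra.
Qed.

(** The vector of [x] is written in a face through [v], with a free coefficient at [v] only. One of
    the other terms must be positive under [k], and its vertex is a neighbour. *)
Lemma half_nonempty v x (k : 'rV[R]_3) : v \in vertices L -> x \in vertices L ->
  lin k (pos v) = 0 -> 0 < lin k (pos x) -> half v k != set0.
Proof.
move=> vL xL k0 kx; have vL' : [set v] \in L by rewrite inE in vL.
have [s sL [vs [a [a0 E]]]] := local_cover tL vL' (pos_ge0 tL xL).
have [w ws aw] : exists2 w, w \in s & 0 < a w * lin k (pos w).
  apply: contrapT => no; move: kx; rewrite E raddf_sum /= ltNge => /negP; apply.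
  apply: sumr_le0 => u us; rewrite linearZ /= /GRing.scale /= leNgt; apply/negP => du.
  by apply: no; exists u.
have wv : w != v by apply: contraTneq aw => ->; rewrite k0 mulr0 ltxx.
apply/set0Pn; exists w; rewrite inE /neighbour wv (face_sub tL sL) /=; last first.
  by rewrite subUset vs sub1set.
have := a0 _ ws; rewrite inE => /(_ wv); rewrite le_eqVlt => /orP[/eqP E0|ap].
  by move: aw; rewrite -E0 mul0r ltxx.
by rewrite pmulr_rgt0 in aw.
Qed.

(* Sweep the triangle by a generic linear form: the lower link of each vertex
   but the first one is a path. *)
Lemma red_triangulation : red L set0.
Proof.
have [c cinj] := generic_lin; pose f w := lin c (pos w).
pose LS S := [set t in L | t \subset S].
(* [S] runs through the sublevel sets of [f]; the induction removes the highest vertex. *)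
have main n S : #|S| = n -> S != set0 -> S \subset vertices L ->
    (forall x y : W, x \in S -> y \in vertices L -> f y < f x -> y \in S) -> red (LS S) set0.
  elim: n S => [|n IH] S Sn S0 SL Slow; first by rewrite (cards0_eq Sn) eqxx in S0.
  have [x0 x0S] := set0Pn _ S0; have [v vS vmax] := arg_maxP f x0S.
  have {}vS : v \in S := vS.
  have vL := subsetP SL _ vS; have vL' : [set v] \in L by rewrite inE in vL.
  have lt_v w : w \in S -> w != v -> f w < f v.
    move=> wS wv; rewrite lt_neqAle; apply/andP; split; last exact: vmax.
    by apply: contra_neq wv => E; apply: cinj => //; apply: (subsetP SL).
  have [S'0|S'0] := eqVneq (S :\ v) set0.
    have SE : S = [set v] by rewrite -(setD1K vS) S'0 setU0.
    apply: (@red_toggled _ v) => t; rewrite inE SE => /andP[tL' tv].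
    have tv1 : v |: t \subset [set v] by rewrite subUset subxx.
    have tv2 : t :\ v \subset t := subsetDl _ _.
    split; rewrite inE; apply/andP; split=> //.
    - exact: (face_sub tL vL' tv1).
    - exact: (face_sub tL tL' tv2).
    exact: subset_trans tv2 tv.
  have sub : LS (S :\ v) \subset LS S.
    by apply/subsetP => t; rewrite !inE => /andP[-> ts]; rewrite (subset_trans ts) ?subsetDl.
  have low : lower (LS S) (LS (S :\ v)).
    by move=> s t; rewrite !inE => /andP[-> _] /andP[_ ts] st; apply: subset_trans st ts.
  have rS : red (LS (S :\ v)) set0.
    apply: IH => //.
    - by apply/eqP; rewrite -eqSS cardD1S ?Sn.
    - exact: subset_trans (subsetDl _ _) SL.
    move=> x y; rewrite !in_setD1 => /andP[xv xS] yL yx.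
    rewrite (Slow x) // andbT; apply: contraTneq yx => ->.
    by rewrite -leNgt; apply: vmax.
  apply: red_trans (red_lower0 sub low rS) _.
  (* On points of coordinate sum 1, the constant row [f v] gives the constant [f v]; so [k] is the
     homogeneous form of [f v - f]. *)
  pose k : 'rV[R]_3 := const_mx (f v) - c.
  have kE w : w \in vertices L -> lin k (pos w) = f v - f w.
    move=> wL; have := pos_sum tL wL; rewrite sum3 => s1.
    by rewrite /k /f {1}/lin !mxE -[X in _ = X - _]mulr1 -s1 /lin; ring.
  have k0 : lin k (pos v) = 0 by rewrite kE ?subrr.
  have halfE w : (w \in half v k) = nbr v w && (w \in S :\ v).
    rewrite in_setD1 inE; case nw : (nbr v w) => //=.
    have wL := nbr_vertex nw; have /andP[wv _] := nw; rewrite kE // subr_gt0 wv /=.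
    by apply/idP/idP => [/(Slow v) ->|wS] //; apply: lt_v.
  have hn : half v k != set0.
    have [x xS] := set0Pn _ S'0; move: xS; rewrite in_setD1 => /andP[xv xS].
    by apply: (@half_nonempty v x) => //; rewrite ?kE ?subr_gt0 ?lt_v // (subsetP SL).
  have vh : v \notin half v k by rewrite halfE !inE eqxx andbF.
  (* The faces lost with [v] are those containing [v]: the lower link with [v] added to each
     member. *)
  have -> : LS S :\: LS (S :\ v) = jn (lk L v (half v k)) [set [set v]].
    have memlk := mem_lk tL (@half_nbr v k).
    apply/setP => t; rewrite !inE; apply/andP/jnP.
      move=> [+ /andP[tL' tS]]; rewrite tL' /= => tSv.
      have vt : v \in t.
        apply: contraNT tSv => vt; apply/subsetP => x xt; rewrite !inE (subsetP tS) // andbT.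
        by apply: contraNneq vt => <-.
      exists (t :\ v), [set v]; split; [|by rewrite inE|by rewrite setUC setD1K].
      rewrite memlk setD1K // tL' andbT.
      apply/subsetP => x; rewrite in_setD1 => /andP[xv xt].
      rewrite halfE in_setD1 xv (subsetP tS) // !andbT /neighbour xv (face_sub tL tL') //.
      by rewrite subUset !sub1set vt xt.
    move=> [r [_ [rl /set1P -> ->]]]; move: rl; rewrite memlk setUC => /andP[rh rL].
    rewrite rL /=; split; first by rewrite subUset sub1set setD11 andbF.
    rewrite subUset sub1set vS andbT; apply/subsetP => x /(subsetP rh).
    by rewrite halfE in_setD1 => /and3P[].
  rewrite -(jn0 [set [set v]]); apply: (red_jn (D := ~: [set v])).
    split=> [r|t /set1P ->]; last by rewrite disjoints1 !inE eqxx.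
    rewrite (mem_lk tL (@half_nbr v k)) => /andP[rh _]; apply/subsetP => x xr.
    by rewrite !inE; apply: contraTneq xr => ->; apply: contra vh; apply: (subsetP rh).
  apply: (lk_red0 tL vL (@half_nbr v k) hn (linked_half k0)).
  exact: half_fwd.
have -> : L = LS (vertices L).
  apply/setP => t; rewrite inE; case tL' : (t \in L) => //=.
  by apply/esym/subsetP => x xt; apply: (mem_vertices tL tL' xt).
apply: (main #|vertices L|) => //.
have [s sL [a [_ E]]] := cone_cover tL (axis_ge0 R o0).
have [s0|/set0Pn[x xs]] := eqVneq s set0.
  have := congr1 (fun y : 'rV[R]_3 => y 0 o0) E.
  by rewrite s0 /lincomb big_set0 !mxE /= => /eqP; rewrite oner_eq0.
by apply/set0Pn; exists x; apply: (mem_vertices tL sL xs).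
Qed.

End Connectivity.

(** * A triangulated triangle is a disc *)

Section TriangulatedTriangle.
Variables (R : realType) (W : finType) (L : {set {set W}}) (pos : W -> 'rV[R]_3).
Hypothesis tL : triangulates_simplex L pos.
Hypothesis oL : only_original_boundary_vertices L pos.
Implicit Types (r s t e N S : {set W}) (u v w x : W) (y z : 'rV[R]_3) (a b : W -> R).

Local Notation ang := (angle_det pos).
Local Notation nbr := (neighbour L).
Local Notation comb := (lincomb pos).
Local Notation B := (boundary_complex L pos).
Local Notation sigma := (vertices (boundary_complex L pos)).

Lemma mem_sigma v : (v \in sigma) = (v \in vertices L) && [exists i, pos v 0 i == 0].
Proof.
rewrite !inE; case: ([set v] \in L) => //=; apply: eq_existsb => i.
by apply/forall_inP/eqP => [/(_ v (set11 v))/eqP|vi w /set1P ->] //; apply/eqP.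
Qed.

Lemma sigma_axis v : v \in sigma -> exists i, pos v = axis R i.
Proof. exact: oL. Qed.

Lemma pos_axis v i : v \in vertices L -> (forall j, j != i -> pos v 0 j = 0) -> pos v = axis R i.
Proof.
move=> vL v0; apply/rowP => j; rewrite axisE; case: (eqVneq j i) => [->|/v0 //].
by have := pos_sum tL vL; rewrite (bigD1 i) //= big1 ?addr0 // => k /v0.
Qed.

Lemma other_axis i : exists j : 'I_3, j != i.
Proof. by case: (ord3P i) => ->; [exists o1|exists o0|exists o0]. Qed.

Lemma axis_sigma v i : v \in vertices L -> pos v = axis R i -> v \in sigma.
Proof.
move=> vL vi; rewrite mem_sigma vL; have [j ji] := other_axis i.
by apply/existsP; exists j; rewrite vi axisE (negbTE ji).
Qed.

Lemma coord_face s a j : s \in L -> (forall v, 0 <= a v) -> comb s a 0 j = 0 ->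
  forall v, v \in s -> a v != 0 -> pos v 0 j = 0.
Proof.
move=> sL a0; rewrite summxE => /psumr_eq0P s0 v vs av.
have := s0 _ v vs; rewrite mxE => /(_ _)/eqP; rewrite mulf_eq0 (negbTE av) => H; apply/eqP/H.
by move=> w ws; rewrite mxE mulr_ge0 // (pos_ge0 tL) //; apply: (mem_vertices tL sL ws).
Qed.

(** A face that covers the corner uses only vertices lying on both sides through it, and the corner
    is the only such point. *)
Lemma corner_ex i : exists v, (v \in vertices L) && (pos v == axis R i).
Proof.
have [s sL [a [a0 E]]] := cone_cover tL (axis_ge0 R i).
have [v vs av] : exists2 v, v \in s & a v != 0.
  apply: contrapT => no; have := congr1 (fun y : 'rV[R]_3 => y 0 i) E.
  rewrite axisE eqxx /lincomb big1 ?mxE => [/eqP|v vs]; first by rewrite oner_eq0.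
  apply: contrapT => av; apply: no; exists v => //.
  by apply: contra_notN av => /eqP ->; rewrite scale0r.
exists v; have vL := mem_vertices tL sL vs; rewrite vL /=; apply/eqP/pos_axis => // j ji.
by apply: (coord_face sL a0) vs av; rewrite -E axisE (negbTE ji).
Qed.

Definition corner i := xchoose (corner_ex i).

Lemma corner_vertex i : corner i \in vertices L.
Proof. by have /andP[] := xchooseP (corner_ex i). Qed.

Lemma pos_corner i : pos (corner i) = axis R i.
Proof. by have /andP[_ /eqP] := xchooseP (corner_ex i). Qed.

Lemma axis_inj : injective (axis R).
Proof.
move=> i j E; apply/eqP; have := congr1 (fun y : 'rV[R]_3 => y 0 i) E.
by rewrite !axisE eqxx; case: eqP => // _ /eqP; rewrite oner_eq0.
Qed.

Lemma corner_inj : injective corner.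
Proof. by move=> i j E; apply: axis_inj; rewrite -!pos_corner E. Qed.

Lemma eq_corner v i : v \in vertices L -> pos v = axis R i -> v = corner i.
Proof. by move=> vL vi; apply: (pos_inj tL) => //; [exact: corner_vertex|rewrite pos_corner]. Qed.

Lemma sigma_corner v : v \in sigma -> exists i, v = corner i.
Proof.
move=> vs; have [i vi] := sigma_axis vs; exists i; apply: eq_corner => //.
by move: vs; rewrite mem_sigma => /andP[].
Qed.

Lemma corner_sigma i : corner i \in sigma.
Proof. by apply: (axis_sigma (corner_vertex i) (pos_corner i)). Qed.

Lemma sigmaE : sigma = [set corner i | i : 'I_3].
Proof.
apply/setP => v; apply/idP/imsetP => [/sigma_corner[i ->]|[i _ ->]]; first by exists i.
exact: corner_sigma.
Qed.

Lemma card_sigma : #|sigma| = 3%N.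
Proof. by rewrite sigmaE card_imset ?card_ord //; apply: corner_inj. Qed.

(** A face covering the midpoint of the side, up to scaling, uses only vertices on that side. These
    are corners by assumption, and both are needed. *)
Lemma corner_edge i j : i != j -> [set corner i; corner j] \in L.
Proof.
move=> ij; pose y := axis R i + axis R j.
have y0 : nonneg y by move=> k; rewrite mxE addr_ge0 // axis_ge0.
have [s sL [a [a0 E]]] := cone_cover tL y0.
have sup v : v \in s -> a v != 0 -> v = corner i \/ v = corner j.
  move=> vs av; have vL := mem_vertices tL sL vs.
  have z k : k != i -> k != j -> pos v 0 k = 0.
    move=> ki kj; apply: (coord_face sL a0) vs av.
    by rewrite -E mxE !axisE (negbTE ki) (negbTE kj) addr0.
  have vsig : v \in sigma.
    rewrite mem_sigma vL; apply/existsP.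
    have [k ki kj] : exists2 k : 'I_3, k != i & k != j.
      by case: (ord3P i) (ord3P j) ij => -> [] -> // _;
         [exists o2|exists o1|exists o2|exists o0|exists o1|exists o0].
    by exists k; rewrite z.
  have [k vk] := sigma_axis vsig; have kij : (k == i) || (k == j).
    apply: contraT; rewrite negb_or => /andP[ki kj]; have := z _ ki kj.
    by rewrite vk axisE eqxx => /eqP; rewrite oner_eq0.
  by case/orP: kij => /eqP kE; [left|right]; apply: eq_corner; rewrite // vk kE.
have has k : (k == i) || (k == j) -> corner k \in s.
  move=> kij; apply: contraT => ks; have := congr1 (fun y : 'rV[R]_3 => y 0 k) E.
  rewrite mxE !axisE summxE big1 => [|v vs].
    by move: kij ij; case: (k =P i) => [->|_] /=; [move=> _ /negbTE ->|move=> -> _];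
       rewrite ?addr0 ?add0r => /eqP; rewrite oner_eq0.
  have [->|av] := eqVneq (a v) 0; first by rewrite scale0r mxE.
  rewrite mxE; have nk l : corner l \in s -> axis R l 0 k = 0.
    by move=> ls; rewrite axisE; case: eqP => // kl; rewrite kl ls in ks.
  have [vE|vE] := sup v vs av; rewrite vE in vs *; by rewrite pos_corner nk ?mulr0.
by apply: (face_sub tL sL); rewrite subUset !sub1set !has ?eqxx ?orbT.
Qed.

Lemma proper_sigma r : r \proper sigma -> exists i, corner i \notin r.
Proof.
by move=> /properP[_ [v /sigma_corner[i ->] vr]]; exists i.
Qed.

Lemma boundaryE r : r \in L -> (r \in B) = (r \proper sigma).
Proof.
move=> rL; rewrite inE rL /=; apply/existsP/idP => [[i /forall_inP ri]|rs].
  apply/properP; split.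
    apply/subsetP => v vr; rewrite mem_sigma (mem_vertices tL rL vr) /=.
    by apply/existsP; exists i; apply: ri.
  exists (corner i); first exact: corner_sigma.
  by apply/negP => /ri; rewrite pos_corner axisE eqxx oner_eq0.
have [i ir] := proper_sigma rs; exists i; apply/forall_inP => v vr.
have [j vj] := sigma_corner (subsetP (proper_sub rs) _ vr).
rewrite vj pos_corner axisE; case: (i =P j) => [ij|]; last by rewrite eqxx.
by rewrite ij -vj vr in ir.
Qed.

Lemma proper_sigma_face r : r \proper sigma -> r \in L.
Proof.
move=> rs; have [i ir] := proper_sigma rs.
have [j [k [jk jki]]] : exists j k : 'I_3, j != k /\ forall l, l != i -> l = j \/ l = k.
  by case: (ord3P i) => ->; [exists o1, o2|exists o0, o2|exists o0, o1]; split=> // l;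
     case: (ord3P l) => -> // _; auto.
apply: (face_sub tL (corner_edge jk)); apply/subsetP => v vr.
have [l vl] := sigma_corner (subsetP (proper_sub rs) _ vr).
have li : l != i by apply: contraNneq ir => <-; rewrite -vl.
by rewrite !inE vl; case: (jki l li) => ->; rewrite eqxx ?orbT.
Qed.

(** Any other vertex would lie in the hull of the corners, thus in the face [sigma] without being
    one of its vertices. *)
Lemma full_face : sigma \in L -> forall r, r \in L -> r \subset sigma.
Proof.
move=> sL r rL; apply/subsetP => u ur; apply: contraT => us.
have uL := mem_vertices tL rL ur; have uL' : [set u] \in L by rewrite inE in uL.
(* At the corner [i] this inner product is the [i]-th barycentric coordinate of [u]. *)
pose a v := \sum_i pos u 0 i * pos v 0 i.
have ac i : a (corner i) = pos u 0 i.
  rewrite /a (bigD1 i) //= pos_corner axisE eqxx mulr1 big1 ?addr0 // => j ji.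
  by rewrite axisE (negbTE ji) mulr0.
have E : comb [set u] (fun=> 1) = comb sigma a.
  rewrite comb1 scale1r /lincomb sigmaE big_imset /=; last by move=> i j _ _; apply: corner_inj.
  under eq_bigr => i _ do rewrite ac pos_corner.
  apply/rowP => k; rewrite summxE (bigD1 k) //= mxE axisE eqxx mulr1 big1 ?addr0 // => j jk.
  by rewrite mxE axisE eq_sym (negbTE jk) mulr0.
have : (1 : R) = 0.
  apply: (cone_inter tL uL' sL _ _ E (set11 u) us) => [v _|v vs]; first exact: ler01.
  have vL := mem_vertices tL sL vs.
  by apply: sumr_ge0 => i _; rewrite mulr_ge0 // (pos_ge0 tL).
by move/eqP; rewrite oner_eq0.
Qed.

Lemma nbrs_nonempty v : v \in vertices L -> nbrs L v != set0.
Proof.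
move=> vL; have vL' : [set v] \in L by rewrite inE in vL.
have [i vi] : exists i, pos v != axis R i.
  have [E|] := eqVneq (pos v) (axis R o0); last by exists o0.
  by exists o1; rewrite E (inj_eq axis_inj).
have [s sL [vs [a [a0 E]]]] := local_cover tL vL' (axis_ge0 R i).
apply: contra_neqN vi => /eqP N0; apply/esym.
have sv : s = [set v].
  apply/eqP; rewrite eqEsubset vs andbT; apply/subsetP => w ws; rewrite inE.
  apply: contraT => wv; have : w \in nbrs L v; last by rewrite N0 inE.
  by rewrite inE /neighbour wv (face_sub tL sL) // subUset vs sub1set.
rewrite sv comb1 in E; rewrite E; suff -> : a v = 1 by rewrite scale1r.
have := congr1 (fun y : 'rV[R]_3 => \sum_j y 0 j) E.
under [RHS]eq_bigr => j _ do rewrite mxE.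
rewrite -mulr_sumr (pos_sum tL vL) mulr1 => <-.
by rewrite (bigD1 i) //= axisE eqxx big1 ?addr0 // => j /negbTE ji; rewrite axisE ji.
Qed.

Lemma nbrsP v x : x \in nbrs L v -> nbr v x. Proof. by rewrite inE. Qed.

Lemma link_vertex v : v \in vertices L -> link L [set v] = lk L v (nbrs L v).
Proof.
move=> vL; apply/setP => t; rewrite [in RHS]inE; case tl : (t \in link L [set v]) => //=.
apply/esym/subsetP => x xt; move: tl.
rewrite (mem_link _ _ (cplxL tL)) disjoints1 => /andP[vt vtL].
rewrite inE /neighbour (face_sub tL vtL) ?setUS ?sub1set // andbT.
by apply: contraNneq vt => <-.
Qed.

Lemma det3_axis2 i j : i != j -> exists k,
  (forall y, det3 (axis R i) (axis R j) y = y 0 k) \/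
  (forall y, det3 (axis R j) (axis R i) y = y 0 k).
Proof.
move=> ij; case: (ord3P i) (ord3P j) ij => -> [] -> // _.
- by exists o2; left=> y; rewrite /det3 !axisE /=; ring.
- by exists o1; right=> y; rewrite /det3 !axisE /=; ring.
- by exists o2; right=> y; rewrite /det3 !axisE /=; ring.
- by exists o0; left=> y; rewrite /det3 !axisE /=; ring.
- by exists o1; left=> y; rewrite /det3 !axisE /=; ring.
- by exists o0; right=> y; rewrite /det3 !axisE /=; ring.
Qed.

Lemma det3_axis_npos i : exists j k, j != i /\ forall y, det3 (axis R i) (axis R j) y = - y 0 k.
Proof.
by case: (ord3P i) => ->; [exists o2, o1|exists o0, o2|exists o1, o0]; split=> // y;
   rewrite /det3 !axisE /=; ring.
Qed.

(** Of the two sides at a corner, one has the whole triangle on its nonpositive side, so its other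
    end has no successor and the link is a path. *)
Lemma red_corner_link i : red (link L [set corner i]) set0.
Proof.
have vL := corner_vertex i; rewrite link_vertex //.
apply: (lk_red0 tL vL (@nbrsP _) (nbrs_nonempty vL) (linked_nbrs tL (v := _))).
have [j [k [ji dk]]] := det3_axis_npos i.
have jN : corner j \in nbrs L (corner i).
  by rewrite inE /neighbour (inj_eq corner_inj) ji corner_edge // eq_sym.
apply/eqP => E; have : corner j \in has_fwd L pos (corner i) (nbrs L (corner i)) by rewrite E.
rewrite inE => /andP[_ /existsP[u /andP[/andP[_ uL]]]].
rewrite /angle_det !pos_corner dk oppr_gt0 ltNge (pos_ge0 tL) //.
by apply: (mem_vertices tL uL); rewrite !inE eqxx orbT.
Qed.

Lemma interior_pos r i : r \in L -> ~~ (r \proper sigma) -> 0 < (\sum_(v in r) pos v) 0 i.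
Proof.
move=> rL; rewrite -boundaryE // inE rL negb_exists => /forallP /(_ i).
rewrite negb_forall => /existsP[v]; rewrite negb_imply => /andP[vr vi].
have p0 w : w \in r -> 0 <= pos w 0 i by move=> wr; apply: (pos_ge0 tL (mem_vertices tL rL wr)).
rewrite summxE (bigD1 v) //= ltr_pwDl //; first by rewrite lt_def vi p0.
by apply: sumr_ge0 => w /andP[/p0].
Qed.

Lemma interior_side v w : v != w -> [set v; w] \in L -> ~~ ([set v; w] \proper sigma) ->
  exists2 u, [set v; w; u] \in L & 0 < ang v w u.
Proof.
move=> vw eL es; have [i di] := edge_axis tL vw eL.
have wv : w != v by rewrite eq_sym.
move: di; rewrite neq_lt => /orP[di|di]; last exact: (edge_cover tL wv eL (axis_ge0 R i)).
pose m := pos v + pos w.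
have mE : m = \sum_(x in [set v; w]) pos x by rewrite big_setU1 ?inE //= big_set1.
have mi : 0 < m 0 i by rewrite mE; apply: interior_pos.
(* When the [i]-th corner is on the wrong side, it is subtracted from the multiple of [m] with
   [i]-th coordinate 1. The result is still nonnegative, and [m], being on the line, does not affect
   the determinant. *)
apply: (edge_cover tL wv eL (y := (m 0 i)^-1 *: m - axis R i)) => [j|].
  have -> : ((m 0 i)^-1 *: m - axis R i) 0 j = (m 0 i)^-1 * m 0 j - (j == i)%:R.
    by rewrite -axisE !mxE.
  have [->|_] := eqVneq j i; first by rewrite mulVf ?subrr // lt0r_neq0.
  by rewrite subr0 mulr_ge0 ?invr_ge0 ?ltW // mE; apply: interior_pos.
have dm : det3 (pos v) (pos w) m = 0.
  by rewrite linearD /= det3_anti det3_alt1 det3_alt2 oppr0 addr0.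
by rewrite linearB linearZ /= dm scaler0 sub0r oppr_gt0.
Qed.

(** All edges at an interior vertex are interior, so every neighbour has a successor. *)
Lemma red_vertex_link v : v \in vertices L -> v \notin sigma ->
  exists2 tau : {set W}, #|tau| = 2%N & red (link L [set v]) [set tau].
Proof.
move=> vL vs; rewrite link_vertex //.
apply: (lk_red1 tL vL (@nbrsP _) (nbrs_nonempty vL) (linked_nbrs tL (v := _))).
apply/setP => w; rewrite inE; case nw : (w \in nbrs L v) => //=.
move: (nw); rewrite inE => /andP[wv vw].
have [||u uL du] := interior_side _ vw; first by rewrite eq_sym.
  by apply: contra vs => /proper_sub /subsetP; apply; rewrite !inE eqxx.
have [_ vu wu] := ang_neq (lt0r_neq0 du).
apply/existsP; exists u; rewrite /fwd uL du !andbT inE.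
by apply: (nbr_tri tL) uL; rewrite eq_sym.
Qed.

Lemma link_edge_cases v w t : v != w -> [set v; w] \in L -> t \in link L [set v; w] ->
  t = set0 \/ exists u, [/\ t = [set u], [set v; w; u] \in L & ang v w u != 0].
Proof.
move=> vw eL; rewrite (mem_link _ _ (cplxL tL)) => /andP[dt tE].
have := face_le3 tL tE; rewrite cardsU disjoint_setI0 // cards0 subn0 cards2 vw /=.
case tc : #|t| => [|[|//]] _; first by left; apply: cards0_eq.
right; move/eqP/cards1P: tc => [u tu]; exists u; move: dt tE; rewrite tu.
rewrite disjoint_sym disjoints1 !inE negb_or => /andP[uv uw] uL.
by split=> //; apply: (tri_ang tL) => //; rewrite eq_sym.
Qed.

Lemma mem_link_edge v w u : [set v; w; u] \in L -> ang v w u != 0 -> [set u] \in link L [set v; w].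
Proof.
move=> uL /ang_neq[vw vu wu]; rewrite (mem_link _ _ (cplxL tL)) uL andbT.
by rewrite disjoint_sym disjoints1 !inE negb_or [u == v]eq_sym vu [u == w]eq_sym wu.
Qed.

(** The triangle lies on one side of the edge, where there is exactly one third vertex; it is
    matched with the empty set. *)
Lemma red_boundary_edge v w k : v != w -> [set v; w] \in L ->
  (forall y, det3 (pos v) (pos w) y = y 0 k) ->
  red (link L [set v; w]) set0.
Proof.
move=> vw eL dk; have wv : w != v by rewrite eq_sym.
have [|u0 uL du] := edge_cover tL wv eL (axis_ge0 R k).
  by rewrite dk axisE eqxx.
apply: (@red_toggled _ u0).
have link0 : set0 \in link L [set v; w] := (link_complex (cplxL tL) eL).1.
have link1 := mem_link_edge uL (lt0r_neq0 du).
move=> t /(link_edge_cases vw eL)[->|[u1 [-> u1L du1]]]; first by rewrite setU0 set0D.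
have u10 : 0 < ang v w u1.
  rewrite lt_def du1 /angle_det dk (pos_ge0 tL) //.
  by apply: (mem_vertices tL u1L); rewrite !inE eqxx orbT.
by rewrite (succ_unique tL u1L uL u10 du) setUid setDv.
Qed.

(** There is one third vertex on each side; [u] is matched with the empty set and [u'] remains. *)
Lemma red_interior_edge v w : v != w -> [set v; w] \in L -> ~~ ([set v; w] \proper sigma) ->
  exists2 tau : {set W}, #|tau| = 1%N & red (link L [set v; w]) [set tau].
Proof.
move=> vw eL es; have [u uL du] := interior_side vw eL es.
have [|||u' uL' du'] := @interior_side w v; first by rewrite eq_sym.
- by rewrite setUC.
- by rewrite setUC.
rewrite set3S in uL'; have duu : ang v w u' < 0 by rewrite -oppr_gt0 -angS.
have uu' : u' != u by apply: contraTneq du => <-; rewrite -leNgt ltW.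
have l1 := mem_link_edge uL (lt0r_neq0 du).
have l2 := mem_link_edge uL' (ltr0_neq0 duu).
have l0 : set0 \in link L [set v; w] := (link_complex (cplxL tL) eL).1.
exists [set u']; first by rewrite cards1.
have -> : [set [set u']] = link L [set v; w] :\: [set set0; [set u]].
  apply/setP => t; rewrite in_setD in_set1; apply/eqP/andP => [->|[]].
    split=> //; rewrite !inE negb_or (inj_eq set1_inj) uu' andbT.
    by apply/eqP => /setP/(_ u'); rewrite !inE eqxx.
  rewrite in_set2 negb_or => /andP[t0 tu] /(link_edge_cases vw eL)[tE|[u1 [tE u1L du1]]].
    by rewrite tE eqxx in t0.
  rewrite tE in tu *; congr [set _]; move: du1; rewrite neq_lt => /orP[d|d]; last first.
    by rewrite (succ_unique tL u1L uL d du) eqxx in tu.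
  apply: (succ_unique tL (v := w) (w := v)) du' => //; try by rewrite set3S.
  by rewrite angS oppr_gt0.
apply: (@red1 _ u).
- by apply/subsetP => t; rewrite in_set2 => /orP[] /eqP ->.
- move=> s t _; rewrite !inE => /orP[] /eqP ->; first by rewrite subset0 => ->.
  by rewrite subset1 orbC.
move=> s; rewrite !inE => /orP[] /eqP ->; first by rewrite setU0 set0D !eqxx orbT.
by rewrite setUid setDv !eqxx orbT.
Qed.

Lemma disc_triangulation : disc L sigma.
Proof.
have cL := cplxL tL.
split=> //; [exact: card_sigma|exact: (face_le3 tL)|move=> r rs|move=> r rL rs|exact: full_face].
- have rL := proper_sigma_face rs; split=> //.
  have := proper_card rs; rewrite card_sigma; case rc: #|r| => [|[|[|//]]] _.
  + rewrite (cards0_eq rc) (_ : link L set0 = L); first exact: (red_triangulation tL).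
    by apply/setP => t; rewrite (mem_link _ _ cL) set0U -setI_eq0 set0I eqxx.
  + move/eqP/cards1P: rc => [v rv].
    have [i vi] : exists i, v = corner i.
      by apply/sigma_corner/(subsetP (proper_sub rs)); rewrite rv inE.
    by rewrite rv vi; apply: red_corner_link.
  move/eqP/cards2P: rc => [v [w [vw rvw]]].
  have [i vi] : exists i, v = corner i.
    by apply/sigma_corner/(subsetP (proper_sub rs)); rewrite rvw !inE eqxx.
  have [j wj] : exists j, w = corner j.
    by apply/sigma_corner/(subsetP (proper_sub rs)); rewrite rvw !inE eqxx orbT.
  have ij : i != j by apply: contraNneq vw => ij; rewrite vi wj ij.
  rewrite rvw in rL *; have [k [dk|dk]] := det3_axis2 ij.
    by apply: (@red_boundary_edge _ _ k) => //; rewrite vi wj !pos_corner.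
  rewrite setUC in rL *; rewrite eq_sym in vw.
  by apply: (@red_boundary_edge _ _ k) => //; rewrite vi wj !pos_corner.
have := face_le3 tL rL; case rc: #|r| => [|[|[|[|//]]]] _.
- case/negP: rs; rewrite (cards0_eq rc) properEneq sub0set andbT.
  by rewrite eq_sym -card_gt0 card_sigma.
- move/eqP/cards1P: rc => [v rv]; rewrite rv in rL rs *.
  apply: red_vertex_link; first by rewrite inE.
  by apply: contra rs => vs; rewrite properEcard sub1set vs cards1 card_sigma.
- move/eqP/cards2P: rc => [v [w [vw rvw]]]; rewrite rvw in rL rs *.
  exact: red_interior_edge.
exists set0; first by rewrite cards0.
rewrite (_ : link L r = [set set0]); first exact: red_refl.
apply/setP => t; rewrite [RHS]inE; apply/idP/eqP => [|->]; last exact: (link_complex cL rL).1.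
rewrite (mem_link _ _ cL) => /andP[rt /(face_le3 tL)].
rewrite cardsU disjoint_setI0 // cards0 rc subn0 => t3; apply: cards0_eq; move: t3.
by set n := #|t|; lia.
Qed.

End TriangulatedTriangle.

(** * Relabelling, cross-polytopes and conclusion *)

Section Relabelling.
Variables (W V : finType) (psi : W -> V) (D : {set W}).
Hypothesis psi_inj : {in D &, injective psi}.
Implicit Types (F G L : {set {set W}}) (r s t : {set W}).

Definition relabel F : {set {set V}} := [set psi @: (r : {set W}) | r in F].

Definition inside F := forall r, r \in F -> r \subset D.

Lemma mem_psi v r : v \in D -> r \subset D -> (psi v \in psi @: r) = (v \in r).
Proof.
move=> vD /subsetP rD; apply/imsetP/idP => [[w wr E]|vr]; last by exists v.
by rewrite (psi_inj vD (rD _ wr) E).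
Qed.

Lemma psi_sub r s : r \subset D -> s \subset D -> (psi @: r \subset psi @: s) = (r \subset s).
Proof.
move=> rD sD; apply/idP/idP => [rs|]; last exact: imsetS.
apply/subsetP => v vr; have vD := subsetP rD _ vr.
by rewrite -(mem_psi vD sD) (subsetP rs) // imset_f.
Qed.

Lemma psi_set_inj r s : r \subset D -> s \subset D -> psi @: r = psi @: s -> r = s.
Proof.
move=> rD sD E; apply/eqP; rewrite eqEsubset -(psi_sub rD sD) -(psi_sub sD rD) E.
by rewrite subxx.
Qed.

Lemma card_psi r : r \subset D -> #|psi @: r| = #|r|.
Proof. by move=> /subsetP rD; apply: card_in_imset => v w /rD vD /rD wD; apply: psi_inj. Qed.

Lemma mem_relabel F r : inside F -> r \subset D -> (psi @: r \in relabel F) = (r \in F).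
Proof.
move=> FD rD; apply/imsetP/idP => [[s sF E]|rF]; last by exists r.
by rewrite (psi_set_inj rD (FD _ sF) E).
Qed.

Lemma sub_psi (t : {set V}) r : t \subset psi @: r -> exists2 s : {set W}, s \subset r & t = psi @: s.
Proof.
move=> tr; exists (r :&: psi @^-1: t); first exact: subsetIl.
apply/setP => x; apply/idP/imsetP => [xt|[v + ->]]; last by rewrite !inE => /andP[].
have /imsetP[v vr xv] := subsetP tr _ xt.
by exists v; rewrite // !inE vr -xv.
Qed.

Lemma red_relabel F F' : inside F -> red F F' -> red (relabel F) (relabel F').
Proof.
move=> + rF; elim: rF => {F F'} [F|v F G F' GF lG tG _ IH] FD; first exact: red_refl.
have GD : inside G by move=> r /(subsetP GF); apply: FD.
(* Only a nonempty [G] guarantees that the toggled vertex lies in [D], where [psi] is injective. *)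
have [G0|[g gG]] := set_0Vmem G; first by rewrite G0 setD0 in IH; apply: IH.
have vD : v \in D by apply: (subsetP (GD _ (tG _ gG).1)); rewrite setU11.
have E : relabel (F :\: G) = relabel F :\: relabel G.
  apply/setP => t; rewrite inE; apply/imsetP/andP => [[r /setDP[rF rG] ->]|[tG' /imsetP[r rF tr]]].
    by rewrite !mem_relabel ?FD.
  exists r => //; rewrite inE rF andbT; apply: contra tG' => rG.
  by rewrite tr mem_relabel ?FD.
apply: (@red_step _ (psi v) _ (relabel G)).
- by apply/subsetP => t /imsetP[r rG ->]; apply/imset_f/(subsetP GF).
- move=> s t /imsetP[r rF ->] /imsetP[r' rG ->]; rewrite (psi_sub (FD _ rF) (GD _ rG)) => rr.
  by rewrite (mem_relabel GD (FD _ rF)); apply: lG rF rG rr.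
- move=> s /imsetP[r rG ->]; have [vr rv] := tG _ rG; split.
    by rewrite -imset_set1 -imsetU imset_f.
  suff -> : psi @: r :\ psi v = psi @: (r :\ v) by rewrite imset_f.
  apply/setP => x; rewrite !inE; apply/andP/imsetP => [[xv /imsetP[w wr xw]]|[w]].
    by exists w; rewrite // !inE wr andbT; apply: contraNneq xv => <-; rewrite xw.
  rewrite !inE => /andP[wv wr] ->; rewrite imset_f //; split=> //.
  by apply: contra_neq wv; apply: psi_inj; rewrite // (subsetP (GD _ rG)).
by rewrite -E; apply: IH => r /setDP[rF _]; apply: FD.
Qed.

Lemma relabel_complex L : is_complex L -> is_complex (relabel L).
Proof.
move=> [L0 Ls]; split; first by apply/imsetP; exists set0; rewrite // imset0.
by move=> _ t /imsetP[r rL ->] /sub_psi[s sr ->]; apply/imset_f/(Ls r).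
Qed.

Lemma relabel_link L r : inside L -> is_complex L -> r \in L ->
  link (relabel L) (psi @: r) = relabel (link L r).
Proof.
move=> LD cL rL; have cL' := relabel_complex cL.
have dis t : t \in L -> [disjoint psi @: r & psi @: t] = [disjoint r & t].
  move=> tL; rewrite -!setI_eq0 -imsetI ?imset_eq0 //.
  by move=> v w vr wt; apply: psi_inj; [apply: (subsetP (LD _ rL))|apply: (subsetP (LD _ tL))].
apply/setP => x; rewrite (mem_link _ _ cL'); apply/idP/imsetP => [/andP[d xL]|[t tl ->]].
  have /imsetP[t tL xt] : x \in relabel L by apply: (cL'.2 _ _ xL); apply: subsetUr.
  rewrite xt in d xL *; exists t => //; rewrite (mem_link _ _ cL) -dis // d.
  by move: xL; rewrite -imsetU mem_relabel // subUset !LD.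
have tL : t \in L by move: tl; rewrite inE => /andP[].
move: tl; rewrite (mem_link _ _ cL) => /andP[d rtL].
by rewrite dis // d -imsetU imset_f.
Qed.

Lemma disc_relabel L (sigma : {set W}) : inside L -> disc L sigma ->
  disc (relabel L) (psi @: sigma).
Proof.
move=> LD dL; have cL := disc_complex dL.
have sD : sigma \subset D.
  apply/subsetP => x xs; have : [set x] \in L; last by move/LD; rewrite sub1set.
  by apply: (disc_bdry dL _).1; rewrite properEcard sub1set xs cards1 (disc_card dL).
have lD r : inside (link L r) by move=> t; rewrite inE => /andP[/LD].
split.
- exact: relabel_complex.
- by rewrite card_psi // (disc_card dL).
- by move=> _ /imsetP[r rL ->]; rewrite card_psi ?LD //; apply: (disc_le3 dL).
- move=> t ts; have [r rs tr] := sub_psi (proper_sub ts).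
  have rp : r \proper sigma.
    have rD := subset_trans rs sD.
    by move: ts; rewrite tr !properE (psi_sub rD sD) (psi_sub sD rD).
  have [rL rr] := disc_bdry dL rp; rewrite tr; split; first exact: imset_f.
  rewrite relabel_link // (_ : set0 = relabel set0); first exact: red_relabel.
  by rewrite /relabel imset0.
- move=> _ /imsetP[r rL ->] rs.
  have rp : ~~ (r \proper sigma).
    by apply: contra rs; rewrite !properE (psi_sub (LD _ rL) sD) (psi_sub sD (LD _ rL)).
  have [tau tauc rtau] := disc_int dL rL rp; exists (psi @: tau).
    have tl : tau \in link L r by apply: (subsetP (red_sub rtau)); apply: set11.
    by rewrite (card_psi (lD _ _ tl)) (card_psi (LD _ rL)).
  rewrite relabel_link // (_ : [set psi @: tau] = relabel [set tau]); first exact: red_relabel.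
  by rewrite /relabel imset_set1.
move=> sL _ /imsetP[r rL ->]; apply: imsetS; apply: (disc_full dL) => //.
by rewrite -(mem_relabel LD sD).
Qed.

End Relabelling.

(** * The cross-polytope boundary as an iterated suspension *)

Section Suspension.
Variables (A : comNzRingType) (V : finType).
Implicit Types (F G K : {set {set V}}) (s t u : {set V}).

Definition two_points (x y : V) : {set {set V}} := [set set0; [set x]; [set y]].

Lemma two_points_complex x y : is_complex (two_points x y).
Proof.
split=> [|s t]; rewrite !inE ?eqxx // => /orP[/orP[]|] /eqP ->.
- by rewrite subset0 => ->.
- by rewrite subset1 => /orP[] ->; rewrite ?orbT.
by rewrite subset1 => /orP[] ->; rewrite ?orbT.
Qed.

Lemma set1_neq0 (x : V) : [set x] != set0.
Proof. by apply/set0Pn; exists x; rewrite inE. Qed.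

Lemma hpol_two_points x y : x != y -> hpol 1 (two_points x y) = 1 + 'X.
Proof.
move=> xy; rewrite /hpol /two_points -setUA big_setU1 ?big_setU1 ?big_set1 /=.
- by rewrite cards0 !cards1 subnn !expr0 !expr1 mul1r mulr1; ring.
- by rewrite inE (inj_eq set1_inj).
by rewrite !inE negb_or ![set0 == _]eq_sym !set1_neq0.
Qed.

Lemma red_two_points x y : x != y -> red (two_points x y) [set [set y]].
Proof.
move=> xy.
have -> : [set [set y]] = two_points x y :\: [set set0; [set x]].
  apply/setP => t; rewrite !inE; case: (t =P [set y]) => [->|_]; last by rewrite orbF andNb.
  by rewrite (negbTE (set1_neq0 y)) (inj_eq set1_inj) eq_sym (negbTE xy).
apply: (@red1 _ x).
- by apply/subsetP => t; rewrite !inE => ->.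
- move=> s t _; rewrite !inE => /orP[] /eqP ->; first by rewrite subset0 => ->.
  by rewrite subset1 orbC.
move=> s; rewrite !inE => /orP[] /eqP ->; first by rewrite setU0 set0D !eqxx orbT.
by rewrite setUid setDv !eqxx orbT.
Qed.

Lemma link_two_points x y : link (two_points x y) set0 = two_points x y.
Proof.
by apply/setP => t; rewrite (mem_link _ _ (two_points_complex x y)) set0U -setI_eq0 set0I eqxx.
Qed.

Lemma link_point x y p : x != y -> p \in [set x; y] -> link (two_points x y) [set p] = [set set0].
Proof.
move=> xy pxy; apply/setP => t; rewrite (mem_link _ _ (two_points_complex x y)) [RHS]in_set1 disjoints1.
apply/andP/eqP => [[pt]|->]; last first.
  by rewrite setU0 inE; move: pxy; rewrite !inE => /orP[] /eqP ->; rewrite eqxx ?orbT.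
rewrite !inE => H; apply: contraNeq pt => /set0Pn[q qt].
have [z E] : exists z, p |: t = [set z].
  case/orP: H => [/orP[]|] /eqP E; [|by exists x|by exists y].
  by have := set1_neq0 p; rewrite -subset0 -E subsetUl.
have := setU11 p t; rewrite E inE => /eqP ->.
by have : q \in p |: t by [rewrite inE qt orbT]; rewrite E inE => /eqP <-.
Qed.

Lemma jn_point (G : {set {set V}}) : jn [set set0] G = G.
Proof.
apply/setP => s; apply/jnP/idP => [[r [t [/set1P-> tG ->]]]|sG]; first by rewrite set0U.
by exists set0, s; rewrite inE set0U.
Qed.

(** The link of a face is the suspension of a link of [K] if the face avoids both new points, and a
    link of [K] itself otherwise. *)
Lemma good_suspension n K x y : good A n K -> x != y ->
  x \notin vertices K -> y \notin vertices K -> good A n.+1 (jn (two_points x y) K).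
Proof.
move=> [cK gK] xy xK yK; pose D := [set x; y].
have sD : separates D (two_points x y) K.
  split=> [r|t tK]; first by rewrite !inE => /orP[/orP[]|] /eqP ->; rewrite ?sub0set ?sub1set /D ?inE ?eqxx ?orbT.
  have no p : p \notin vertices K -> p \notin t.
    by apply: contra => pt; apply: (subsetP (sub_vertices cK tK)).
  by rewrite disjoint_sym disjoint_subset; apply/subsetP => p; rewrite !inE => /orP[] /eqP ->; apply: no.
have cP := two_points_complex x y; have cJ := jn_complex sD cP cK.
split=> // s sJ; have := sJ; rewrite (mem_jn_split _ sD) => /andP[rP uK].
rewrite (link_jn sD cP cK sJ).
have [uc sph gp] := gK _ uK; set u := s :\: D in uK uc sph gp *.
have sc : #|s| = (#|s :&: D| + #|u|)%N by rewrite cardsID.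
have cLu := link_complex cK uK.
have Lu_card t : t \in link K u -> (#|t| <= n - #|u|)%N.
  rewrite (mem_link _ _ cK) => /andP[ut /gK[]].
  by rewrite cardsU disjoint_setI0 // cards0 subn0 => le _ _; rewrite leq_subRL.
have [r0|rn0] := eqVneq (s :&: D) set0.
  rewrite r0 cards0 add0n in sc; rewrite r0 link_two_points sc.
  have sD' : separates D (two_points x y) (link K u).
    by split=> t; [apply: sD.1|rewrite inE => /andP[/sD.2]].
  have P1 t : t \in two_points x y -> (#|t| <= 1)%N.
    by rewrite !inE => /orP[/orP[]|] /eqP ->; rewrite ?cards0 ?cards1.
  split; first exact: leqW.
    rewrite (red_sphere A _ _ (red_jn sD' (red_two_points xy))); last first.
      by apply: convex_complex; apply: jn_complex sD' cP cLu.
    rewrite subSn // -addn1 -(cards1 y); apply: jn1_sphere sph => t /sD'.2.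
    by rewrite disjoint_sym; apply: disjointWl; rewrite sub1set !inE eqxx orbT.
  rewrite subSn // -add1n (hpol_jn sD' P1 Lu_card) hpol_two_points //.
  exact: gposM gpos_X1 gp.
have [p pD pr] : exists2 p, p \in [set x; y] & s :&: D = [set p].
  move: rP; rewrite !inE (negbTE rn0) /= => /orP[] /eqP ->; [exists x|exists y] => //;
  by rewrite !inE eqxx ?orbT.
rewrite pr cards1 add1n in sc; rewrite pr link_point // jn_point sc subSS.
by split.
Qed.

End Suspension.

Section CrossPolytope.
Variables (A : comNzRingType) (V : finType) (d : nat) (iota : 'I_d * bool -> V).
Hypothesis iota_inj : injective iota.

(** The cross-polytope on the first [j] axes, realised inside [V] so that each further axis is a
    suspension. *)
Definition crossp (j : nat) : {set {set V}} :=
  [set F : {set V} | (F \subset [set iota p | p : 'I_d * bool & (p.1 < j)%N]) &&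
           [forall i, ~~ ((iota (i, true) \in F) && (iota (i, false) \in F))]].

Lemma crosspE : crossp d = [set iota @: s | s : {set 'I_d * bool} in cross_polytope d].
Proof.
apply/setP => F; rewrite inE; apply/andP/imsetP => [[FI /forallP Fp]|[s + ->]].
  exists (iota @^-1: F).
    by rewrite inE; apply/forallP => i; rewrite !inE.
  apply/setP => x; apply/idP/imsetP => [xF|[p + ->]]; last by rewrite inE.
  by have /imsetP[p _ xp] := subsetP FI _ xF; exists p; rewrite // inE -xp.
rewrite inE => /forallP sp; split.
  by apply/subsetP => _ /imsetP[p _ ->]; apply: imset_f; rewrite inE.
by apply/forallP => i; rewrite !(mem_imset _ _ iota_inj).
Qed.

Lemma crosspS (j : 'I_d) :
  crossp j.+1 = jn (two_points (iota (j, true)) (iota (j, false))) (crossp j).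
Proof.
set a := iota (j, true); set b := iota (j, false).
apply/setP => F; rewrite inE; apply/andP/jnP => [[FI /forallP Fp]|].
  exists (F :&: [set a; b]), (F :\: [set a; b]); split.
  - have := Fp j; rewrite -/a -/b !inE => ab.
    case aF: (a \in F) ab => /= ab.
      suff -> : F :&: [set a; b] = [set a] by rewrite eqxx orbT.
      apply/setP => x; rewrite !inE; case: (x =P a) => [->|_] /=; first by rewrite aF.
      by case: (x =P b) => [->|_]; rewrite ?andbF // (negbTE ab).
    case bF: (b \in F).
      suff -> : F :&: [set a; b] = [set b] by rewrite eqxx orbT.
      apply/setP => x; rewrite !inE; case: (x =P b) => [->|_] /=; first by rewrite bF orbT.
      by case: (x =P a) => [->|_]; rewrite ?andbF // aF.
    suff -> : F :&: [set a; b] = set0 by rewrite eqxx.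
    apply/setP => x; rewrite !inE; case: (x =P a) => [->|_] /=; first by rewrite aF.
    by case: (x =P b) => [->|_]; rewrite ?andbF // bF.
  - rewrite inE; apply/andP; split; last first.
      by apply/forallP => i; apply: contra (Fp i) => /andP[]; rewrite !inE => /andP[_ ->] /andP[_ ->].
    apply/subsetP => x; rewrite !inE negb_or => /andP[/andP[xa xb] xF].
    have /imsetP[[i c] + xp] := subsetP FI _ xF; rewrite inE /= ltnS leq_eqVlt => /orP[/eqP ij|ij].
      have E : i = j by apply: val_inj.
      by move: xa xb; rewrite xp E /a /b; case: c {xp}; rewrite eqxx.
    by rewrite xp; apply: imset_f; rewrite inE.
  by rewrite setID.
move=> [r [t [rP]]]; rewrite inE => /andP[tI /forallP tp] ->.
have tj c : iota (j, c) \notin t.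
  by apply/negP => /(subsetP tI) /imsetP[p + /iota_inj pj]; rewrite inE -pj /= ltnn.
have rsub : r \subset [set a; b].
  by move: rP; rewrite !inE => /orP[/orP[]|] /eqP ->; rewrite ?sub0set // sub1set !inE eqxx ?orbT.
split.
  apply/subsetP => x; rewrite inE => /orP[/(subsetP rsub)|/(subsetP tI)].
    by rewrite !inE => /orP[] /eqP ->; apply: imset_f; rewrite inE /= ltnSn.
  by case/imsetP => p; rewrite inE => pj ->; apply: imset_f; rewrite inE leqW.
apply/forallP => i; have [->|ij] := eqVneq i j.
  rewrite !inE (negbTE (tj true)) (negbTE (tj false)) !orbF.
  have ab : a != b by apply/eqP => /iota_inj.
  move: rP; rewrite !inE => /orP[/orP[]|] /eqP ->; rewrite !inE ?andbF //.
    by rewrite eqxx /= eq_sym.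
  by rewrite eqxx andbT.
have ri c : iota (i, c) \notin r.
  apply/negP => /(subsetP rsub); rewrite !inE => /orP[] /eqP /iota_inj [E _]; by rewrite E eqxx in ij.
by rewrite !inE (negbTE (ri true)) (negbTE (ri false)) /=.
Qed.

(** The complex with the empty face only is the (-1)-sphere, the start of the suspensions. *)
Lemma good_point : good A 0 [set set0 : {set V}].
Proof.
have c0 : is_complex [set set0 : {set V}].
  by split=> [|s t]; rewrite !inE // => /eqP ->; rewrite subset0.
split=> // s; rewrite inE => /eqP ->; rewrite cards0.
have -> : link [set set0] set0 = [set set0 : {set V}].
  by apply/setP => t; rewrite (mem_link _ _ c0) set0U -setI_eq0 set0I eqxx.
split=> //; last by rewrite /hpol big_set1 cards0 !expr0 mulr1; apply: gpos1.
split=> [k c k0 [Fc _]|].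
  exists 0 => [t|t tF]; first by rewrite ffunE eqxx.
  rewrite bdry0 ffunE (chain_card Fc) //; move: tF; rewrite inE => /eqP ->.
  by rewrite cards0 eq_sym; apply/eqP.
pose z : {ffun {set V} -> A^o} := [ffun s => if s == set0 then 1 else 0].
have Fz : chain [set set0] 0 z.
  move=> t; rewrite ffunE; case: (t =P set0) => [->|_]; last by rewrite eqxx.
  by rewrite inE eqxx cards0.
have noc c : chain [set set0 : {set V}] 1 c -> c = 0.
  move=> Fc; apply/ffunP => t; rewrite ffunE; apply/eqP; apply: contraT => /Fc[].
  by rewrite inE => /eqP ->; rewrite cards0.
exists z; split.
- split=> // t; rewrite inE => /eqP ->; apply: bdry_at0 => v _.
  by rewrite ffunE setU0 (negbTE (set1_neq0 v)).
- move=> c [Fc _]; exists (c set0); exists 0 => [t|t]; first by rewrite ffunE eqxx.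
  rewrite inE => /eqP ->; rewrite bdry0 ffunE chainB_at chainZ_at ffunE eqxx.
  by rewrite mulr1 subrr.
move=> a [c /noc -> /(_ set0)]; rewrite inE eqxx bdry0 chainZ_at !ffunE eqxx mulr1.
by move=> /(_ isT) ->.
Qed.

Lemma good_crossp j : (j <= d)%N -> good A j (crossp j).
Proof.
elim: j => [|j IH] jd.
  have -> : crossp 0 = [set set0]; last exact: good_point.
  apply/setP => F; rewrite !inE; apply/andP/eqP => [[FI _]|->].
    apply/eqP; rewrite -subset0; apply: subset_trans FI _.
    by apply/subsetP => x /imsetP[p]; rewrite inE ltn0.
  by rewrite sub0set; split=> //; apply/forallP => i; rewrite !inE.
rewrite (crosspS (Ordinal jd)); apply: good_suspension; first exact: IH (ltnW jd).
- by apply/eqP => /iota_inj.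
- rewrite !inE sub1set negb_and; apply/orP; left; apply/negP => /imsetP[p + /iota_inj E].
  by rewrite inE -E /= ltnn.
rewrite !inE sub1set negb_and; apply/orP; left; apply/negP => /imsetP[p + /iota_inj E].
by rewrite inE -E /= ltnn.
Qed.

(** A missing face is an antipodal pair or a single element of [V] that is not a vertex. *)
Lemma missing_crossp (F : {set V}) : missing_face (crossp d) F -> (#|F| <= 2)%N.
Proof.
move=> [FK Fp]; have small (Q : {set V}) : Q \subset F -> Q \notin crossp d -> F = Q.
  move=> QF QK; apply/esym/eqP; apply: contraNT QK => QF'.
  by apply: Fp; rewrite properEneq QF' QF.
have [FI|] := boolP (F \subset [set iota p | p : 'I_d * bool & (p.1 < d)%N]); last first.
  case/subsetPn => x xF xI; rewrite (small [set x]) ?cards1 ?sub1set //.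
  by rewrite inE sub1set (negbTE xI).
move: (FK); rewrite inE FI negb_forall => /existsP[i]; rewrite negbK => /andP[i1 i2].
rewrite (small [set iota (i, true); iota (i, false)]).
- by rewrite cards2; case: (_ != _).
- by rewrite subUset !sub1set i1.
rewrite inE negb_and negb_forall; apply/orP; right; apply/existsP; exists i.
by rewrite !inE !eqxx orbT.
Qed.

End CrossPolytope.

Lemma good_HS (A : comNzRingType) (V : finType) d (K : {set {set V}}) : good A d K ->
  (forall F : {set V}, missing_face K F -> (#|F| <= 3)%N) ->
  HS A 2 d K /\ exists g : 'I_(d./2).+1 -> int, is_g2 d K g /\ (forall k, 0 <= g k).
Proof.
move=> [cK gK] mK; have K0 : set0 \in K := cK.1.
have link0 : link K set0 = K.
  by apply/setP => t; rewrite (mem_link _ _ cK) set0U -setI_eq0 set0I eqxx.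
have [_ sph gp] := gK _ K0; rewrite cards0 subn0 link0 in sph gp.
have rkK : rk K = d.
  apply/eqP; rewrite eqn_leq; apply/andP; split.
    by apply/bigmax_leqP => s /gK[].
  (* Without a face of size [d] the generator in degree [d] would be the zero chain, which bounds,
     and 1 would be 0. *)
  have [s sK sd] : exists2 s, s \in K & #|s| = d.
    apply: contrapT => no; case: sph => _ [z [[zc _] _ z1]].
    have z0 : z = 0.
      apply/ffunP => s; rewrite ffunE; apply/eqP; apply: contraT => /zc[sK sd].
      by case: no; exists s.
    suff /z1/eqP : rbound K d (1 *: z) by rewrite oner_eq0.
    rewrite z0 scaler0; exists 0 => [t|t _]; last by rewrite bdry0.
    by rewrite ffunE eqxx.
  by rewrite /rk (bigD1 s) //= sd leq_maxl.
split.
  split; last exact: mK.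
  split=> // s sK; have [_ sp _] := gK _ sK.
  by apply/(rsphereP A _ (link_complex cK sK)).
have [g [gE g0]] := gpos_coef gp; exists g; split=> //.
by rewrite /is_g2 (hpolyE rkK) gE.
Qed.

(** * Iterating the replacement step *)

Section Main.
Variables (R : realType) (A : comNzRingType) (W V : finType).
Variables (L : {set {set W}}) (pos : W -> 'rV[R]_3).
Hypothesis tL : triangulates_simplex L pos.
Hypothesis oL : only_original_boundary_vertices L pos.
Local Notation B := (boundary_complex L pos).

Lemma step_disc d (s : {set V}) K1 K2 : good A d K1 ->
  (forall F : {set V}, missing_face K1 F -> (#|F| <= 3)%N) -> s \in K1 ->
  tcheb_step L B s K1 K2 ->
  [/\ good A d K2, (forall F : {set V}, missing_face K2 F -> (#|F| <= 3)%N) &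
      forall t : {set V}, t \in K1 -> ~~ (s \subset t) -> t \in K2].
Proof.
move=> gK mK sK [psi [psi_inj psiB new K2E]].
have dL := disc_triangulation tL oL.
have LD : inside (vertices L) L by move=> r rL; apply: sub_vertices (disc_complex dL) rL.
have dL' := disc_relabel psi_inj LD dL; rewrite psiB in dL'.
have new' x : x \in vertices (relabel psi L) -> x \notin s -> x \notin vertices K1.
  rewrite inE => /imsetP[r rL xr] xs.
  have /imsetP[v vr xv] : x \in psi @: r by rewrite -xr inE.
  rewrite xv; apply: new; first by apply: (subsetP (LD _ rL)).
  by apply: contra xs => vB; rewrite xv -psiB imset_f.
have E : K2 = (K1 :\: [set s :|: t | t in link K1 s]) :|: jn (relabel psi L) (link K1 s).
  rewrite K2E; congr (_ :|: _); apply/setP => x; apply/imset2P/jnP.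
    by move=> [r t rL tl ->]; exists (psi @: r), t; rewrite imset_f.
  by move=> [_ [t [/imsetP[r rL ->] tl ->]]]; exists r t.
rewrite E; split.
- exact: (good_step gK sK dL' new').
- exact: (missing_step gK dL' new' mK).
move=> t tK st; rewrite in_setU in_setD tK andbT; apply/orP; left.
by apply: contra st => /imsetP[u _ ->]; apply: subsetUl.
Qed.

End Main.

Theorem theorem9p6 (R : realType) (A : comNzRingType) (W V : finType)
    (L : {set {set W}}) (pos : W -> 'rV[R]_3) (d : nat)
    (K K' : {set {set V}}) :
  triangulates_simplex L pos ->
  only_original_boundary_vertices L pos ->
  (1 <= d)%N ->
  is_cross_polytope d K ->
  gen_tchebyshev L (boundary_complex L pos) K K' ->
  HS A 2 d K' /\
  exists g : 'I_(d./2).+1 -> int, is_g2 d K' g /\ (forall k, 0 <= g k).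
Proof.
move=> tL oL _ [iota iota_inj KE] [sigma [Ks [us sP K0 <- steps]]].
rewrite -(crosspE iota_inj) in KE.
(* Besides the two invariants, the triangles still waiting for replacement must remain faces. *)
have all l : (l <= size sigma)%N ->
  [/\ good A d (Ks l), (forall F : {set V}, missing_face (Ks l) F -> (#|F| <= 3)%N) &
      forall t, t \in drop l sigma -> t \in Ks l].
  elim: l => [|l IH] lt.
    rewrite drop0 K0 KE; split; first exact: good_crossp.
      by move=> F /missing_crossp /leqW.
    by move=> t; rewrite sP KE => /andP[].
  have [gK mK inK] := IH (ltnW lt).
  have dE := drop_nth set0 lt.
  have [|gK2 mK2 old] := step_disc tL oL gK mK _ (steps l lt).
    by apply: inK; rewrite dE mem_head.
  split=> // t td; apply: old; first by apply: inK; rewrite dE inE td orbT.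
  (* A pending triangle is destroyed only if it contains the current one; equal sizes would make
     them equal, against [uniq sigma]. *)
  apply/negP => st; have := drop_uniq l us; rewrite dE /= => /andP[/negP nin _]; apply: nin.
  have card3 x : x \in sigma -> #|x| = 3%N by rewrite sP => /andP[_ /eqP].
  have /eqP -> // : nth set0 sigma l == t.
  by rewrite eqEcard st !card3 // ?mem_nth // (mem_drop td).
have [gK mK _] := all _ (leqnn _).
exact: good_HS gK mK.
Qed.
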